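(* Let $\mu$ be a translation bounded measure on $G$ with hull $\mathbb{X}(\mu)$, and let $\mathcal{A}$ be a van Hove sequence on $G$. Then $\mu$ is Besicovitch almost periodic with respect to $\mathcal{A}$ if and only if there exists a $G$-invariant probability measure $\mathfrak{m}$ on $\mathbb{X}(\mu)$ with pure point spectrum such that $\mu$ is a Wiener--Wintner point for $\mathfrak{m}$ and $\mathcal{A}$. Moreover, in this case, $\mathfrak{m}$ is ergodic.
   Context: $G$ is a locally compact (Hausdorff), $\sigma$-compact abelian group with Haar measure $\theta_G$; $|A|=\theta_G(A)$, $\mathrm{d}t$ is integration against $\theta_G$, and $\widehat{G}$ is the dual group. A measure on $G$ is a (complex) Radon measure; $|\mu|$ is its total variation. $\mu$ is translation bounded if $\sup_{t\in G}|\mu|(t+V)<\infty$ for one (equivalently every) nonempty open relatively compact $V$. $(\mu*\varphi)(t)=\int_G\varphi(t-s)\,\mathrm{d}\mu(s)$ for $\varphi\in C_c(G)$; $\tau_t\mu=\delta_t*\mu$. A van Hove sequence $\mathcal{A}=(A_n)$ is a sequence of relatively compact open sets (of positive measure) with $|\partial^K A_n|/|A_n|\to 0$ for every compact $K\subseteq G$, where $\partial^K A=\big(\overline{A+K}\cap\overline{A^c}\big)\cup\big(\overline{A^c-K}\cap\overline{A}\big)$. For $f\in\mathcal{L}^1_{loc}(G)$ put $\|f\|_{\mathsf{B},1,\mathcal{A}}=\limsup_n\frac{1}{|A_n|}\int_{A_n}|f(t)|\,\mathrm{d}t$. A function $f\in\mathcal{L}^1_{loc}(G)$ is Besicovitch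 almost periodic with respect to $\mathcal{A}$ if for each $\varepsilon>0$ there is a trigonometric polynomial $P$ (finite linear combination of characters) with $\|f-P\|_{\mathsf{B},1,\mathcal{A}}<\varepsilon$; a measure $\mu$ is Besicovitch almost periodic with respect to $\mathcal{A}$ if all $\mu*\varphi$, $\varphi\in C_c(G)$, are. The hull $\mathbb{X}(\mu)$ is the vague closure of $\{\tau_t\mu:t\in G\}$; it is vaguely compact, $G$ acts continuously on it by $(t,\omega)\mapsto\tau_t\omega$, and it is assumed to be metrisable (automatic if $G$ is second countable). Let $\mathfrak{m}$ be a $G$-invariant probability measure on $\mathbb{X}(\mu)$. A nonzero $f\in L^2(\mathbb{X}(\mu),\mathfrak{m})$ is an eigenfunction with eigenvalue $\chi\in\widehat G$ if $f(\tau_{-t}\,\cdot)=\chi(t)f$ in $L^2$ for all $t\in G$; $\mathbb{S}$ is the set of eigenvalues and $\mathbb{E}_\chi$ the eigenspace of $\chi$. $\mathfrak{m}$ has pure point spectrum if $L^2(\mathbb{X}(\mu),\mathfrak{m})$ has an orthonormal basis of eigenfunctions. $\mathfrak{m}$ is ergodic if every measurable $G$-invariant set has measure $0$ or $1$. The point $\mu$ is a Wiener--Wintner point for $\mathfrak{m}$ and $\mathcal{A}$ if for each $\chi\in\mathbb{S}$ there is a basis $B_\chi$ of $\mathbb{E}_\chi$ consisting of unit vectors such that for all $f\in C(\mathbb{X}(\mu))$, all $\chi\in\mathbb{S}$ and all $e_\chi\in B_\chi$: $\int_{\mathbb{X}(\mu)}f\,\overline{e_\chi}\,\mathrm{d}\mathfrak{m}=\lim_{n\to\infty}\frac{1}{|A_n|}\int_{A_n}\overline{\chi(t)}\,f(\tau_{-t}\mu)\,\mathrm{d}t$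 (in particular the limit exists). (This forces each $\mathbb{E}_\chi$, $\chi\in\mathbb{S}$, to be one-dimensional.) *)

(* Defs.v *)
From HB Require Import structures.
From mathcomp Require Import all_boot all_order all_algebra.
From mathcomp Require Import all_classical all_reals all_analysis.
From mathcomp Require Import complex.
Set Implicit Arguments.
Unset Strict Implicit.
Unset Printing Implicit Defensive.
Import Order.TTheory GRing.Theory Num.Theory.
Import numFieldNormedType.Exports.
Local Open Scope classical_set_scope.
Local Open Scope ring_scope.

(* The complex numbers over R, packed as a numClosedFieldType so that they
   inherit the norm topology. *)
Definition Cx (R : realType) : numClosedFieldType := R[i]%C.

Definition ofR (R : realType) (x : R) : Cx R := x%:C%C.
Definition reC (R : realType) (z : Cx R) : R := complex.Re z.
Definition imC (R : realType) (z : Cx R) : R := complex.Im z.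
(* The modulus as a real number; the library norm [`|z|] of z : Cx R is again
   an element of Cx R. *)
Definition absC (R : realType) (z : Cx R) : R := reC `|z|.

(* T with its Borel sigma-algebra; x0 only witnesses that T is inhabited, as
   required of a measurableType. *)
Definition borel (T : topologicalType) (x0 : T) : Type := T.

Section borel_instances.
Context (T : topologicalType) (x0 : T).
HB.instance Definition _ := Choice.copy (borel x0) T.
HB.instance Definition _ := isPointed.Build (borel x0) x0.
Let G : set (set (borel x0)) := @open T.
HB.instance Definition _ := @isMeasurable.Build (sigma_display G) (borel x0)
  <<s G >> (@sigma_algebra0 _ setT G) (@sigma_algebraC _ G)
  (@sigma_algebra_bigcup _ setT G).
End borel_instances.

Section complex_integration.
Context d (T : measurableType d) (R : realType).
Variable m : {measure set T -> \bar R}.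
Implicit Types f g : T -> Cx R.

Definition measurableC (f : T -> Cx R) :=
  measurable_fun setT (fun x => reC (f x)) /\
  measurable_fun setT (fun x => imC (f x)).

Definition integralC (D : set T) (f : T -> Cx R) : Cx R :=
  ofR (Rintegral m D (fun x => reC (f x))) +
  'i * ofR (Rintegral m D (fun x => imC (f x))).

(* Elements of L^2 are represented by functions; equality in L^2 is equality
   almost everywhere. *)
Definition L2 (f : T -> Cx R) :=
  measurableC f /\ (\int[m]_x (absC (f x) ^+ 2)%:E < +oo)%E.

Definition innerL2 (f g : T -> Cx R) : Cx R :=
  integralC setT (fun x => f x * (g x)^*).

Definition dist2L2 (f g : T -> Cx R) : \bar R :=
  (\int[m]_x (absC (f x - g x) ^+ 2)%:E)%E.

Definition orthonormal_basis (B : set (T -> Cx R)) :=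
  [/\ B `<=` L2,
      forall e, B e -> innerL2 e e = 1,
      forall e e', B e -> B e' -> e <> e' -> innerL2 e e' = 0 &
      forall f, L2 f -> forall eps : R, 0 < eps ->
        exists n (a : 'I_n -> Cx R) (e : 'I_n -> T -> Cx R),
          (forall i, B (e i)) /\
          (dist2L2 f (fun x => \sum_(i < n) a i * e i x)%R < eps%:E)%E].

(* B is a vector space basis of (the image in L^2 of) the subspace E. *)
Definition ae_basis (E B : set (T -> Cx R)) :=
  [/\ B `<=` E,
      forall n (a : 'I_n -> Cx R) (e : 'I_n -> T -> Cx R),
        injective e -> (forall i, B (e i)) ->
        {ae m, forall x, \sum_(i < n) a i * e i x = 0} ->
        forall i, a i = 0 &
      forall f, E f ->
        exists n (a : 'I_n -> Cx R) (e : 'I_n -> T -> Cx R),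
          (forall i, B (e i)) /\
          {ae m, forall x, f x = \sum_(i < n) a i * e i x}].

End complex_integration.

Definition metrisable (R : realType) (T : topologicalType) :=
  exists d : T -> T -> R,
    [/\ forall x y, 0 <= d x y,
        forall x y, d x y = 0 <-> x = y,
        forall x y, d x y = d y x,
        forall x y z, d x z <= d x y + d y z &
        forall x (U : set T), nbhs x U <->
          exists2 r : R, 0 < r & [set y | d x y < r] `<=` U].

Definition sigma_compact (T : topologicalType) :=
  exists2 K : nat -> set T, (forall n, compact (K n)) &
    \bigcup_n K n = [set: T].

Section lca_group.
Context (R : realType) (G : topologicalZmodType).

Definition is_haar (theta : {measure set (borel (0 : G)) -> \bar R}) :=
  [/\ theta [set: G] != 0%E,
      forall K : set G, compact K -> (theta K < +oo)%E,
      forall A : set (borel (0 : G)), measurable A ->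
        theta A = ereal_inf [set theta U | U in
                    [set U : set G | open U /\ A `<=` U]],
      forall U : set G, open U ->
        theta U = ereal_sup [set theta K | K in
                    [set K : set G | compact K /\ K `<=` U]] &
      forall (t : G) (A : set (borel (0 : G))), measurable A ->
        theta [set t + x | x in (A : set G)] = theta A].

Definition is_character (chi : G -> Cx R) :=
  [/\ continuous chi, forall s t, chi (s + t) = chi s * chi t &
      forall t, `|chi t| = 1].

Definition trig_poly (P : G -> Cx R) :=
  exists n (a : 'I_n -> Cx R) (chi : 'I_n -> G -> Cx R),
    (forall i, is_character (chi i)) /\
    P = (fun t => \sum_(i < n) a i * chi i t).

Definition vh_boundary (K A : set G) : set G :=
  (closure [set a + k | a in A & k in K] `&` closure (~` A)) `|`
  (closure [set a - k | a in ~` A & k in K] `&` closure A).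

(* All the values of theta below are finite when theta is a Haar measure, so
   that fine only changes the type. *)
Definition van_hove (theta : {measure set (borel (0 : G)) -> \bar R})
    (A : nat -> set G) :=
  [/\ forall n, open (A n),
      forall n, compact (closure (A n)),
      forall n, (0 < theta (A n))%E &
      forall K : set G, compact K ->
        fine (theta (vh_boundary K (A n))) / fine (theta (A n))
          @[n --> \oo] --> (0 : R)].

Definition L1loc (theta : {measure set (borel (0 : G)) -> \bar R})
    (f : G -> Cx R) :=
  measurableC (f : borel (0 : G) -> Cx R) /\
  forall K : set G, compact K ->
    (\int[theta]_(t in K) (absC (f t))%:E < +oo)%E.

Definition besicovitch_seminorm
    (theta : {measure set (borel (0 : G)) -> \bar R}) (A : nat -> set G)
    (f : G -> Cx R) : \bar R :=
  limn_esup (fun n => (((fine (theta (A n)))^-1)%:E *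
    \int[theta]_(t in A n) (absC (f t))%:E)%E).

Definition besicovitch_ap_fun
    (theta : {measure set (borel (0 : G)) -> \bar R}) (A : nat -> set G)
    (f : G -> Cx R) :=
  L1loc theta f /\
  forall eps : R, 0 < eps -> exists2 P, trig_poly P &
    (besicovitch_seminorm theta A (fun t => (f t - P t)%R) < eps%:E)%E.

Definition Cc_pred : {pred G -> Cx R} :=
  [pred f | `[< continuous f /\ compact (closure [set x | f x != 0]) >]].

Lemma Cc_predP (f : G -> Cx R) : reflect
  (continuous f /\ compact (closure [set x | f x != 0])) (f \in Cc_pred).
Proof. by apply: (iffP idP) => [/asboolP|H]; [|apply/asboolP]. Qed.

Lemma Cc_pred_submod : submod_closed Cc_pred.
Proof.
split.
  apply/Cc_predP; split; first by move=> x; exact: cvg_cst.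
  rewrite (_ : [set x | _] = set0); first by rewrite closure0; exact: compact0.
  by rewrite -subset0 => x /=; rewrite eqxx.
move=> a f g /Cc_predP[cf sf] /Cc_predP[cg sg]; apply/Cc_predP; split.
  move=> x; apply: cvgD; last exact: cg.
  by apply: cvgZr; exact: cf.
rewrite -precompactE.
apply: (@precompact_subset _ _ (closure [set x | f x != 0] `|`
                                closure [set x | g x != 0])); last first.
  rewrite precompact_closed; first exact: compactU.
  by apply: closedU; exact: closed_closure.
move=> x /= afg; have [fx0|fx0] := eqVneq (f x) 0; last first.
  by left; exact: subset_closure.
right; apply: subset_closure => /=; apply: contra_neq afg => gx0.
have -> : (a *: f + g) x = a * f x + g x by [].
by rewrite fx0 gx0 mulr0 addr0.
Qed.

HB.instance Definition _ := GRing.isSubmodClosed.Build _ _ Cc_pred Cc_pred_submod.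

Record Cc := MkCc { Cc_fun :> G -> Cx R; _ : Cc_fun \in Cc_pred }.
HB.instance Definition _ := [isSub for Cc_fun].
HB.instance Definition _ := [Choice of Cc by <:].
HB.instance Definition _ := [SubChoice_isSubLmodule of Cc by <:].

Lemma Cc_comp (phi : Cc) (h h' : G -> G) :
  continuous h -> continuous h' -> cancel h h' -> cancel h' h ->
  (fun x => phi (h x)) \in Cc_pred.
Proof.
case: phi => f /= /Cc_predP[cf sf] ch ch' hK h'K; apply/Cc_predP; split.
  by move=> x; apply: continuous_comp; [exact: ch|exact: cf].
rewrite -precompactE.
apply: (@precompact_subset _ _ (h @^-1` closure [set x | f x != 0])).
  by move=> x /= fx; exact: subset_closure.
rewrite precompact_closed; last first.
  by apply: closed_comp; [move=> x _; exact: ch|exact: closed_closure].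
rewrite (_ : _ @^-1` _ = h' @` closure [set x | f x != 0]).
  by apply: continuous_compact => //; exact: continuous_subspaceT.
apply/seteqP; split => [x /= hx|_ /= [y hy <-]]; last by rewrite h'K.
by exists (h x).
Qed.

Lemma addl_continuous (t : G) : continuous (fun x : G => t + x).
Proof.
move=> x.
apply: (@cvg_comp _ _ _ (fun y => (t, y)) (fun p : G * G => p.1 + p.2)
  _ (nbhs (t, x))); last exact: (@add_continuous G (t, x)).
by apply: cvg_pair; [exact: cvg_cst|exact: cvg_id].
Qed.

Lemma subl_continuous (t : G) : continuous (fun x : G => t - x).
Proof.
move=> x; apply: (@continuous_comp _ _ _ (@GRing.opp G) (fun y => t + y)).
  exact: opp_continuous.
exact: addl_continuous.
Qed.

Lemma Cc_shift_subproof (t : G) (phi : Cc) :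
  (fun x => phi (t + x)) \in Cc_pred.
Proof.
apply: (@Cc_comp phi _ (fun x => - t + x)); try exact: addl_continuous.
- exact: addKr.
- exact: addNKr.
Qed.

Lemma Cc_refl_subproof (t : G) (phi : Cc) :
  (fun x => phi (t - x)) \in Cc_pred.
Proof.
by apply: (@Cc_comp phi _ (fun x => t - x)); try exact: subl_continuous;
  move=> x; rewrite opprB addrC subrK.
Qed.

Definition Cc_shift (t : G) (phi : Cc) : Cc := MkCc (Cc_shift_subproof t phi).
Definition Cc_refl (t : G) (phi : Cc) : Cc := MkCc (Cc_refl_subproof t phi).

(* Complex Radon measures in the sense of Bourbaki: linear functionals on
   C_c(G), phi |-> \int phi d(mu), which are bounded for the supremum norm on
   the functions supported in a fixed compact set. *)
Record radon := Radon {
  radon_fun :> Cc -> Cx R;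
  radon_linear : forall (a : Cx R) (phi psi : Cc),
    radon_fun (a *: phi + psi) = a * radon_fun phi + radon_fun psi;
  radon_bounded : forall K : set G, compact K ->
    exists c : R, forall (phi : Cc) (M : R),
      (forall x, ~ K x -> phi x = 0) -> (forall x, absC (phi x) <= M) ->
      absC (radon_fun phi) <= c * M }.

HB.instance Definition _ := gen_eqMixin radon.
HB.instance Definition _ := gen_choiceMixin radon.

Definition radon_eval (mu : radon) : {ptws Cc -> Cx R} := radon_fun mu.

(* The vague topology: pointwise convergence on C_c(G). *)
HB.instance Definition _ :=
  Topological.copy radon (initial_topology radon_eval).

Lemma radon_ext (mu nu : radon) : radon_fun mu = radon_fun nu -> mu = nu.
Proof.
case: mu => f lf bf; case: nu => g lg bg /= fg; subst g.
by congr Radon; exact: Prop_irrelevance.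
Qed.

Lemma radon_shift_linear (t : G) (mu : radon) (a : Cx R) (phi psi : Cc) :
  mu (Cc_shift t (a *: phi + psi)) =
  a * mu (Cc_shift t phi) + mu (Cc_shift t psi).
Proof. by rewrite -radon_linear; congr (mu _); exact: val_inj. Qed.

Lemma radon_shift_bounded (t : G) (mu : radon) (K : set G) : compact K ->
    exists c : R, forall (phi : Cc) (M : R),
      (forall x, ~ K x -> phi x = 0) -> (forall x, absC (phi x) <= M) ->
      absC (mu (Cc_shift t phi)) <= c * M.
Proof.
move=> cK; have cK' : compact [set - t + x | x in K].
  apply: continuous_compact => //; apply: continuous_subspaceT.
  exact: addl_continuous.
have [c cP] := radon_bounded mu cK'; exists c => phi M sphi bphi.
apply: cP => x /=; last exact: bphi.
by move=> Kx; apply: sphi => Ktx; apply: Kx; exists (t + x) => //; exact: addKr.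
Qed.

(* (tau_t mu)(phi) = (delta_t * mu)(phi) = \int phi(t + x) d(mu)(x). *)
Definition radon_shift (t : G) (mu : radon) : radon :=
  Radon (@radon_shift_linear t mu) (@radon_shift_bounded t mu).

Definition conv (mu : radon) (phi : Cc) : G -> Cx R :=
  fun t => mu (Cc_refl t phi).

Definition besicovitch_ap
    (theta : {measure set (borel (0 : G)) -> \bar R}) (A : nat -> set G)
    (mu : radon) :=
  forall phi : Cc, besicovitch_ap_fun theta A (conv mu phi).

(* The total variation as a functional on the nonnegative functions of C_c(G)
   and the value of the corresponding measure on an open set. *)
Definition tvar (mu : radon) (phi : Cc) : \bar R :=
  ereal_sup [set (absC (mu psi))%:E | psi in
    [set psi : Cc | forall x, `|psi x| <= phi x]].

Definition tvar_open (mu : radon) (U : set G) : \bar R :=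
  ereal_sup [set tvar mu phi | phi in
    [set phi : Cc | forall x, 0 <= phi x <= \1_U x]].

Definition translation_bounded (mu : radon) :=
  exists V : set G, [/\ open V, V !=set0, compact (closure V) &
    (ereal_sup [set tvar_open mu [set (t + v)%R | v in V] | t in [set: G]]
       < +oo)%E].

Definition hull (mu : radon) : set radon :=
  closure [set radon_shift t mu | t in [set: G]].

Lemma radon_shift0 (mu : radon) : radon_shift 0 mu = mu.
Proof.
apply: radon_ext; apply/funext => phi /=; congr (mu _); apply: val_inj.
by apply/funext => x /=; rewrite add0r.
Qed.

Lemma radon_shiftD (s t : G) (mu : radon) :
  radon_shift s (radon_shift t mu) = radon_shift (s + t) mu.
Proof.
apply: radon_ext; apply/funext => phi /=; congr (mu _); apply: val_inj.
by apply/funext => x /=; rewrite addrA.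
Qed.

Lemma radon_shift_continuous (t : G) : continuous (radon_shift t).
Proof.
apply/continuousP => _ [U oU <-].
suff ct : continuous (fun f : {ptws Cc -> Cx R} =>
    (fun phi => f (Cc_shift t phi)) : {ptws Cc -> Cx R}).
  by exists ((fun f : {ptws Cc -> Cx R} =>
    (fun phi => f (Cc_shift t phi)) : {ptws Cc -> Cx R}) @^-1` U) => //;
    move/continuousP: ct; exact.
move=> f; set h := (fun f : {ptws Cc -> Cx R} => _).
have FF : Filter (h @ nbhs f) by apply: fmap_filter; exact: nbhs_filter.
apply: (snd (@cvg_sup (Cc -> Cx R) Cc _ (h @ nbhs f) (h f) FF)).
move=> phi W [_ [[V oV <-] Vf VW]].
apply: (@filterS _ (nbhs f) _ (proj (Cc_shift t phi) @^-1` V)).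
  by move=> g Vg; apply: VW.
apply: (@proj_continuous Cc (fun=> Cx R) (Cc_shift t phi) f).
exact: open_nbhs_nbhs.
Qed.

Lemma hull_shift_subproof (t : G) (mu : radon) (w : radon) :
  hull mu w -> hull mu (radon_shift t w).
Proof.
move=> hw U /radon_shift_continuous /hw [_ [[s _ <-] Us]].
by exists (radon_shift t (radon_shift s mu)); split => //;
  rewrite radon_shiftD; exists (t + s).
Qed.

Lemma hull_base_subproof (mu : radon) : mu \in hull mu.
Proof.
by apply/mem_set/subset_closure; exists 0 => //; exact: radon_shift0.
Qed.

Definition hull_base (mu : radon) : hull mu :=
  exist _ mu (hull_base_subproof mu).

Definition hull_shift (mu : radon) (t : G) (w : hull mu) : hull mu :=
  exist _ (radon_shift t (val w))
    (mem_set (@hull_shift_subproof t mu (val w) (set_valP w))).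

Section hull_measure.
Context (mu : radon).
Notation X := (borel (hull_base mu)).
Variable m : probability X R.

Definition invariant_measure :=
  forall (t : G) (B : set X), measurable B ->
    m (hull_shift (mu := mu) t @^-1` B) = m B.

Definition ergodic :=
  forall B : set X, measurable B ->
    (forall t : G, hull_shift (mu := mu) t @^-1` B = B) ->
    m B = 0%E \/ m B = 1%E.

Definition dyn_eigenspace (chi : G -> Cx R) : set (X -> Cx R) :=
  [set f | L2 m f /\
    forall t : G, {ae m, forall w : X,
      f (hull_shift (mu := mu) (- t) w) = chi t * f w}].

Definition dyn_eigenfunction (chi : G -> Cx R) (f : X -> Cx R) :=
  [/\ is_character chi, dyn_eigenspace chi f & ~ {ae m, forall w, f w = 0}].

Definition dyn_eigenvalue (chi : G -> Cx R) := exists f, dyn_eigenfunction chi f.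

Definition pure_point_spectrum :=
  exists2 B : set (X -> Cx R), orthonormal_basis m B &
    forall e, B e -> exists chi, dyn_eigenfunction chi e.

Definition wiener_wintner (theta : {measure set (borel (0 : G)) -> \bar R})
    (A : nat -> set G) :=
  forall chi, dyn_eigenvalue chi ->
    exists B : set (X -> Cx R),
      [/\ ae_basis m (dyn_eigenspace chi) B,
          forall e, B e -> innerL2 m e e = 1 &
          forall f : hull mu -> Cx R, continuous f -> forall e, B e ->
            ofR (fine (theta (A n)))^-1 *
              integralC theta (A n) (fun t : G =>
                (chi t)^* * f (hull_shift (- t) (hull_base mu)))
            @[n --> \oo] --> innerL2 m f e].

End hull_measure.

End lca_group.

(* Main.v *)
From HB Require Import structures.
Require Import Defs.
From mathcomp Require Import all_boot all_order all_algebra.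
From mathcomp Require Import all_classical all_reals all_analysis.
From mathcomp Require Import measurable_realfun complex ring lra.

(** Write F_f for the function t |-> f(tau_{-t} mu), where f is continuous on the
    hull. Since mu * phi is F_f for an evaluation f, the theorem compares the
    Besicovitch almost periodicity of the functions F_f with the spectral theory
    of the hull. Averaging over A_n is integration against a probability measure
    p n on G, and the van Hove property makes the means given by these measures
    asymptotically translation invariant; in particular, distinct characters are
    orthogonal in the mean ([avg_asymp_invariant], [char_orth]).

    The link between both sides is the notion of correlation: (h, H), with h
    square-integrable on the hull and H bounded continuous on G, is correlated
    with (k, K) when the mean of H times the conjugate of K exists and equals the
    inner product of h and k. A continuous f is matched with F_f, and an
    eigenfunction with its character. Correlation is sesquilinear, so that once
    it is known between these generators the distance in L2 from f to a
    combination of eigenfunctions is the limit of the quadratic means of the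
    difference between F_f and the same combination of characters
    ([nrm_combination_cvg]).

    Suppose that the Wiener-Wintner averages converge. They determine the inner
    products of a basis vector with continuous functions, which are dense; hence
    every eigenspace is a line ([ww_line]). Pure point spectrum then makes each
    f a limit of combinations of eigenfunctions, and the formula for distances
    makes F_f a limit of trigonometric polynomials ([ww_bap]). Ergodicity follows
    because the eigenspace of the trivial character consists of the constants
    ([ww_ergodic]).

    Conversely, suppose that the convolutions of mu are Besicovitch almost
    periodic. The hull is compact by a Tychonoff argument ([hull_compact]). The
    f for which F_f is almost periodic form a uniformly closed vector lattice
    which separates points, so that they are all the continuous functions
    ([stone_weierstrass], [along_bap]). The mean of F_f is a positive functional
    of f, represented by an invariant measure m ([riesz_representation],
    [orbit_measure]). When some F_f has a nonzero Fourier-Bohr coefficient at chi,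
    twisted averages of translates of f remove all other frequencies and give
    continuous g_k with F_{g_k} close to chi ([kill_frequencies],
    [approx_char]); the g_k form a Cauchy sequence in L2, and its limit is a
    unit eigenfunction for chi whose inner products are the Wiener-Wintner
    averages ([L2_complete], [frequency_vector], [frequency_eigen]). Finally, each
    F_f is approximated by polynomials with such frequencies only
    ([restrict_frequencies]), so that these eigenfunctions are total and are all
    of the eigenfunctions up to scalars ([system_approx], [system_line]). *)

Set Implicit Arguments.
Unset Strict Implicit.
Unset Printing Implicit Defensive.
Import Order.TTheory GRing.Theory Num.Theory.
Import numFieldNormedType.Exports.
Local Open Scope classical_set_scope.
Local Open Scope ring_scope.

(** * Complex numbers *)

Section complex_basics.
Variable R : realType.
Implicit Types (z w : Cx R) (x y : R).

Lemma Cx_ext z w : reC z = reC w -> imC z = imC w -> z = w.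
Proof. by case: z w => a b [c d] /= -> ->. Qed.

Lemma reCD z w : reC (z + w) = reC z + reC w.
Proof. by case: z w => a b [c d]. Qed.
Lemma imCD z w : imC (z + w) = imC z + imC w.
Proof. by case: z w => a b [c d]. Qed.
Lemma reCN z : reC (- z) = - reC z.
Proof. by case: z. Qed.
Lemma imCN z : imC (- z) = - imC z.
Proof. by case: z. Qed.
Lemma reCB z w : reC (z - w) = reC z - reC w.
Proof. by rewrite reCD reCN. Qed.
Lemma imCB z w : imC (z - w) = imC z - imC w.
Proof. by rewrite imCD imCN. Qed.
Lemma reCM z w : reC (z * w) = reC z * reC w - imC z * imC w.
Proof. by case: z w => a b [c d]. Qed.
Lemma imCM z w : imC (z * w) = reC z * imC w + imC z * reC w.
Proof. by case: z w => a b [c d]. Qed.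
Lemma reC_conj z : reC z^* = reC z.
Proof. by case: z. Qed.
Lemma imC_conj z : imC z^* = - imC z.
Proof. by case: z. Qed.
Lemma reC0 : reC (0 : Cx R) = 0. Proof. by []. Qed.
Lemma imC0 : imC (0 : Cx R) = 0. Proof. by []. Qed.
Lemma reC1 : reC (1 : Cx R) = 1. Proof. by []. Qed.
Lemma imC1 : imC (1 : Cx R) = 0. Proof. by []. Qed.
Lemma reC_ofR x : reC (ofR x) = x. Proof. by []. Qed.
Lemma imC_ofR x : imC (ofR x) = 0. Proof. by []. Qed.
Lemma reCi : reC ('i : Cx R) = 0.
Proof. by rewrite -complexiE. Qed.
Lemma imCi : imC ('i : Cx R) = 1.
Proof. by rewrite -complexiE. Qed.

(** Reduces an identity between complex numbers to two real identities. *)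
Definition CE := (reCD, imCD, reCN, imCN, reCM, imCM, reC_conj, imC_conj,
  reC0, imC0, reC1, imC1, reC_ofR, imC_ofR, reCi, imCi).

Lemma ofRD x y : ofR (x + y) = ofR x + ofR y.
Proof. by apply: Cx_ext; rewrite !CE// addr0. Qed.
Lemma ofRN x : ofR (- x) = - ofR x.
Proof. by apply: Cx_ext; rewrite !CE// oppr0. Qed.
Lemma ofRM x y : ofR (x * y) = ofR x * ofR y.
Proof. by apply: Cx_ext; rewrite !CE; ring. Qed.
Lemma ofR0 : ofR 0 = 0 :> Cx R. Proof. by []. Qed.
Lemma ofR_inj : injective (@ofR R).
Proof. by move=> x y []. Qed.

Lemma Cx_rect z : z = ofR (reC z) + 'i * ofR (imC z).
Proof. by apply: Cx_ext; rewrite !CE; ring. Qed.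

Lemma ler_ofR x y : (ofR x <= ofR y :> Cx R) = (x <= y).
Proof. exact: lecR. Qed.
Lemma ltr_ofR x y : (ofR x < ofR y :> Cx R) = (x < y).
Proof. exact: ltcR. Qed.

Lemma normr_absC z : `|z| = ofR (absC z).
Proof. by rewrite /absC normc_def. Qed.
Lemma absC_def z : absC z = Num.sqrt (reC z ^+ 2 + imC z ^+ 2).
Proof. by rewrite /absC normc_def. Qed.
Lemma absC_ge0 z : 0 <= absC z.
Proof. by rewrite absC_def sqrtr_ge0. Qed.
Lemma absC_sq z : absC z ^+ 2 = reC z ^+ 2 + imC z ^+ 2.
Proof. by rewrite absC_def sqr_sqrtr// addr_ge0// sqr_ge0. Qed.
Lemma absCD z w : absC (z + w) <= absC z + absC w.
Proof. by rewrite -ler_ofR ofRD -!normr_absC ler_normD. Qed.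
Lemma absCM z w : absC (z * w) = absC z * absC w.
Proof. by apply: ofR_inj; rewrite ofRM -!normr_absC normrM. Qed.
Lemma absCN z : absC (- z) = absC z.
Proof. by apply: ofR_inj; rewrite -!normr_absC normrN. Qed.
Lemma absC_conj z : absC z^* = absC z.
Proof. by apply: ofR_inj; rewrite -!normr_absC norm_conjC. Qed.
Lemma absC0 : absC (0 : Cx R) = 0.
Proof. by apply: ofR_inj; rewrite -!normr_absC normr0. Qed.
Lemma absC1 : absC (1 : Cx R) = 1.
Proof. by apply: ofR_inj; rewrite -!normr_absC normr1. Qed.
Lemma absC_ofR x : absC (ofR x) = `|x|.
Proof. by rewrite absC_def !CE expr0n addr0 sqrtr_sqr. Qed.
Lemma absC_eq0 z : (absC z == 0) = (z == 0).
Proof. by rewrite -(inj_eq ofR_inj) -normr_absC normr_eq0. Qed.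
Lemma absCB z w : absC (z - w) = absC (w - z).
Proof. by rewrite -absCN opprB. Qed.
Lemma absCX z n : absC (z ^+ n) = absC z ^+ n.
Proof. by elim: n => [|n IH]; rewrite ?expr0 ?absC1// !exprS absCM IH. Qed.
Lemma absC_sum n (f : 'I_n -> Cx R) :
  absC (\sum_(i < n) f i) <= \sum_(i < n) absC (f i).
Proof.
elim/big_ind2 : _ => //; first by rewrite absC0.
by move=> a b c d ab cd; rewrite (le_trans (absCD _ _))// lerD.
Qed.
Lemma absC_dist z w u : absC (z - u) <= absC (z - w) + absC (w - u).
Proof. by rewrite (le_trans _ (absCD _ _))// subrKA. Qed.

Lemma mulr_conj z : z * z^* = ofR (absC z ^+ 2).
Proof. by apply: Cx_ext; rewrite absC_sq !CE; ring. Qed.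

Lemma absC_eq1 z : `|z| = 1 -> absC z = 1.
Proof. by rewrite normr_absC => /(congr1 (@reC R)). Qed.

Lemma ler_reC z : `|reC z| <= absC z.
Proof.
by rewrite -(@ler_pXn2r _ 2)// ?nnegrE ?absC_ge0// real_normK ?num_real// absC_sq
  lerDl sqr_ge0.
Qed.
Lemma ler_imC z : `|imC z| <= absC z.
Proof.
by rewrite -(@ler_pXn2r _ 2)// ?nnegrE ?absC_ge0// real_normK ?num_real// absC_sq
  lerDr sqr_ge0.
Qed.
Lemma absC_le z : absC z <= `|reC z| + `|imC z|.
Proof.
rewrite -(@ler_pXn2r _ 2)// ?nnegrE ?absC_ge0 ?addr_ge0// absC_sq sqrrD.
by rewrite !real_normK ?num_real// lerD2r lerDl mulrn_wge0// mulr_ge0.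
Qed.

End complex_basics.
Arguments CE {R}.

Section complex_topology.
Variable R : realType.
Local Notation C := (Cx R).

(** The order of the complex numbers makes positive elements real, so that
    the radii in the definition of a limit can be taken real. *)
Lemma ltC0_ofR (e : C) : 0 < e -> exists2 d : R, 0 < d & e = ofR d.
Proof.
move=> e0; have -> : e = ofR (reC e).
  apply: Cx_ext; rewrite ?reC_ofR ?imC_ofR//.
  by move: e0; rewrite ltcE => /andP[/eqP].
by exists (reC e) => //; move: e0; rewrite ltcE => /andP[].
Qed.

Lemma cvgC_abs (T : Type) (F : set_system T) (FF : Filter F) (f : T -> C) (l : C) :
  (f @ F --> l) <-> (forall e : R, 0 < e -> \forall t \near F, absC (f t - l) < e).
Proof.
split=> [/cvgrPdist_lt fl e e0|fl].
  have := fl (ofR e); rewrite -[X in X < _]ofR0 ltr_ofR => /(_ e0).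
  by apply: filterS => t; rewrite normr_absC ltr_ofR absCB.
apply/cvgrPdist_lt => e /ltC0_ofR[d d0 ->].
by apply: filterS (fl d d0) => t; rewrite normr_absC ltr_ofR absCB.
Qed.

Lemma cvg_reC (T : Type) (F : set_system T) (FF : Filter F) (f : T -> C) (l : C) :
  f @ F --> l -> (fun t => reC (f t)) @ F --> reC l.
Proof.
move=> /cvgC_abs fl; apply/cvgrPdist_lt => e /fl; apply: filterS => t.
by rewrite absCB; apply: le_lt_trans; rewrite -reCB ler_reC.
Qed.

Lemma cvg_imC (T : Type) (F : set_system T) (FF : Filter F) (f : T -> C) (l : C) :
  f @ F --> l -> (fun t => imC (f t)) @ F --> imC l.
Proof.
move=> /cvgC_abs fl; apply/cvgrPdist_lt => e /fl; apply: filterS => t.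
by rewrite absCB; apply: le_lt_trans; rewrite -imCB ler_imC.
Qed.

Lemma cvg_reimC (T : Type) (F : set_system T) (FF : Filter F) (f : T -> C) (l : C) :
  (fun t => reC (f t)) @ F --> reC l -> (fun t => imC (f t)) @ F --> imC l ->
  f @ F --> l.
Proof.
move=> /cvgrPdist_lt fr /cvgrPdist_lt fi; apply/cvgC_abs => e e0.
have e20 : 0 < e / 2 by rewrite divr_gt0.
apply: filterS2 (fr _ e20) (fi _ e20) => t rt it.
rewrite absCB (le_lt_trans (absC_le _))// !(reCB,imCB).
by rewrite [e]splitr ltrD.
Qed.

Lemma cvg_absC (T : Type) (F : set_system T) (FF : Filter F) (f : T -> C) (l : C) :
  f @ F --> l -> (fun t => absC (f t)) @ F --> absC l.
Proof.
move=> /cvgC_abs fl; apply/cvgrPdist_lt => e /fl; apply: filterS => t.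
apply: le_lt_trans; rewrite ler_norml; apply/andP; split.
  rewrite lerBrDl lerBlDl -[X in X <= _](congr1 _ (subrK l (f t))).
  by rewrite (le_trans (absCD _ _))// addrC.
rewrite lerBlDl -[X in X <= _](congr1 _ (subrK (f t) l)).
by rewrite (le_trans (absCD _ _))// addrC absCB.
Qed.

Lemma cvg_ofR (T : Type) (F : set_system T) (FF : Filter F) (f : T -> R) (l : R) :
  f @ F --> l -> (fun t => ofR (f t)) @ F --> ofR l.
Proof.
by move=> fl; apply: cvg_reimC => //=; exact: cvg_cst.
Qed.

Lemma cvg_conjC (T : Type) (F : set_system T) (FF : Filter F) (f : T -> C) (l : C) :
  f @ F --> l -> (fun t => (f t)^*) @ F --> l^*.
Proof.
move=> fl; apply: cvg_reimC.
  by rewrite reC_conj; under eq_fun do rewrite reC_conj; exact: cvg_reC.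
by rewrite imC_conj; under eq_fun do rewrite imC_conj; apply: cvgN; exact: cvg_imC.
Qed.

Lemma absC_continuous : continuous (@absC R).
Proof. by move=> z; apply: (@cvg_absC C (nbhs z) (nbhs_filter z) id z). Qed.

End complex_topology.

(** * Square-integrable complex functions *)

(** The unqualified name also denotes a lemma on complements of measurable
    sets. *)
Notation mfunC := Defs.measurableC.

Section mfunC_theory.
Context d (T : measurableType d) (R : realType).
Local Notation C := (Cx R).
Implicit Types f g : T -> C.

Lemma mfunC_cst (c : C) : mfunC (fun _ : T => c).
Proof. by split; exact: (measurable_cst _). Qed.
Lemma mfunCD f g : mfunC f -> mfunC g ->
  mfunC (fun x => f x + g x).
Proof.
move=> [f1 f2] [g1 g2]; split.
  by under eq_fun do rewrite reCD; exact: measurable_funD.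
by under eq_fun do rewrite imCD; exact: measurable_funD.
Qed.
Lemma mfunCM f g : mfunC f -> mfunC g ->
  mfunC (fun x => f x * g x).
Proof.
move=> [f1 f2] [g1 g2]; split.
  under eq_fun do rewrite reCM.
  by apply: measurable_funB; exact: measurable_funM.
under eq_fun do rewrite imCM.
by apply: measurable_funD; exact: measurable_funM.
Qed.
Lemma mfunC_conj f : mfunC f -> mfunC (fun x => (f x)^*).
Proof.
move=> [f1 f2]; split; first by under eq_fun do rewrite reC_conj.
by under eq_fun do rewrite imC_conj; exact: measurable_funN.
Qed.
Lemma mfunC_abs2 f : mfunC f ->
  measurable_fun setT (fun x => absC (f x) ^+ 2).
Proof.
move=> [f1 f2]; under eq_fun do rewrite absC_sq.
by apply: measurable_funD; exact: measurable_funX.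
Qed.
Lemma mfunC_abs f : mfunC f ->
  measurable_fun setT (fun x => absC (f x)).
Proof.
move=> mf; have := mfunC_abs2 mf.
move=> /(measurableT_comp (continuous_measurable_fun (@sqrt_continuous R))).
by apply: eq_measurable_fun => x _ /=; rewrite sqrtr_sqr ger0_norm ?absC_ge0.
Qed.
End mfunC_theory.

Section L1_theory.
Context d (T : measurableType d) (R : realType) (m : probability T R).
Local Notation C := (Cx R).
Implicit Types f g : T -> C.

Definition L1C f := m.-integrable setT (EFin \o (fun x => reC (f x))) /\
  m.-integrable setT (EFin \o (fun x => imC (f x))).

Lemma L1C_le f (h : T -> R) : mfunC f -> m.-integrable setT (EFin \o h) ->
  (forall x, absC (f x) <= h x) -> L1C f.
Proof.
move=> [mr mi] hi fh; split.
  apply: le_integrable hi => //; first exact/measurable_EFinP.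
  move=> x _ /=; rewrite lee_fin (le_trans (ler_reC _))// (le_trans (fh x))//.
  exact: ler_norm.
apply: le_integrable hi => //; first exact/measurable_EFinP.
move=> x _ /=; rewrite lee_fin (le_trans (ler_imC _))// (le_trans (fh x))//.
exact: ler_norm.
Qed.

Lemma L1C_mfunC f : L1C f -> mfunC f.
Proof. by case=> /measurable_int/measurable_EFinP ? /measurable_int/measurable_EFinP. Qed.

Lemma L1C_abs f : L1C f -> m.-integrable setT (EFin \o (fun x => absC (f x))).
Proof.
move=> [fr fi]; have mf : mfunC f by exact: L1C_mfunC.
have := integrableD measurableT (integrable_norm fr) (integrable_norm fi).
apply: le_integrable => //; first exact/measurable_EFinP/mfunC_abs.
move=> x _ /=; rewrite lee_fin ger0_norm ?absC_ge0//.
by rewrite (le_trans (absC_le _))// ler_norm.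
Qed.

Lemma integralC_lin (c : C) f g : L1C f -> L1C g ->
  L1C (fun x => c * f x + g x) /\
  integralC m setT (fun x => c * f x + g x) =
  c * integralC m setT f + integralC m setT g.
Proof.
move=> [fr fi] [gr gi].
have intZ (k : R) (h : T -> R) : m.-integrable setT (EFin \o h) ->
    m.-integrable setT (EFin \o (fun x => k * h x)).
  by move=> /(integrableZl measurableT k); apply: eq_integrable => // x _; rewrite /= EFinM.
have intD (h k : T -> R) : m.-integrable setT (EFin \o h) ->
    m.-integrable setT (EFin \o k) ->
    m.-integrable setT (EFin \o (fun x => h x + k x)).
  by move=> h1 k1; have := integrableD measurableT h1 k1;
    apply: eq_integrable => // x _; rewrite /= EFinD.
have r1 : m.-integrable setT (EFin \o (fun x => reC c * reC (f x) + - imC c * imC (f x))).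
  by apply: intD; exact: intZ.
have i1 : m.-integrable setT (EFin \o (fun x => reC c * imC (f x) + imC c * reC (f x))).
  by apply: intD; exact: intZ.
have er : (fun x => reC (c * f x + g x)) =
    (fun x => (reC c * reC (f x) + - imC c * imC (f x)) + reC (g x)).
  by apply/funext => x; rewrite !CE; ring.
have ei : (fun x => imC (c * f x + g x)) =
    (fun x => (reC c * imC (f x) + imC c * reC (f x)) + imC (g x)).
  by apply/funext => x; rewrite !CE; ring.
split.
  by rewrite /L1C er ei; split; exact: intD.
rewrite /integralC er ei.
rewrite (RintegralD measurableT r1 gr) (RintegralD measurableT i1 gi).
rewrite (RintegralD measurableT (intZ _ _ fr) (intZ _ _ fi)).
rewrite (RintegralD measurableT (intZ _ _ fi) (intZ _ _ fr)).
rewrite !RintegralZl//.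
by apply: Cx_ext; rewrite !CE; ring.
Qed.

Lemma L1C_cst (c : C) : L1C (fun=> c).
Proof. by split; apply: finite_measure_integrable_cst. Qed.

Lemma integralC_cst (c : C) : integralC m setT (fun=> c) = c.
Proof.
have E (r : R) : Rintegral m setT (fun=> r) = r.
  rewrite Rintegral_cst//; transitivity (r * fine (1%:E : \bar R)); last by rewrite mulr1.
  by congr (_ * fine _); exact: probability_setT.
by rewrite /integralC !E -Cx_rect.
Qed.

Lemma L1CZ (c : C) f : L1C f -> L1C (fun x => c * f x).
Proof.
move=> Lf; have [+ _] := integralC_lin c Lf (L1C_cst 0).
by under eq_fun do rewrite addr0.
Qed.

Lemma integralCZ (c : C) f : L1C f ->
  integralC m setT (fun x => c * f x) = c * integralC m setT f.
Proof.
move=> Lf; have [_] := integralC_lin c Lf (L1C_cst 0).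
by rewrite integralC_cst addr0; under eq_fun do rewrite addr0.
Qed.

Lemma integralCB f g : L1C f -> L1C g ->
  integralC m setT (fun x => f x - g x) = integralC m setT f - integralC m setT g.
Proof.
move=> Lf Lg; have [_] := integralC_lin (-1) Lg Lf.
rewrite mulN1r addrC => <-; congr integralC.
by apply/funext => x; rewrite mulN1r addrC.
Qed.

Lemma integralC_conj f : L1C f ->
  integralC m setT (fun x => (f x)^*) = (integralC m setT f)^*.
Proof.
move=> [fr fi]; rewrite /integralC.
have -> : (fun x => reC (f x)^*) = (fun x => reC (f x)).
  by apply/funext => x; rewrite reC_conj.
have -> : (fun x => imC (f x)^*) = (fun x => -1 * imC (f x)).
  by apply/funext => x; rewrite imC_conj mulN1r.
rewrite [X in 'i * ofR X]RintegralZl//.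
by apply: Cx_ext; rewrite !CE; ring.
Qed.

(** Multiplying by a complex number of modulus one makes the integral
    nonnegative; the real part of the integrand then suffices to compute it. *)
Lemma le_absC_integralC f : L1C f ->
  absC (integralC m setT f) <= Rintegral m setT (fun x => absC (f x)).
Proof.
move=> Lf; set z := integralC m setT f.
have [z0|z0] := eqVneq z 0.
  by rewrite z0 absC0 Rintegral_ge0// => x _; exact: absC_ge0.
have a0 : absC z != 0 by rewrite absC_eq0.
pose u := ofR (absC z)^-1 * z^*.
have u1 : absC u = 1.
  by rewrite absCM absC_ofR absC_conj normfV ger0_norm ?absC_ge0// mulVf.
have -> : absC z = reC (u * z).
  by rewrite -mulrA [_^* * _]mulrC mulr_conj -ofRM reC_ofR expr2 mulrA mulVf// mul1r.
rewrite -integralCZ// /integralC !CE mul0r mul1r subrr addr0.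
have [h1 h2] := L1CZ u Lf.
apply: le_Rintegral => //; first exact: L1C_abs.
move=> x _; rewrite (le_trans (ler_norm _))// (le_trans (ler_reC _))//.
by rewrite absCM u1 mul1r.
Qed.

End L1_theory.

Section L2_theory.
Context d (T : measurableType d) (R : realType) (m : probability T R).
Local Notation C := (Cx R).
Implicit Types f g : T -> C.

Definition sqnorm f : R := Rintegral m setT (fun x => absC (f x) ^+ 2).
Definition nrm f : R := Num.sqrt (sqnorm f).

Lemma L2_int f : L2 m f -> m.-integrable setT (EFin \o (fun x => absC (f x) ^+ 2)).
Proof.
move=> [mf fi]; apply/integrableP; split.
  exact/measurable_EFinP/mfunC_abs2.
apply: le_lt_trans fi; rewrite le_eqVlt; apply/orP; left; apply/eqP.
by apply: eq_integral => x _; rewrite /= ger0_norm// sqr_ge0.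
Qed.

Lemma L2_le f (h : T -> R) : mfunC f -> m.-integrable setT (EFin \o h) ->
  (forall x, absC (f x) ^+ 2 <= h x) -> L2 m f.
Proof.
move=> mf hi fh; split => //.
have := integrable_lty measurableT hi; apply: le_lt_trans.
apply: ge0_le_integral => //=.
- by move=> x _; rewrite lee_fin sqr_ge0.
- exact/measurable_EFinP/mfunC_abs2.
- exact: measurable_int hi.
- by move=> x _; rewrite lee_fin.
Qed.

Lemma sqnorm_ge0 f : 0 <= sqnorm f.
Proof. by apply: Rintegral_ge0 => x _; exact: sqr_ge0. Qed.
Lemma nrm_ge0 f : 0 <= nrm f.
Proof. exact: sqrtr_ge0. Qed.
Lemma nrm_sq f : nrm f ^+ 2 = sqnorm f.
Proof. by rewrite sqr_sqrtr// sqnorm_ge0. Qed.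

Lemma EFin_sqnorm f : L2 m f -> (\int[m]_x (absC (f x) ^+ 2)%:E)%E = (sqnorm f)%:E.
Proof.
move=> Lf; rewrite /sqnorm /Rintegral fineK//.
exact: (integrable_fin_num measurableT (L2_int Lf)).
Qed.

Lemma L2_lin (c : C) f g : L2 m f -> L2 m g -> L2 m (fun x => c * f x + g x).
Proof.
move=> Lf Lg; pose k := absC c ^+ 2.
have := integrableD measurableT
  (integrableZl measurableT (2 * k) (L2_int Lf))
  (integrableZl measurableT 2 (L2_int Lg)).
move=> h; apply: (@L2_le _ (fun x => 2 * k * absC (f x) ^+ 2 + 2 * absC (g x) ^+ 2)) => //.
- case: Lf Lg => mf _ [mg _]; apply: mfunCD => //.
  by apply: mfunCM => //; exact: mfunC_cst.
- move=> x; apply: le_trans (_ : (absC c * absC (f x) + absC (g x)) ^+ 2 <= _).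
    by rewrite lerXn2r ?nnegrE ?addr_ge0 ?mulr_ge0 ?absC_ge0// -absCM absCD.
  rewrite /k; have := sqr_ge0 (absC c * absC (f x) - absC (g x)); lra.
Qed.

Lemma L2_cst (c : C) : L2 m (fun=> c).
Proof.
apply: (@L2_le _ (fun=> absC c ^+ 2)) => //.
exact: finite_measure_integrable_cst.
Qed.

Lemma L2Z (c : C) f : L2 m f -> L2 m (fun x => c * f x).
Proof.
by move=> Lf; have := L2_lin c Lf (L2_cst 0); under eq_fun do rewrite addr0.
Qed.

Lemma L2D f g : L2 m f -> L2 m g -> L2 m (fun x => f x + g x).
Proof.
by move=> Lf Lg; have := L2_lin 1 Lf Lg; under eq_fun do rewrite mul1r.
Qed.

Lemma L2B f g : L2 m f -> L2 m g -> L2 m (fun x => f x - g x).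
Proof.
move=> Lf Lg; have := L2_lin (-1) Lg Lf.
by under eq_fun do rewrite mulN1r addrC.
Qed.

Lemma L2_sum n (f : 'I_n -> T -> C) : (forall i, L2 m (f i)) ->
  L2 m (fun x => \sum_(i < n) f i x).
Proof.
elim: n f => [|n IH] f Lf.
  by under eq_fun do rewrite big_ord0; exact: L2_cst.
under eq_fun do rewrite big_ord_recl.
by apply: L2D => //; exact: IH.
Qed.

Lemma L2_mul f g : L2 m f -> L2 m g -> L1C m (fun x => f x * (g x)^*).
Proof.
move=> Lf Lg; have := integrableD measurableT (L2_int Lf) (L2_int Lg).
move=> h; apply: (L1C_le _ h); first last.
  move=> x /=; rewrite absCM absC_conj.
  have := sqr_ge0 (absC (f x) - absC (g x)).
  by have := absC_ge0 (f x); have := absC_ge0 (g x); nra.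
by case: Lf Lg => mf _ [mg _]; apply: mfunCM => //; exact: mfunC_conj.
Qed.

Lemma L2_L1 f : L2 m f -> L1C m f.
Proof.
move=> Lf; have := L2_mul Lf (L2_cst 1).
by under eq_fun do rewrite conjC1 mulr1.
Qed.

Lemma innerL2_lin (c : C) f h g : L2 m f -> L2 m h -> L2 m g ->
  innerL2 m (fun x => c * f x + h x) g = c * innerL2 m f g + innerL2 m h g.
Proof.
move=> Lf Lh Lg; have [_ <-] := integralC_lin c (L2_mul Lf Lg) (L2_mul Lh Lg).
by congr integralC; apply/funext => x; rewrite mulrDl mulrA.
Qed.

Lemma innerL2_conj f g : L2 m f -> L2 m g -> innerL2 m g f = (innerL2 m f g)^*.
Proof.
move=> Lf Lg; rewrite -integralC_conj; last exact: L2_mul.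
by congr integralC; apply/funext => x; rewrite rmorphM /= conjCK mulrC.
Qed.

Lemma innerL2Z (c : C) f g : L2 m f -> L2 m g ->
  innerL2 m (fun x => c * f x) g = c * innerL2 m f g.
Proof.
move=> Lf Lg; rewrite -integralCZ; last exact: L2_mul.
by congr integralC; apply/funext => x; rewrite mulrA.
Qed.

Lemma innerL2D f h g : L2 m f -> L2 m h -> L2 m g ->
  innerL2 m (fun x => f x + h x) g = innerL2 m f g + innerL2 m h g.
Proof.
move=> Lf Lh Lg; have := innerL2_lin 1 Lf Lh Lg.
by under eq_fun do rewrite mul1r; rewrite mul1r.
Qed.

Lemma innerL2B f h g : L2 m f -> L2 m h -> L2 m g ->
  innerL2 m (fun x => f x - h x) g = innerL2 m f g - innerL2 m h g.
Proof.
move=> Lf Lh Lg; have E := innerL2_lin (-1) Lh Lf Lg.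
have -> : (fun x => f x - h x) = (fun x => -1 * h x + f x).
  by apply/funext => x; rewrite mulN1r addrC.
by rewrite E mulN1r addrC.
Qed.

Lemma innerL2Zr (c : C) f g : L2 m f -> L2 m g ->
  innerL2 m f (fun x => c * g x) = c^* * innerL2 m f g.
Proof.
move=> Lf Lg; rewrite (innerL2_conj (L2Z c Lg) Lf) innerL2Z// rmorphM /=.
by rewrite -innerL2_conj.
Qed.

Lemma innerL2Br f h g : L2 m f -> L2 m h -> L2 m g ->
  innerL2 m g (fun x => f x - h x) = innerL2 m g f - innerL2 m g h.
Proof.
move=> Lf Lh Lg; rewrite (innerL2_conj (L2B Lf Lh) Lg) innerL2B// rmorphB /=.
by rewrite -!innerL2_conj.
Qed.

Lemma innerL2_suml n (f : 'I_n -> T -> C) g : (forall i, L2 m (f i)) -> L2 m g ->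
  innerL2 m (fun x => \sum_(i < n) f i x) g = \sum_(i < n) innerL2 m (f i) g.
Proof.
elim: n f => [|n IH] f Lf Lg.
  rewrite big_ord0 /innerL2 (_ : (fun x => _) = (fun=> 0)) ?integralC_cst//.
  by apply/funext => x; rewrite big_ord0 mul0r.
under eq_fun do rewrite big_ord_recl.
rewrite innerL2D//; last by apply: L2_sum.
by rewrite IH// big_ord_recl.
Qed.

Lemma innerL2_self f : L2 m f -> innerL2 m f f = ofR (sqnorm f).
Proof.
move=> Lf; rewrite /innerL2 (_ : (fun x => _) = fun x => ofR (absC (f x) ^+ 2)).
  by rewrite /integralC /= Rintegral_cst// mul0r ofR0 mulr0 addr0.
by apply/funext => x; rewrite mulr_conj.
Qed.

Lemma sqnorm_lin (c : C) f g : L2 m f -> L2 m g ->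
  sqnorm (fun x => c * f x + g x) =
  absC c ^+ 2 * sqnorm f + sqnorm g + 2 * reC (c * innerL2 m f g).
Proof.
move=> Lf Lg; have Lh := L2_lin c Lf Lg.
have := innerL2_self Lh; rewrite innerL2_lin//.
rewrite (innerL2_conj Lh Lf) (innerL2_conj Lh Lg) !innerL2_lin// !innerL2_self//.
rewrite (innerL2_conj Lf Lg) => /(congr1 (@reC R)); rewrite reC_ofR => <-.
by rewrite absC_sq !CE; ring.
Qed.

Lemma sqnormD f g : L2 m f -> L2 m g ->
  sqnorm (fun x => f x + g x) = sqnorm f + sqnorm g + 2 * reC (innerL2 m f g).
Proof.
move=> Lf Lg; have := sqnorm_lin 1 Lf Lg.
by under eq_fun do rewrite mul1r; rewrite absC1 expr1n !mul1r.
Qed.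

Lemma sqnormB f g : L2 m f -> L2 m g ->
  sqnorm (fun x => f x - g x) = sqnorm f + sqnorm g - 2 * reC (innerL2 m f g).
Proof.
move=> Lf Lg; have := sqnorm_lin (-1) Lg Lf.
rewrite absCN absC1 expr1n mul1r mulN1r reCN (innerL2_conj Lf Lg) reC_conj mulrN.
move=> E; rewrite [sqnorm f + _]addrC -E; congr sqnorm.
by apply/funext => x; rewrite mulN1r addrC.
Qed.

(** The squared norm of (- t z^* ) f + g, where z is the inner product, is a
    nonnegative quadratic polynomial in the real number t. *)
Lemma Cauchy_Schwarz f g : L2 m f -> L2 m g ->
  absC (innerL2 m f g) <= nrm f * nrm g.
Proof.
move=> Lf Lg; set z := innerL2 m f g.
rewrite -(@ler_pXn2r _ 2)// ?nnegrE ?mulr_ge0 ?nrm_ge0 ?absC_ge0//.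
rewrite exprMn !nrm_sq.
have ineq t : 0 <= t ^+ 2 * absC z ^+ 2 * sqnorm f + sqnorm g - 2 * t * absC z ^+ 2.
  have := sqnorm_ge0 (fun x => (ofR (- t) * z^*) * f x + g x).
  rewrite sqnorm_lin// absCM absC_ofR absC_conj normrN exprMn real_normK ?num_real//.
  by rewrite -mulrA [_^* * _]mulrC mulr_conj -ofRM reC_ofR mulrA mulrN mulNr.
have := sqnorm_ge0 f; rewrite le_eqVlt => /predU1P[a0|a0].
  have [->|z0] := eqVneq (absC z ^+ 2) 0; first by rewrite -a0 mul0r.
  have zp : 0 < absC z ^+ 2 by rewrite lt_def z0 sqr_ge0.
  (* with no quadratic term, this value of t makes the linear term exceed sqnorm g *)
  have := ineq ((sqnorm g + 1) / (2 * absC z ^+ 2)).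
  have -> : 2 * ((sqnorm g + 1) / (2 * absC z ^+ 2)) * absC z ^+ 2 = sqnorm g + 1.
    by move: zp; set Z := absC z ^+ 2 => zp; field; rewrite gt_eqF.
  by rewrite -a0 mulr0 add0r; lra.
have := ineq (sqnorm f)^-1.
have -> : (sqnorm f)^-1 ^+ 2 * absC z ^+ 2 * sqnorm f = absC z ^+ 2 / sqnorm f.
  by field; rewrite gt_eqF.
rewrite mulrAC => h.
have : absC z ^+ 2 / sqnorm f <= sqnorm g.
  by move: h; rewrite -mulrA; lra.
by rewrite ler_pdivrMr// mulrC.
Qed.

Lemma nrmZ (c : C) f : L2 m f -> nrm (fun x => c * f x) = absC c * nrm f.
Proof.
move=> Lf; rewrite /nrm; have := sqnorm_lin c Lf (L2_cst 0).
under eq_fun do rewrite addr0; move=> ->.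
rewrite (_ : sqnorm (fun=> 0) = 0); last first.
  by rewrite /sqnorm absC0 Rintegral_cst// expr0n mul0r.
rewrite (_ : innerL2 m f _ = 0); last first.
  rewrite /innerL2 (_ : (fun x => _) = (fun=> 0)) ?integralC_cst//.
  by apply/funext => x; rewrite conjC0 mulr0.
rewrite mulr0 reC0 mulr0 !addr0 sqrtrM ?sqr_ge0// sqrtr_sqr ger0_norm//.
exact: absC_ge0.
Qed.

Lemma nrmD f g : L2 m f -> L2 m g -> nrm (fun x => f x + g x) <= nrm f + nrm g.
Proof.
move=> Lf Lg; rewrite -(@ler_pXn2r _ 2)// ?nnegrE ?addr_ge0 ?nrm_ge0//.
rewrite nrm_sq sqnormD// sqrrD !nrm_sq.
have := Cauchy_Schwarz Lf Lg; have := ler_reC (innerL2 m f g).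
have := ler_norm (reC (innerL2 m f g)); lra.
Qed.

Lemma nrm_tri f g h : L2 m f -> L2 m g -> L2 m h ->
  nrm (fun x => f x - h x) <= nrm (fun x => f x - g x) + nrm (fun x => g x - h x).
Proof.
move=> Lf Lg Lh; apply: le_trans (nrmD (L2B Lf Lg) (L2B Lg Lh)).
by under [X in _ <= nrm X]eq_fun do rewrite subrKA.
Qed.

Lemma dist2L2_nrm f g : L2 m f -> L2 m g ->
  dist2L2 m f g = (nrm (fun x => f x - g x) ^+ 2)%:E.
Proof. by move=> Lf Lg; rewrite nrm_sq -EFin_sqnorm//; exact: L2B. Qed.

Lemma nrm_eq0 f : L2 m f -> nrm f = 0 -> {ae m, forall x, f x = 0}.
Proof.
move=> Lf f0; have : (\int[m]_x `|(absC (f x) ^+ 2)%:E| = 0)%E.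
  rewrite -[RHS](_ : (sqnorm f)%:E = 0%E); last by rewrite -nrm_sq f0 expr0n.
  rewrite -EFin_sqnorm//; apply: eq_integral => x _.
  by rewrite /= ger0_norm// sqr_ge0.
move=> /(ae_eq_integral_abs m measurableT (measurable_int m (L2_int Lf))).
apply: filterS => x /= /(_ I) /eqP; rewrite eqe sqrf_eq0 absC_eq0.
by move/eqP.
Qed.

Lemma ae_nrm f g : L2 m f -> L2 m g -> {ae m, forall x, f x = g x} -> nrm f = nrm g.
Proof.
move=> Lf Lg fg; rewrite /nrm /sqnorm /Rintegral; congr (Num.sqrt (fine _)).
apply: ae_eq_integral => //.
- exact: measurable_int (L2_int Lf).
- exact: measurable_int (L2_int Lg).
- by apply: filterS fg => x -> .
Qed.

Lemma nrm0 : nrm (fun=> 0) = 0.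
Proof.
by rewrite /nrm /sqnorm absC0 Rintegral_cst// expr0n mul0r sqrtr0.
Qed.

Lemma ae_nrm0 f : L2 m f -> {ae m, forall x, f x = 0} -> nrm f = 0.
Proof. by move=> Lf f0; rewrite -nrm0; apply: ae_nrm => //; exact: L2_cst. Qed.

(** By the Cauchy-Schwarz inequality, applied to a difference of norm zero. *)
Lemma ae_innerL2 f f' g : L2 m f -> L2 m f' -> L2 m g ->
  {ae m, forall x, f x = f' x} -> innerL2 m f g = innerL2 m f' g.
Proof.
move=> Lf Lf' Lg ff'; apply/eqP; rewrite -subr_eq0 -absC_eq0 -innerL2B//.
have -> // : absC (innerL2 m (fun x => f x - f' x) g) = 0.
apply/eqP; rewrite eq_le absC_ge0 andbT.
apply: le_trans (Cauchy_Schwarz (L2B Lf Lf') Lg) _.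
rewrite ae_nrm0 ?mul0r//; first exact: L2B.
by apply: filterS ff' => x ->; rewrite subrr.
Qed.

Definition bmfun f := mfunC f /\ exists M, forall x, absC (f x) <= M.

Lemma bmfun_L2 f : bmfun f -> L2 m f.
Proof.
move=> [mf [M fM]]; apply: (@L2_le _ (fun=> M ^+ 2)) => //.
  exact: finite_measure_integrable_cst.
by move=> x; rewrite lerXn2r ?nnegrE ?absC_ge0// (le_trans (absC_ge0 _) (fM x)).
Qed.

Lemma sqnorm_le f M : (forall x, absC (f x) <= M) -> L2 m f -> sqnorm f <= M ^+ 2.
Proof.
move=> fM Lf; rewrite -[leRHS]mulr1.
have : (fine (m setT)) = 1 by rewrite (_ : m setT = 1%E)//; exact: probability_setT.
move=> <-; rewrite -Rintegral_cst//; apply: le_Rintegral => //.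
- exact: L2_int.
- exact: finite_measure_integrable_cst.
by move=> x _; rewrite lerXn2r ?nnegrE ?absC_ge0// (le_trans (absC_ge0 _) (fM x)).
Qed.

Lemma nrm_le f M : 0 <= M -> (forall x, absC (f x) <= M) -> L2 m f -> nrm f <= M.
Proof.
move=> M0 fM Lf; rewrite -(@ler_pXn2r _ 2)// ?nnegrE ?nrm_ge0// nrm_sq.
exact: sqnorm_le.
Qed.

Lemma Rintegral_absC_le_nrm f : L2 m f ->
  Rintegral m setT (fun x => absC (f x)) <= nrm f.
Proof.
move=> Lf; pose g x := ofR (absC (f x)).
have Lg : L2 m g.
  case: (Lf) => mf fi; split.
    by split => /=; [exact: mfunC_abs|exact: (measurable_cst _)].
  apply: le_lt_trans fi; rewrite le_eqVlt; apply/orP; left; apply/eqP.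
  by apply: eq_integral => x _; rewrite absC_ofR ger0_norm// absC_ge0.
have -> : nrm f = nrm g.
  rewrite /nrm /sqnorm; congr (Num.sqrt (Rintegral _ _ _)).
  by apply/funext => x; rewrite absC_ofR ger0_norm// absC_ge0.
have := Cauchy_Schwarz Lg (L2_cst 1); rewrite /innerL2.
under eq_fun do rewrite conjC1 mulr1.
rewrite /integralC /g /= Rintegral_cst// mul0r ofR0 mulr0 addr0 absC_ofR ger0_norm; last first.
  by apply: Rintegral_ge0 => x _; exact: absC_ge0.
move=> /le_trans; apply; rewrite -[leRHS]mulr1 ler_wpM2l ?nrm_ge0// nrm_le//.
  by move=> x; rewrite absC1.
exact: L2_cst.
Qed.

End L2_theory.

(** * The Riesz representation theorem on a compact space *)

(** What is used of metrisability: the indicator of an open set is the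
    increasing limit of continuous functions, in the strong sense that the
    sequence reaches the value one at every point of the set. *)
Definition open_approx (R : realType) (T : topologicalType) :=
  forall U : set T, open U -> exists h : nat -> T -> R,
    [/\ forall n, continuous (h n), forall n x, 0 <= h n x <= 1,
        forall n x, h n x <= h n.+1 x, forall n x, ~ U x -> h n x = 0 &
        forall x, U x -> \forall n \near \oo, h n x = 1].

(** The near-covering form of compactness is applied along the filter of finite
    subsets ordered by inclusion. *)
Lemma compact_finite_nbhs (T : topologicalType) (K : set T) (U : T -> set T) :
  compact K -> (forall x, K x -> nbhs x (U x)) ->
  exists s : seq T, forall y, K y -> exists2 x, x \in s & U x y.
Proof.
move=> cK hU; pose F : set_system (seq T) :=
  [set A : set (seq T) | exists s0 : seq T, forall s : seq T, {subset s0 <= s} -> A s].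
have FF : Filter F.
  split=> [|P Q [s1 h1] [s2 h2]|P Q PQ [s1 h1]]; first by exists [::].
    exists (s1 ++ s2) => s h; split; [apply: h1|apply: h2] => y ys; apply: h;
      by rewrite mem_cat ys ?orbT.
  by exists s1 => s /h1 /PQ.
have /compact_near_coveringP/(_ _ F
  (fun (s : seq T) y => exists2 x, x \in s & U x y) FF) := cK.
case=> [x Kx|s0 hs0]; last by exists s0 => y Ky; exact: (hs0 s0 (fun _ => id)).
exists (U x, [set s : seq T | x \in s]); last by case=> y s /= [h1 h2]; exists x.
by split; [exact: hU|exists [:: x] => s; apply; rewrite mem_head].
Qed.

Lemma continuous_borel_measurable (R : realType) (T : topologicalType) (x0 : T)
    (f : T -> R) : continuous f -> measurable_fun setT (f : borel x0 -> R).
Proof.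
move=> cf; apply: (measurability _ (RGenOInfty.measurableE R)) => //.
move=> _ [_ [a ->] <-]; rewrite setTI; apply: sub_sigma_algebra.
by apply: open_comp => //; rewrite set_itvE; exact: open_gt.
Qed.

(** The sum counts the integers from 1 to N that are at most y, which gives the
    integer part of y when y <= N. It writes a function as a combination of
    indicators of its level sets, up to an error controlled by the mesh. *)
Lemma count_le (R : realType) N (y : R) : 0 <= y ->
  \sum_(i < N) (i.+1%:R <= y)%R%:R <= y /\
  (y <= N%:R -> y < \sum_(i < N) (i.+1%:R <= y)%R%:R + 1).
Proof.
move=> y0; elim: N => [|N [IH1 IH2]]; first by rewrite big_ord0 add0r; split=> //; lra.
have full : N%:R <= y -> \sum_(i < N) (i.+1%:R <= y)%R%:R = N%:R :> R.
  move=> Ny; transitivity (\sum_(i < N) (1 : R)); last by rewrite sumr_const card_ord.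
  apply: eq_bigr => i _; rewrite (_ : (_ <= _) = true)//.
  by rewrite (le_trans _ Ny)// ler_nat.
rewrite big_ord_recr /=; have [h|h] := leP N.+1%:R y.
  have Ny : N%:R <= y by rewrite (le_trans _ h)// ler_nat.
  by rewrite full//= -natr1 in h *; split; lra.
rewrite addr0; split=> // _; have [Ny|Ny] := leP y N%:R; first exact: IH2.
by rewrite full ?(ltW Ny)// natr1.
Qed.

Section riesz.
Context (R : realType) (T : topologicalType) (x0 : T).
Hypothesis cT : compact [set: T].
Hypothesis oT : open_approx R T.
Variable L : (T -> R) -> R.
Implicit Types (f g : T -> R) (A B : set T).
Hypothesis Llin : forall (a : R) f g, continuous f -> continuous g ->
  L (fun x => a * f x + g x) = a * L f + L g.
Hypothesis Lpos : forall f, continuous f -> (forall x, 0 <= f x) -> 0 <= L f.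
Hypothesis L1 : L (fun=> 1) = 1.

Let cstc (a : R) : continuous (fun _ : T => a).
Proof. by move=> x; exact: cvg_cst. Qed.
Let cD f g : continuous f -> continuous g -> continuous (fun x => f x + g x).
Proof. by move=> cf cg x; apply: cvgD; [exact: cf|exact: cg]. Qed.
Let cB f g : continuous f -> continuous g -> continuous (fun x => f x - g x).
Proof. by move=> cf cg x; apply: cvgB; [exact: cf|exact: cg]. Qed.
Let cM f g : continuous f -> continuous g -> continuous (fun x => f x * g x).
Proof. by move=> cf cg x; apply: cvgM; [exact: cf|exact: cg]. Qed.

Let LD f g : continuous f -> continuous g -> L (fun x => f x + g x) = L f + L g.
Proof.
by move=> cf cg; have := Llin 1 cf cg; under eq_fun do rewrite mul1r; rewrite mul1r.
Qed.
Let L0 : L (fun=> 0) = 0.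
Proof.
by have := LD (@cstc 0) (@cstc 0); under eq_fun do rewrite addr0; lra.
Qed.
Let LZ a f : continuous f -> L (fun x => a * f x) = a * L f.
Proof.
by move=> cf; have := Llin a cf (@cstc 0); under eq_fun do rewrite addr0;
  rewrite L0 addr0.
Qed.
Let LB f g : continuous f -> continuous g -> L (fun x => f x - g x) = L f - L g.
Proof.
move=> cf cg; have := Llin (-1) cg cf; rewrite mulN1r addrC => <-.
by congr L; apply/funext => x; rewrite mulN1r addrC.
Qed.
Let Lcst a : L (fun=> a) = a.
Proof.
rewrite (_ : (fun=> a) = (fun x => a * (fun _ : T => 1) x)) ?LZ ?L1 ?mulr1//.
Qed.
Let Lle f g : continuous f -> continuous g -> (forall x, f x <= g x) -> L f <= L g.
Proof.
move=> cf cg fg; rewrite -subr_ge0 -LB//; apply: Lpos; first exact: cB.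
by move=> x; rewrite subr_ge0.
Qed.
Let csum n (f : 'I_n -> T -> R) : (forall i, continuous (f i)) ->
  continuous (fun x => \sum_(i < n) f i x).
Proof.
elim: n f => [|n IH] f cf; first rewrite (_ : (fun x => _) = fun=> 0).
- exact: cstc.
- by apply/funext => x; rewrite big_ord0.
rewrite (_ : (fun x => _) = fun x => f ord0 x + \sum_(i < n) f (lift ord0 i) x).
  by apply: cD => //; exact: IH.
by apply/funext => x; rewrite big_ord_recl.
Qed.
Let Lsum n (f : 'I_n -> T -> R) : (forall i, continuous (f i)) ->
  L (fun x => \sum_(i < n) f i x) = \sum_(i < n) L (f i).
Proof.
elim: n f => [|n IH] f cf; first by under eq_fun do rewrite big_ord0; rewrite big_ord0.
by under eq_fun do rewrite big_ord_recl; rewrite LD ?IH ?big_ord_recl//; exact: csum.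
Qed.

(** A limit-free form of u <= sup_n (G n), which also makes sense when the
    supremum is infinite. *)
Definition dominates (G : nat -> T -> R) (u : T -> R) :=
  forall x (c : R), c < u x -> exists n, c < G n x.

Definition increasing_cont (G : nat -> T -> R) :=
  [/\ forall n, continuous (G n), forall n x, 0 <= G n x &
      forall n x, G n x <= G n.+1 x].

Let inc_le G : increasing_cont G -> forall m n x, (m <= n)%N -> G m x <= G n x.
Proof.
move=> [_ _ inc] m n x; elim: n => [|n IH]; first by rewrite leqn0 => /eqP ->.
by rewrite leq_eqVlt => /predU1P[->//|/IH h]; exact: le_trans h (inc _ _).
Qed.

Let LG_le G : increasing_cont G -> forall m n, (m <= n)%N -> L (G m) <= L (G n).
Proof.
move=> iG m n mn; case: (iG) => cG _ _; apply: Lle => // x; exact: inc_le.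
Qed.

(** Dini argument: if the sup of the increasing sequence exceeds f - e at each
    point, some G N exceeds f - e everywhere by compactness. *)
Lemma dini f G S : continuous f -> increasing_cont G -> dominates G f ->
  (forall n, L (G n) <= S) -> L f <= S.
Proof.
move=> cf iG dom GS; case: (iG) => cG _ _; apply/ler_addgt0Pr => e e0.
have /compact_near_coveringP/(_ nat \oo (fun n x => f x - e < G n x)) := cT.
case=> [x _|N _ hN].
- have [|n fx] := dom x (f x - e); first by rewrite ltrBlDr ltrDl.
  exists ([set y | f y - e < G n y], [set k | (n <= k)%N]).
    split; last by exists n.
    rewrite (_ : mkset _ = (fun y => G n y - (f y - e)) @^-1` [set z | 0 < z]).
      apply: open_nbhs_nbhs; split; last by rewrite /= subr_gt0.
      apply: open_comp; last exact: open_gt.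
      by move=> y _; apply: cB => //; apply: cB => //; exact: cstc.
    by apply/seteqP; split => y /=; rewrite subr_gt0.
  by case=> y k [/= h nk]; apply: lt_le_trans h _; exact: inc_le.
rewrite -lerBlDr -[e]Lcst -LB//.
apply: le_trans (GS N); apply: Lle => // [|x]; first by apply: cB => //; exact: cstc.
exact: ltW (hN N (leqnn N) x I).
Qed.

(** The analogue of a countable open cover of A of total cost S, with increasing
    sequences of continuous functions in place of unions of open sets. *)
Definition cover A (S : R) := exists2 G, increasing_cont G &
  dominates G \1_A /\ forall n, L (G n) <= S.

Let cover_ge0 A S : cover A S -> 0 <= S.
Proof.
by move=> [G [cG G0 _] [_ /(_ 0%N)]]; apply: le_trans; exact: Lpos.
Qed.
Let cover1 A : cover A 1.
Proof.
exists (fun _ _ => 1); first by split=> // n; exact: cstc.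
split=> [x c|n]; last by rewrite L1.
by rewrite indicE; case: (x \in A) => /= c1; exists 0%N => //; exact: lt_trans c1 _.
Qed.

(** The upper integral of the indicator of A. *)
Definition om A : R := inf [set S | cover A S].

Let om_has_inf A : has_inf [set S | cover A S].
Proof.
split; first by exists 1; exact: cover1.
by exists 0 => S /= /cover_ge0.
Qed.
Let om_le A S : cover A S -> om A <= S.
Proof. by move=> cS; apply: ge_inf => //; case: (om_has_inf A). Qed.
Let om_ge A s : (forall S, cover A S -> s <= S) -> s <= om A.
Proof.
by move=> h; apply: lb_le_inf => //; exists 1; exact: cover1.
Qed.
Let om_ge0 A : 0 <= om A.
Proof. by apply: om_ge => S /cover_ge0. Qed.
Let om_adh A e : 0 < e -> exists2 S, cover A S & S < om A + e.
Proof. by move=> e0; exact: (inf_adherent e0 (om_has_inf A)). Qed.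

Let coverS A B S : A `<=` B -> cover B S -> cover A S.
Proof.
move=> AB [G iG [dom GS]]; exists G => //; split=> // x c cA; apply: dom.
apply: lt_le_trans cA _; rewrite !indicE ler_nat.
by have [/set_mem/AB/mem_set ->|] := boolP (x \in A).
Qed.
Let om_mono A B : A `<=` B -> om A <= om B.
Proof. by move=> AB; apply: om_ge => S /(coverS AB); exact: om_le. Qed.

(** The partial sums over a growing set of indices form one increasing
    sequence; this is what makes the outer measure countably subadditive. *)
Let cover_bigcup (F : nat -> set T) (s : nat -> R) S : (forall i, cover (F i) (s i)) ->
  (forall n, \sum_(i < n) s i <= S) -> cover (\bigcup_i F i) S.
Proof.
move=> cF sS; have /choice[G GP] : forall i, exists G, increasing_cont G /\
    (dominates G \1_(F i) /\ forall n, L (G n) <= s i).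
  by move=> i; have [G ? ?] := cF i; exists G.
exists (fun n x => \sum_(i < n) G i n x).
  split=> [n|n x|n x].
  - by apply: csum => i; case: (GP i) => -[].
  - by apply: sumr_ge0 => i _; case: (GP i) => -[].
  - rewrite big_ord_recr /= -[leLHS]addr0 lerD//; last by case: (GP n) => -[].
    by apply: ler_sum => i _; case: (GP i) => -[].
split=> [x c|n]; last first.
  rewrite Lsum; last by move=> i; case: (GP i) => -[].
  by apply: le_trans (sS n); apply: ler_sum => i _; case: (GP i) => _ [].
have pos n : 0 <= \sum_(i < n) G i n x.
  by apply: sumr_ge0 => i _; case: (GP i) => -[].
rewrite indicE; have [/set_mem[i _ Fix]|_] := boolP (x \in _) => /= c1; last first.
  by exists 0%N; apply: lt_le_trans c1 (pos 0%N).
have [iG [dom _]] := GP i; have [|n cG] := dom x c.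
  by rewrite indicE mem_set.
exists (maxn n i.+1); apply: lt_le_trans cG _.
apply: le_trans (inc_le iG x (leq_maxl n i.+1)) _.
have ii : (i < maxn n i.+1)%N by rewrite leq_max ltnS leqnn orbT.
rewrite (bigD1 (Ordinal ii))//= lerDl sumr_ge0// => j _.
by case: (GP j) => -[].
Qed.

Definition omE A : \bar R := (om A)%:E.

Let omE0 : omE set0 = 0%E.
Proof.
congr EFin; apply/eqP; rewrite eq_le om_ge0 andbT; apply: om_le.
exists (fun _ _ => 0); first by split=> // n; exact: cstc.
by split=> [x c|n]; [rewrite indic0; exists 0%N|rewrite L0].
Qed.
Let omE_ge0 A : (0 <= omE A)%E. Proof. by rewrite lee_fin. Qed.
Let omE_mono : {homo omE : A B / A `<=` B >-> (A <= B)%E}.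
Proof. by move=> A B AB; rewrite lee_fin om_mono. Qed.
Let omE_ssa : sigma_subadditive omE.
Proof.
move=> F; apply/lee_addgt0Pr => e e0.
apply: le_trans (epsilon_trick _ _ (ltW e0)) => //.
have omS i : exists S, cover (F i) S /\ S <= om (F i) + e / (2 ^ i.+1)%:R.
  have [|S cS Se] := @om_adh (F i) (e / (2 ^ i.+1)%:R).
    by rewrite divr_gt0// ltr0n expn_gt0.
  by exists S; split=> //; exact: ltW.
have /choice[s sP] := omS.
set S := (X in (_ <= X)%E).
have s0 i : 0 <= s i by have [/cover_ge0] := sP i.
have hS n : ((\sum_(i < n) s i)%:E <= S)%E.
  rewrite /S -sumEFin; apply: (@le_trans _ _
    (\sum_(0 <= i < n) (omE (F i) + (e / (2 ^ i.+1)%:R)%:E))%E).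
    rewrite big_mkord; apply: lee_sum => i _.
    by rewrite -EFinD lee_fin; have [] := sP i.
  apply: nneseries_lim_ge => i _ _; rewrite adde_ge0// lee_fin divr_ge0// ltW//.
move: hS; case: S => [r hr|_|/(_ 0%N)]; rewrite ?leey//.
  by rewrite lee_fin om_le//; apply: cover_bigcup (fun i => (sP i).1) _.
Qed.

HB.instance Definition _ := isOuterMeasure.Build R T omE
  omE0 omE_ge0 omE_mono omE_ssa.

(** Caratheodory splitting of X by an open set U. If G covers X and h
    increases to the indicator of U, then G h covers the part of X in U, while
    G (1 - h j) covers the rest for every fixed j; the total cost is that of
    G up to the gap between the integral of G j h j and the limit. *)
Let open_cara U : open U -> omE.-caratheodory U.
Proof.
move=> oU; apply: le_caratheodory_measurable => X.
rewrite -EFinD lee_fin; apply: om_ge => S [G iG [dom GS]].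
have [h [ch h01 hS hU hU1]] := oT oU.
case: (iG) => cG G0 GI.
have iGh : increasing_cont (fun n x => G n x * h n x).
  split=> [n|n x|n x]; first exact: cM.
    by rewrite mulr_ge0//; have /andP[] := h01 n x.
  by apply: ler_pM => //; have /andP[] := h01 n x.
have bnd n : L (fun x => G n x * h n x) <= S.
  apply: le_trans (GS n); apply: Lle => // [|x]; first exact: cM.
  by rewrite ler_piMr//; have /andP[] := h01 n x.
pose Y := [set L (fun x => G n x * h n x) | n in [set: nat]].
have supY : has_sup Y.
  by split; [exists (L (fun x => G 0%N x * h 0%N x)); exists 0%N|
    exists S => _ [n _ <-]].
have h1 : om (X `&` U) <= sup Y.
  apply: om_le; exists (fun n x => G n x * h n x) => //; split=> [x c|n]; last first.
    by apply: ub_le_sup; [case: supY|exists n].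
  rewrite indicE; have [/set_mem[Xx Ux]|_] := boolP (x \in _) => /= c1; last first.
    by exists 0%N; apply: lt_le_trans c1 _; case: iGh.
  have [|n cn] := dom x c; first by rewrite indicE mem_set.
  have [N _ hN] := hU1 x Ux; exists (maxn n N).
  rewrite hN ?mulr1/=; last exact: leq_maxr.
  by apply: lt_le_trans cn _; apply: inc_le => //; exact: leq_maxl.
suff h2 : om (X `&` ~` U) <= S - sup Y by lra.
apply/ler_addgt0Pr => e e0.
have [_ [j _ <-] hj] := sup_adherent e0 supY.
apply: om_le; exists (fun n x => G n x * (1 - h j x)).
  split=> [n|n x|n x].
  - by apply: cM => //; apply: cB => //; exact: cstc.
  - by rewrite mulr_ge0// subr_ge0; have /andP[] := h01 j x.
  - by rewrite ler_wpM2r// subr_ge0; have /andP[] := h01 j x.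
split=> [x c|n].
  rewrite indicE; have [/set_mem[Xx Ux]|_] := boolP (x \in _) => /= c1; last first.
    exists 0%N; apply: lt_le_trans c1 _.
    by rewrite mulr_ge0// subr_ge0; have /andP[] := h01 j x.
  have [|n cn] := dom x c; first by rewrite indicE mem_set.
  by exists n; rewrite hU// subr0 mulr1.
apply: (@le_trans _ _ (L (fun x => G (maxn n j) x * (1 - h j x)))).
  apply: Lle => [||x].
  - by apply: cM => //; apply: cB => //; exact: cstc.
  - by apply: cM => //; apply: cB => //; exact: cstc.
  - by rewrite ler_wpM2r ?subr_ge0 ?inc_le ?leq_maxl//; have /andP[] := h01 j x.
rewrite (_ : (fun x => _) = (fun x => G (maxn n j) x - G (maxn n j) x * h j x)).
  rewrite LB ?(GS _)//; last exact: cM.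
  have : L (fun x => G j x * h j x) <= L (fun x => G (maxn n j) x * h j x).
    apply: Lle => [||x]; [exact: cM|exact: cM|].
    by rewrite ler_wpM2r ?inc_le ?leq_maxr//; have /andP[] := h01 j x.
  by have := GS (maxn n j); lra.
by apply/funext => x; rewrite mulrBr mulr1.
Qed.

Let borel_cara (B : set (borel x0)) : measurable B -> omE.-caratheodory (B : set T).
Proof.
move=> mB; apply: (@smallest_sub _ (sigma_algebra setT) (@open T) omE.-caratheodory) mB.
  split=> [|A hA|F hF].
  - exact: (caratheodory_measurable_set0 omE).
  - by rewrite setTD; apply: (caratheodory_measurable_setC hA).
  - exact: (caratheodory_measurable_bigcup hF).
by move=> U oU; exact: open_cara.
Qed.

Definition riesz_measure (B : set (borel x0)) : \bar R := omE B.

Let riesz0 : riesz_measure set0 = 0%E. Proof. exact: omE0. Qed.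
Let riesz_ge0 B : (0 <= riesz_measure B)%E. Proof. exact: omE_ge0. Qed.
Let riesz_sa : semi_sigma_additive riesz_measure.
Proof.
move=> F mF tF mU.
apply: (@caratheodory_measure_sigma_additive R (borel x0) omE) => //.
  by move=> i; exact: borel_cara.
exact: borel_cara.
Qed.
HB.instance Definition _ := isMeasure.Build _ _ _ riesz_measure
  riesz0 riesz_ge0 riesz_sa.

Let rieszT : riesz_measure setT = 1%E.
Proof.
congr EFin; apply/eqP; rewrite eq_le om_le//=; apply: om_ge => S [G iG [dom GS]].
by rewrite -L1; apply: (dini (@cstc 1) iG) GS => x c c1; apply: dom;
  rewrite indicE in_setT.
Qed.
HB.instance Definition _ := Measure_isProbability.Build _ _ _ riesz_measure rieszT.

Let m : probability (borel x0) R := riesz_measure.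

Let int_cont f : continuous f -> (exists M, forall x, `|f x| <= M) ->
  m.-integrable setT (EFin \o f).
Proof.
move=> cf [M fM]; have := finite_measure_integrable_cst m M measurableT.
apply: le_integrable => //; first by apply/measurable_EFinP; exact: (@continuous_borel_measurable _ _ x0 _ cf).
by move=> x _ /=; rewrite lee_fin (le_trans (fM x))// ler_norm.
Qed.

(** With mesh 1/N the function f is, up to 1/N, the mean of the indicators of
    its level sets, and an efficient cover of each of these level sets gives an
    increasing sequence that dominates f; the Dini argument concludes. *)
Let L_le_int f : continuous f -> (forall x, 0 <= f x <= 1) ->
  L f <= Rintegral m setT f.
Proof.
move=> cf f01; apply/ler_addgt0Pr => e e0.
have [k ke] : exists k, k.+1%:R^-1 < e / 2.
  have := near_infty_natSinv_lt (PosNum (divr_gt0 e0 (ltr0n R 2))).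
  by case=> k _ /(_ k (leqnn k)) h; exists k.
set N := k.+1 in ke; have N0 : 0 < N%:R :> R by rewrite ltr0n.
pose B (i : 'I_N) : set (borel x0) := [set x | i.+1%:R <= N%:R * f x].
have mB i : measurable (B i).
  rewrite -[B i]setTI; have /(@continuous_borel_measurable R T x0)mNf :
    continuous (fun x => N%:R * f x) by apply: cM => //; exact: cstc.
  have := mNf measurableT _ (measurable_itv `[i.+1%:R, +oo[).
  by congr measurable; apply/seteqP; split => x /=; rewrite in_itv /= andbT.
have /choice[S SP] : forall i, exists S, cover (B i) S /\ S < om (B i) + e / 2.
  by move=> i; have [S ? ?] := @om_adh (B i) _ (divr_gt0 e0 (ltr0n R 2)); exists S.
have /choice[G GP] : forall i, exists G, increasing_cont G /\
    (dominates G \1_(B i) /\ forall n, L (G n) <= S i).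
  by move=> i; have [[G ? ?] _] := SP i; exists G.
have cS n : continuous (fun x => \sum_(i < N) G i n x).
  by apply: csum => i; case: (GP i) => -[].
have h1 : L f <= N%:R^-1 * \sum_(i < N) S i + N%:R^-1.
  apply: (@dini f (fun n x => N%:R^-1 * (\sum_(i < N) G i n x) + N%:R^-1)) => //.
  - split=> [n|n x|n x].
    + by apply: cD; [apply: cM => //; exact: cstc|exact: cstc].
    + apply: addr_ge0; last by rewrite invr_ge0 ltW.
      apply: mulr_ge0; first by rewrite invr_ge0 ltW.
      by apply: sumr_ge0 => i _; case: (GP i) => -[].
    + rewrite lerD2r ler_wpM2l ?invr_ge0 ?(ltW N0)//.
      by apply: ler_sum => i _; case: (GP i) => -[].
  - move=> x c cf'; have /andP[fx0 fx1] := f01 x.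
    have [_ hk] := @count_le R N (N%:R * f x) (mulr_ge0 (ltW N0) fx0).
    set K := \sum_(i < N) _ in hk.
    have {}hk : N%:R * f x < K + 1 by apply: hk; rewrite ler_piMr// ltW.
    pose dl := (K + 1 - N%:R * c) / (2 * N%:R).
    have Nc : N%:R * c < N%:R * f x by rewrite ltr_pM2l.
    have dl0 : 0 < dl by rewrite divr_gt0 ?mulr_gt0//; lra.
    have /choice[nn nP] : forall i : 'I_N, exists n,
        (i.+1%:R <= N%:R * f x)%R%:R - dl < G i n x.
      move=> i; case: (GP i) => _ [dom _]; apply: dom; rewrite indicE.
      case: (leP i.+1%:R (N%:R * f x)) => h; last first.
        by case: (_ \in _) => /=; lra.
      by rewrite mem_set//=; lra.
    exists (\max_(i < N) nn i)%N.
    have : K - N%:R * dl <= \sum_(i < N) G i (\max_(i < N) nn i)%N x.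
      have -> : N%:R * dl = \sum_(i < N) dl by rewrite sumr_const card_ord mulr_natl.
      rewrite /K -sumrB; apply: ler_sum => i _; apply: (le_trans (ltW (nP i))).
      by apply: inc_le; [case: (GP i)|exact: leq_bigmax].
    have -> : N%:R * dl = (K + 1 - N%:R * c) / 2 by rewrite /dl; field; rewrite gt_eqF.
    move=> h; rewrite -(ltr_pM2l N0) mulrDr mulrA divff ?gt_eqF// mul1r; lra.
  - move=> n; rewrite LD; [|by apply: cM => //; exact: cstc|exact: cstc].
    rewrite LZ// Lcst lerD2r ler_wpM2l ?invr_ge0 ?(ltW N0)// Lsum.
      by apply: ler_sum => i _; case: (GP i) => _ [].
    by move=> i; case: (GP i) => -[].
have h2 : N%:R^-1 * \sum_(i < N) S i <= N%:R^-1 * \sum_(i < N) om (B i) + e / 2.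
  rewrite -(ler_pM2l N0) mulrDr !mulrA divff ?gt_eqF// !mul1r.
  have -> : N%:R * e / 2 = \sum_(i < N) (e / 2).
    by rewrite sumr_const card_ord -mulrA mulr_natl.
  by rewrite -big_split /=; apply: ler_sum => i _; apply: ltW; case: (SP i).
have h3 : N%:R^-1 * \sum_(i < N) om (B i) <= Rintegral m setT f.
  rewrite ler_pdivrMl// -RintegralZl//; last first.
    apply: int_cont => //; exists 1 => x; have /andP[fx0 fx1] := f01 x.
    by rewrite ger0_norm.
  have iN : m.-integrable setT (EFin \o (fun x => N%:R * f x)).
    apply: int_cont; first by apply: cM => //; exact: cstc.
    exists N%:R => x; have /andP[fx0 fx1] := f01 x.
    by rewrite ger0_norm ?mulr_ge0// ler_piMr.
  rewrite -lee_fin /Rintegral fineK; last first.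
    exact: (integrable_fin_num measurableT iN).
  rewrite -sumEFin.
  have -> : (\sum_(i < N) (om (B i))%:E)%E =
      (\int[m]_x (\sum_(i < N) (\1_(B i) x : R)%:E))%E.
    rewrite ge0_integral_sum//; last first.
      by move=> i; apply/measurable_EFinP; exact: measurable_indic.
    by apply: eq_bigr => i _; rewrite integral_indic// setIT.
  apply: ge0_le_integral => //.
  - by move=> x _; apply: sume_ge0 => i _; rewrite lee_fin.
  - apply: emeasurable_sum => i; apply/measurable_EFinP; exact: measurable_indic.
  - exact: measurable_int iN.
  - move=> x _; rewrite sumEFin lee_fin; have /andP[fx0 _] := f01 x.
    have [h _] := @count_le R N (N%:R * f x) (mulr_ge0 (ltW N0) fx0).
    apply: le_trans h; rewrite le_eqVlt; apply/orP; left; apply/eqP.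
    apply: eq_bigr => i _; rewrite indicE; congr (_%:R); congr nat_of_bool.
    by apply/idP/idP => [/set_mem//|h]; rewrite mem_set.
lra.
Qed.

(** One inequality holds for functions with values in the unit interval.
    Applied to f and to 1 - f it gives equality, and affine rescaling reaches
    all continuous functions. *)
Lemma riesz_integral f : continuous f -> Rintegral m setT f = L f.
Proof.
move=> cf.
have cst1 : Rintegral m setT (fun=> 1 : R) = 1.
  rewrite Rintegral_cst// mul1r; transitivity (fine (1%:E : \bar R)) => //.
  by congr fine; exact: rieszT.
have E01 g : continuous g -> (forall x, 0 <= g x <= 1) -> Rintegral m setT g = L g.
  move=> cg g01; apply/eqP; rewrite eq_le L_le_int// andbT.
  have c1g : continuous (fun x => 1 - g x) by apply: cB => //; exact: cstc.
  have := @L_le_int (fun x => 1 - g x) c1g.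
  rewrite LB ?L1 ?RintegralB ?cst1//; last 2 first.
  - exact: finite_measure_integrable_cst.
  - by apply: int_cont => //; exists 1 => x; have /andP[? ?] := g01 x; rewrite ger0_norm.
  move=> h; have {}h : 1 - L g <= 1 - Rintegral m setT g.
    by apply: h => x; have /andP[? ?] := g01 x; apply/andP; split; lra.
  lra.
have [M M0 fM] : exists2 M, 0 < M & forall x, `|f x| <= M.
  have : compact (range f) by apply: continuous_compact => //; exact: continuous_subspaceT.
  move=> /compact_bounded[M [_ hM]]; exists (`|M| + 1); first by rewrite ltr_wpDl.
  move=> x; apply: (hM (`|M| + 1)); last by exists x.
  by rewrite (le_lt_trans (ler_norm _))// ltrDl.
pose g x := (2 * M)^-1 * f x + 2^-1.
have cg : continuous g by apply: cD; [apply: cM => //; exact: cstc|exact: cstc].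
have g01 x : 0 <= g x <= 1.
  have := fM x; rewrite ler_norml => /andP[f1 f2].
  have e : (2 * M)^-1 * M = 2^-1 by field; rewrite gt_eqF.
  have i0 : 0 < (2 * M)^-1 by rewrite invr_gt0 mulr_gt0.
  have : (2 * M)^-1 * - M <= (2 * M)^-1 * f x by rewrite ler_pM2l.
  have : (2 * M)^-1 * f x <= (2 * M)^-1 * M by rewrite ler_pM2l.
  by rewrite mulrN e /g => *; apply/andP; split; lra.
have fE : f = fun x => 2 * M * g x + - M.
  by apply/funext => x; rewrite /g; field; rewrite gt_eqF.
have ig : m.-integrable setT (EFin \o g).
  by apply: int_cont => //; exists 1 => x; have /andP[? ?] := g01 x; rewrite ger0_norm.
have iMg : m.-integrable setT (EFin \o (fun x => 2 * M * g x)).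
  by have := integrableZl measurableT (2 * M) ig; apply: eq_integrable.
rewrite [in LHS]fE RintegralD//; last exact: finite_measure_integrable_cst.
rewrite RintegralZl// E01//.
have -> : Rintegral m setT (fun=> - M) = - M.
  rewrite Rintegral_cst//; transitivity (- M * fine (1%:E : \bar R)); last by rewrite mulr1.
  by congr (_ * fine _); exact: rieszT.
by rewrite [in RHS]fE (Llin _ cg (@cstc _)) Lcst.
Qed.

(** Composition with h carries covers of B to covers of its preimage at the
    same cost, and composition with the inverse k carries them back. *)
Lemma riesz_invariant (h k : T -> T) (B : set T) : continuous h -> continuous k ->
  cancel h k -> cancel k h -> (forall f, continuous f -> L (f \o h) = L f) ->
  riesz_measure (h @^-1` B) = riesz_measure B.
Proof.
move=> ch ck hk kh Lh.
have Lk f : continuous f -> L (f \o k) = L f.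
  move=> cf; rewrite -Lh; last by move=> x; apply: continuous_comp; [exact: ck|exact: cf].
  by congr L; apply/funext => x /=; rewrite hk.
have pull (g : T -> T) A S : continuous g ->
    (forall f, continuous f -> L (f \o g) = L f) -> cover A S -> cover (g @^-1` A) S.
  move=> cg Lg [G [cG G0 GI] [dom GS]]; exists (fun n => G n \o g).
    split=> [n x|n x|n x] /=; [|exact: G0|exact: GI].
    by apply: continuous_comp; [exact: cg|exact: cG].
  by split=> [x c cA|n]; [exact: dom|rewrite Lg].
congr EFin; apply/eqP; rewrite eq_le; apply/andP; split; apply: om_ge => S cS.
  by apply: om_le; exact: pull.
apply: om_le; have := pull k _ _ ck Lk cS.
by congr cover; apply/seteqP; split => x /=; rewrite kh.
Qed.

Theorem riesz_representation : exists P : probability (borel x0) R,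
  (forall f, continuous f -> Rintegral P setT f = L f) /\
  (forall (h k : T -> T), continuous h -> continuous k -> cancel h k -> cancel k h ->
    (forall f, continuous f -> L (f \o h) = L f) ->
    forall B : set (borel x0), measurable B -> P (h @^-1` B) = P B).
Proof.
exists m; split=> [f cf|h k ch ck hk kh Lh B _]; first exact: riesz_integral.
exact: riesz_invariant ch ck hk kh Lh.
Qed.

End riesz.

(** * Density of the bounded continuous functions *)

(** The functions are min(1, n D), where D is the distance to the
    complement of the open set. *)
Lemma metrisable_open_approx (R : realType) (T : topologicalType) :
  metrisable R T -> open_approx R T.
Proof.
move=> [d [d0 dE dC dT dN]] U oU.
have [UT|[y0 Uy0]] : U = setT \/ exists y, ~ U y.
- have [h|/existsNP h] := pselect (forall y, U y); last by right.
  by left; apply/seteqP; split.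
- exists (fun _ _ => 1); split=> [n|n x|n x|n x|x _].
  + exact: cst_continuous.
  + by rewrite ler01 lexx.
  + exact: lexx.
  + by rewrite UT => /(_ I).
  + by exists 0%N.
pose E x := [set d x y | y in ~` U].
have Ei x : has_inf (E x).
  by split; [exists (d x y0), y0|exists 0 => _ [y _ <-]].
pose D x := inf (E x).
have D0 x : 0 <= D x.
  by apply: lb_le_inf; [case: (Ei x)|move=> _ [y _ <-]].
have DL x y : D x <= d x y + D y.
  rewrite -lerBlDl; apply: lb_le_inf; first by case: (Ei y).
  move=> _ [z Uz <-]; rewrite lerBlDl; apply: le_trans (dT x y z).
  by apply: ge_inf; [case: (Ei x)|exists z].
have DU x : U x -> 0 < D x.
  move=> Ux; have /dN[r r0 rU] : nbhs x U by apply: open_nbhs_nbhs.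
  apply: lt_le_trans r0 _; apply: lb_le_inf; first by case: (Ei x).
  by move=> _ [z Uz <-]; rewrite leNgt; apply/negP => /rU.
have DnU x : ~ U x -> D x = 0.
  move=> Ux; apply/eqP; rewrite eq_le D0 andbT; apply: ge_inf.
    by case: (Ei x).
  by exists x => //; apply/dE.
have cD : continuous D.
  move=> x; apply/cvgrPdist_lt => e e0; apply/dN; exists e => // y /= dxy.
  have := DL x y; have := DL y x; rewrite (dC y x) ltr_norml => h1 h2.
  by apply/andP; split; lra.
exists (fun n x => Num.min 1 (n%:R * D x)); split.
- move=> n x; apply: (@continuous_min R T (fun=> 1) (fun x => n%:R * D x)).
    exact: cvg_cst.
  by apply: cvgM; [exact: cvg_cst|exact: cD].
- by move=> n x; rewrite le_min ler01 mulr_ge0//= ge_min lexx.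
- move=> n x; rewrite le_min !ge_min lexx/=; apply/orP; right.
  by rewrite ler_wpM2r// ler_nat.
- by move=> n x /DnU ->; rewrite mulr0; apply/min_idPr; exact: ler01.
- move=> x /DU Dx; exists (Num.truncn (D x)^-1).+1 => // n /= hn.
  apply/min_idPl; rewrite -ler_pdivrMr// mul1r.
  apply: (le_trans (ltW (truncnS_gt _))).
  by rewrite ler_nat.
Qed.

Section density.
Context (R : realType) (T : topologicalType) (x0 : T).
Hypothesis oT : open_approx R T.
Variable m : probability (borel x0) R.
Local Notation C := (Cx R).
Implicit Types f g : T -> C.

Definition bcont f := continuous f /\ exists M, forall x, absC (f x) <= M.

Lemma continuous_mfunC f : continuous f -> mfunC (f : borel x0 -> C).
Proof.
move=> cf; split; apply: continuous_borel_measurable => x.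
  by apply: cvg_reC; exact: cf.
by apply: cvg_imC; exact: cf.
Qed.

Lemma bcont_L2 f : bcont f -> L2 m f.
Proof. by move=> [cf bf]; apply: bmfun_L2; split=> //; exact: continuous_mfunC. Qed.

Lemma bcont_lin (c : C) f g : bcont f -> bcont g -> bcont (fun x => c * f x + g x).
Proof.
move=> [cf [M fM]] [cg [N gN]]; split.
  move=> x; apply: cvgD; last exact: cg.
  by apply: cvgM; [exact: cvg_cst|exact: cf].
exists (absC c * M + N) => x; apply: le_trans (absCD _ _) _.
by rewrite absCM lerD// ler_wpM2l ?absC_ge0.
Qed.

Lemma bcont_cst (c : C) : bcont (fun=> c).
Proof. by split; [exact: cst_continuous|exists (absC c)]. Qed.

(** The closure of the bounded continuous functions in the L2 space. *)
Definition apx (f : borel x0 -> C) := L2 m f /\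
  forall e : R, 0 < e -> exists2 g, bcont g & nrm m (fun x => f x - g x) < e.

Lemma apx_bcont f : bcont f -> apx f.
Proof.
move=> bf; split; first exact: bcont_L2.
move=> e e0; exists f => //; rewrite (_ : (fun x => _) = (fun=> 0)) ?nrm0//.
by apply/funext => x; rewrite subrr.
Qed.

Lemma apx_lim (f : borel x0 -> C) : L2 m f ->
  (forall e : R, 0 < e -> exists2 g, apx g & nrm m (fun x => f x - g x) < e) ->
  apx f.
Proof.
move=> Lf H; split=> // e e0; have e20 : 0 < e / 2 by rewrite divr_gt0.
have [g [Lg Hg] fg] := H _ e20; have [h bh gh] := Hg _ e20.
exists h => //; rewrite [e]splitr; apply: le_lt_trans (ltrD fg gh).
by apply: nrm_tri => //; exact: bcont_L2.
Qed.

Lemma apx_lin (c : C) (f g : borel x0 -> C) : apx f -> apx g ->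
  apx (fun x => c * f x + g x).
Proof.
move=> [Lf Hf] [Lg Hg]; split; first exact: L2_lin.
move=> e e0; have k0 : 0 < absC c + 1 by rewrite ltr_wpDl ?absC_ge0.
have e20 : 0 < e / 2 by rewrite divr_gt0.
have [h bh fh] := Hf _ (divr_gt0 e20 k0); have [k bk gk] := Hg _ e20.
exists (fun x => c * h x + k x); first exact: bcont_lin.
have Lh := bcont_L2 bh; have Lk := bcont_L2 bk.
rewrite (_ : (fun x => _) = (fun x => c * (f x - h x) + (g x - k x))); last first.
  by apply/funext => x; ring.
apply: le_lt_trans (nrmD (L2Z c (L2B Lf Lh)) (L2B Lg Lk)) _.
rewrite nrmZ; last exact: L2B.
rewrite [e]splitr ler_ltD//.
apply: le_trans (_ : (absC c + 1) * (e / 2 / (absC c + 1)) <= _); last first.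
  by rewrite mulrCA divff ?gt_eqF// mulr1.
by apply: ler_pM => //; rewrite ?nrm_ge0 ?absC_ge0 ?lerDl// ltW.
Qed.

Lemma apx_cst (c : C) : apx (fun=> c).
Proof. by apply: apx_bcont; exact: bcont_cst. Qed.

Lemma apxD f g : apx f -> apx g -> apx (fun x => f x + g x).
Proof. by move=> af ag; have := apx_lin 1 af ag; under eq_fun do rewrite mul1r. Qed.
Lemma apxZ c f : apx f -> apx (fun x => c * f x).
Proof.
by move=> af; have := apx_lin c af (apx_cst 0); under eq_fun do rewrite addr0.
Qed.
Lemma apx_sum n (f : 'I_n -> T -> C) : (forall i, apx (f i)) ->
  apx (fun x => \sum_(i < n) f i x).
Proof.
elim: n f => [|n IH] f af.
  by under eq_fun do rewrite big_ord0; exact: apx_cst.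
under eq_fun do rewrite big_ord_recl; apply: apxD => //; exact: IH.
Qed.

Definition indC (A : set (borel x0)) (x : borel x0) : C := ofR (\1_A x).

Lemma indC_L2 A : measurable A -> L2 m (indC A).
Proof.
move=> mA; apply: bmfun_L2; split.
  by split => /=; [exact: measurable_indic|exact: (measurable_cst _)].
by exists 1 => x; rewrite absC_ofR ger0_norm// indicE; case: (_ \in _).
Qed.

(** The squared distance is at most the measure of U minus F n, which
    tends to zero by continuity of the measure. *)
Lemma indC_approx (U : set (borel x0)) (F : nat -> set (borel x0))
    (g : nat -> borel x0 -> R) (e : R) : 0 < e ->
  (forall n, measurable (F n)) -> nondecreasing_seq F -> U = \bigcup_n F n ->
  (forall n, L2 m (fun x => ofR (g n x))) ->
  (forall n x, \1_(F n) x <= g n x <= \1_U x) ->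
  exists n, nrm m (fun x => indC U x - ofR (g n x)) < e.
Proof.
move=> e0 mF ndF UE Lg hg.
have mU : measurable U by rewrite UE; exact: bigcupT_measurable.
have mfin A : measurable A -> m A \is a fin_num by move=> mA; exact: fin_num_measure.
have : m (F n) @[n --> \oo] --> (fine (m U))%:E.
  rewrite fineK ?mfin// UE; apply: (@nondecreasing_cvg_mu _ _ _ m F) => //.
  by rewrite -UE.
move=> /fine_cvgP[_ /cvgrPdist_lt/(_ (e ^+ 2))].
rewrite exprn_gt0// => /(_ isT)[N _ /(_ N (leqnn N))] /= h; exists N.
rewrite -(@ltr_pXn2r _ 2)// ?nnegrE ?nrm_ge0 ?ltW// nrm_sq.
have LU := indC_L2 mU.
apply: le_lt_trans h; rewrite (le_trans _ (ler_norm _))//.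
have FU : F N `<=` U by rewrite UE => x Fx; exists N.
have iI A : measurable A -> m.-integrable setT (EFin \o (\1_A : _ -> R)).
  by move=> mA; exact: integrable_indic.
have E A : measurable A -> fine (m A) = Rintegral m setT (\1_A : borel x0 -> R).
  by move=> mA; rewrite /Rintegral integral_indic// setIT.
rewrite !E// -RintegralB ?iI//; apply: le_Rintegral => //.
- by apply: L2_int; exact: L2B.
- by have := integrableB measurableT (iI _ mU) (iI _ (mF N)); apply: eq_integrable.
- move=> x _; rewrite /indC -ofRN -ofRD absC_ofR real_normK ?num_real//.
  have := hg N x; rewrite !indicE.
  have [/set_mem/FU/mem_set ->|_] := boolP (x \in F N) => /=.
    by move=> h; rewrite (_ : g N x = 1) ?subrr ?expr0n//; lra.
  case: (x \in U) => /= h; last by rewrite (_ : g N x = 0) ?subrr ?expr0n//; lra.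
  by rewrite subr0; nra.
Qed.

(** Dynkin argument: the sets whose indicator is a limit of continuous
    functions form a lambda-system containing the open sets. *)
Lemma apx_ind A : measurable A -> apx (indC A).
Proof.
pose H := [set A | measurable A /\ apx (indC A)].
move=> mA; suff : H A by case.
apply: (@lambda_system_subset (borel x0) (@open T) _ setT H) mA.
- by move=> U V oU oV; exact: openI.
- split=> //.
  + split; first exact: measurableT.
    rewrite (_ : indC _ = fun=> 1); first exact: apx_cst.
    by apply/funext => x; rewrite /indC indicE in_setT.
  + move=> B D DB [mB aB] [mD aD]; split; first exact: measurableD.
    rewrite (_ : indC _ = fun x => -1 * indC D x + indC B x); first exact: apx_lin.
    apply/funext => x; rewrite /indC mulN1r -ofRN -ofRD; congr ofR.
    rewrite !indicE in_setD; have [/set_mem/DB/mem_set ->|] := boolP (x \in D) => /=.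
      by rewrite addNr.
    by rewrite andbT oppr0 add0r.
  + move=> F ndF HF; have mU : measurable (\bigcup_i F i : set (borel x0)).
      by apply: bigcupT_measurable => i; case: (HF i).
    split => //; apply: apx_lim; first exact: indC_L2.
    move=> e e0; have [|||||n hn] := @indC_approx (\bigcup_i F i : set (borel x0)) F (fun n => \1_(F n)) e e0.
    * by move=> n; case: (HF n).
    * exact: ndF.
    * by [].
    * by move=> n; apply: indC_L2; case: (HF n).
    * move=> n x; rewrite lexx/= !indicE ler_nat.
      have [/set_mem Fx|//] := boolP (x \in F n).
      by rewrite mem_set//; exists n.
    * by exists (indC (F n)) => //; case: (HF n).
- move=> U oU; have mU : measurable (U : set (borel x0)) by exact: sub_sigma_algebra.
  split => //; apply: apx_lim; first exact: indC_L2.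
  move=> e e0; have [h [ch h01 hS hU hU1]] := oT oU.
  have bh n : bcont (fun x => ofR (h n x)).
    split; first by move=> x; apply: cvg_ofR; exact: ch.
    by exists 1 => x; have /andP[? ?] := h01 n x; rewrite absC_ofR ger0_norm.
  pose F n : set (borel x0) := [set x | 1 <= h n x].
  have [|||||n hn] := @indC_approx U F h e e0.
  + move=> n; rewrite -[F n]setTI.
    have := @continuous_borel_measurable _ _ x0 _ (ch n) measurableT _
      (measurable_itv `[1, +oo[).
    by congr measurable; apply/seteqP; split => x /=; rewrite in_itv /= andbT.
  + apply/nondecreasing_seqP => n; apply/subsetPset => x /= h1.
    exact: le_trans h1 (hS n x).
  + apply/seteqP; split=> [x /hU1[N _ /(_ N (leqnn N)) h1]|x [n _ /= h1]].
      by exists N => //=; rewrite /F /= (h1 : h N x = 1).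
    by apply: contrapT => /(hU n) h0; move: h1; rewrite /F /= h0 ler10.
  + by move=> n; exact: bcont_L2.
  + move=> n x; have /andP[h0 h1] := h01 n x; apply/andP; split.
      by rewrite indicE; have [/set_mem//|_] := boolP (x \in F n).
    rewrite indicE; have [//|/negP nU] := boolP (x \in U).
    by rewrite hU// => Ux; apply: nU; rewrite mem_set.
  + by exists (fun x => ofR (h n x)) => //; exact: apx_bcont.
- by [].
Qed.

(** Approximation by simple functions, with dominated convergence of the
    squared error. *)
Lemma apx_nonneg (u : borel x0 -> R) : (forall x, 0 <= u x) ->
  L2 m (fun x => ofR (u x)) -> apx (fun x => ofR (u x)).
Proof.
move=> u0 Lu; apply: apx_lim => // e e0.
have mu : measurable_fun setT u by case: Lu => -[].
pose B n i : set (borel x0) := [set x | i.+1%:R <= n.+1%:R * u x].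
have mB n i : measurable (B n i).
  rewrite -[B n i]setTI.
  have mNf : measurable_fun setT (fun x => n.+1%:R * u x) by exact: measurable_funM.
  have := mNf measurableT _ (measurable_itv `[i.+1%:R, +oo[).
  by congr measurable; apply/seteqP; split => x /=; rewrite in_itv /= andbT.
pose un n x := n.+1%:R^-1 * \sum_(i < n.+1 * n.+1) \1_(B n i) x : R.
have N0 n : 0 < n.+1%:R :> R by rewrite ltr0n.
have unE n x : un n x = n.+1%:R^-1 * \sum_(i < n.+1 * n.+1) (i.+1%:R <= n.+1%:R * u x)%R%:R.
  congr (_ * _); apply: eq_bigr => i _; rewrite indicE; congr (_%:R); congr nat_of_bool.
  by apply/idP/idP => [/set_mem//|h]; rewrite mem_set.
have unle n x : 0 <= un n x <= u x.
  rewrite unE; have [h _] := @count_le R (n.+1 * n.+1) (n.+1%:R * u x) (mulr_ge0 (ltW (N0 n)) (u0 x)).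
  rewrite mulr_ge0 ?invr_ge0 ?(ltW (N0 n)) ?sumr_ge0//=.
  by rewrite ler_pdivrMl.
have unC n : (fun x => ofR (un n x)) =
    fun x => ofR n.+1%:R^-1 * \sum_(i < n.+1 * n.+1) indC (B n i) x.
  apply/funext => x; rewrite /un ofRM; congr (_ * _).
  by elim/big_ind2 : _ => // a b c d <- <-; rewrite ofRD.
have aun n : apx (fun x => ofR (un n x)).
  by rewrite unC; apply: apxZ; apply: apx_sum => i; exact: apx_ind.
have mun n : measurable_fun setT (un n) by case: (aun n) => -[[]].
have cvg0 : (fun n => \int[m]_x ((u x - un n x) ^+ 2)%:E)%E @ \oo --> 0%E.
  rewrite -(@integral0 _ _ _ m setT).
  have [|||||_ _] := @dominated_convergence _ _ _ m setT measurableT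
    (fun n x => ((u x - un n x) ^+ 2)%:E) (fun=> 0%E) (fun x => (absC (ofR (u x)) ^+ 2)%:E).
  - move=> n; apply/measurable_EFinP; apply: measurable_funX.
    exact: measurable_funB.
  - exact: measurable_cst.
  - apply: aeW => x _; apply: cvg_EFin; first by apply: nearW.
    apply/cvgrPdist_lt => d d0; pose dd := Num.min d 1.
    have dd0 : 0 < dd by rewrite lt_min d0 ltr01.
    have := near_infty_natSinv_lt (PosNum dd0) => -[k1 _ hk1].
    exists (maxn k1 (Num.truncn (u x)).+1) => // n /=.
    rewrite geq_max => /andP[/hk1 /= nd hn].
    rewrite sub0r normrN ger0_norm ?sqr_ge0//.
    have un1 : u x <= n.+1%:R.
      apply: (le_trans (ltW (truncnS_gt _))).
      by rewrite ler_nat (leq_trans hn).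
    have d1 : 0 <= u x - un n x < dd.
      have /andP[_ ul] := unle n x; rewrite subr_ge0 ul/=; apply: lt_trans nd.
      have [_] := @count_le R (n.+1 * n.+1) (n.+1%:R * u x) (mulr_ge0 (ltW (N0 n)) (u0 x)).
      rewrite unE natrM ler_pM2l// => /(_ un1) h.
      rewrite -(ltr_pM2l (N0 n)) mulrBr mulrA divff ?gt_eqF// mul1r; lra.
    have : dd <= d by rewrite ge_min lexx.
    have : dd <= 1 by rewrite ge_min lexx orbT.
    by move: d1 => /andP[? ?]; nra.
  - exact: L2_int Lu.
  - apply: aeW => x n _; rewrite /= lee_fin absC_ofR ger0_norm ?sqr_ge0//.
    rewrite ger0_norm//; have := unle n x; have := u0 x; nra.
  - exact.
have [N _ /(_ N (leqnn N)) hN] : \forall n \near \oo,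
    (\int[m]_x ((u x - un n x) ^+ 2)%:E < (e ^+ 2)%:E)%E.
  have /= := cvg0 [set x : \bar R | (x < (e ^+ 2)%:E)%E]; apply.
  by apply: open_nbhs_nbhs; split; [exact: open_ereal_lt_ereal|rewrite /= lte_fin exprn_gt0].
exists (fun x => ofR (un N x)); first exact: aun.
rewrite -(@ltr_pXn2r _ 2)// ?nnegrE ?nrm_ge0 ?ltW// nrm_sq -lte_fin -EFin_sqnorm; last first.
  by apply: L2B => //; case: (aun N).
apply: le_lt_trans hN; rewrite le_eqVlt; apply/orP; left; apply/eqP.
by apply: eq_integral => x _; rewrite -ofRN -ofRD absC_ofR real_normK ?num_real.
Qed.

Theorem bcont_dense (f : borel x0 -> C) : L2 m f -> apx f.
Proof.
move=> Lf; case: (Lf) => -[mr mi] _.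
have part (u : borel x0 -> R) : measurable_fun setT u ->
    (forall x, `|u x| <= absC (f x)) -> apx (fun x => ofR (u x)).
  move=> mu uf.
  have P (v : borel x0 -> R) : measurable_fun setT v -> (forall x, 0 <= v x) ->
      (forall x, `|v x| <= absC (f x)) -> apx (fun x => ofR (v x)).
    move=> mv v0 vf; apply: apx_nonneg => //; apply: L2_le (L2_int Lf) _.
      by split => //=; exact: (measurable_cst _).
    by move=> x; rewrite absC_ofR lerXn2r ?nnegrE ?absC_ge0.
  have -> : (fun x => ofR (u x)) =
      fun x => -1 * ofR (Num.max (- u x) 0) + ofR (Num.max (u x) 0).
    apply/funext => x; rewrite mulN1r -ofRN -ofRD; congr ofR.
    by rewrite !maxEle; do 2 case: ifPn; lra.
  apply: apx_lin; apply: P.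
  - by apply: measurable_maxr => //; exact: measurable_funN.
  - by move=> x; rewrite le_max lexx orbT.
  - move=> x; apply: le_trans (uf x); rewrite ger0_norm ?le_max ?lexx ?orbT//.
    by rewrite ge_max normr_ge0 andbT -normrN ler_norm.
  - exact: measurable_maxr.
  - by move=> x; rewrite le_max lexx orbT.
  - move=> x; apply: le_trans (uf x); rewrite ger0_norm ?le_max ?lexx ?orbT//.
    by rewrite ge_max normr_ge0 andbT ler_norm.
rewrite (_ : f = fun x => 'i * ofR (imC (f x)) + ofR (reC (f x))).
  apply: apx_lin; apply: part => // x; [exact: ler_imC|exact: ler_reC].
by apply/funext => x; rewrite addrC -Cx_rect.
Qed.

Lemma orth_bcont_ae0 (f : borel x0 -> C) : L2 m f ->
  (forall g, bcont g -> innerL2 m f g = 0) -> {ae m, forall x, f x = 0}.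
Proof.
move=> Lf H; apply: nrm_eq0 => //; apply/eqP; rewrite eq_le nrm_ge0 andbT.
apply/ler_addgt0Pr => e e0; rewrite add0r.
have [_ /(_ e e0)[g bg fg]] := bcont_dense Lf.
have Lg := bcont_L2 bg.
have [->|n0] := eqVneq (nrm m f) 0; first exact: ltW.
have np : 0 < nrm m f by rewrite lt_def n0 nrm_ge0.
rewrite -(ler_pM2l np); have <- : sqnorm m f = nrm m f * nrm m f.
  by rewrite -nrm_sq expr2.
have <- : absC (innerL2 m f (fun x => f x - g x)) = sqnorm m f.
  by rewrite innerL2Br// (H g bg) subr0 innerL2_self// absC_ofR ger0_norm ?sqnorm_ge0.
apply: le_trans (Cauchy_Schwarz Lf (L2B Lf Lg)) _.
by rewrite ler_wpM2l ?nrm_ge0// ltW.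
Qed.

End density.

(** * The vague topology on the hull *)

Section radon_basics.
Context (R : realType) (G : topologicalZmodType).
Local Notation C := (Cx R).
Local Notation Cc := (Cc R G).
Local Notation radon := (radon R G).
Implicit Types (mu w : radon) (phi psi : Cc).

Lemma Cc_continuous phi : continuous phi.
Proof. by case: phi => f /= /Cc_predP[]. Qed.
Lemma Cc_support phi : compact (closure [set x | phi x != 0]).
Proof. by case: phi => f /= /Cc_predP[]. Qed.

Lemma radonD mu phi psi : mu (phi + psi) = mu phi + mu psi.
Proof. by rewrite -[phi]scale1r radon_linear mul1r scale1r. Qed.
Lemma radon0 mu : mu 0 = 0.
Proof. by apply: (@addrI _ (mu 0)); rewrite -radonD !addr0. Qed.
Lemma radonZ mu (a : C) phi : mu (a *: phi) = a * mu phi.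
Proof. by rewrite -[a *: phi]addr0 radon_linear radon0 addr0. Qed.
Lemma radonB mu phi psi : mu (phi - psi) = mu phi - mu psi.
Proof. by rewrite -scaleN1r radonD radonZ mulN1r. Qed.
Lemma radon_sum mu n (f : 'I_n -> Cc) : mu (\sum_(i < n) f i) = \sum_(i < n) mu (f i).
Proof.
elim/big_ind2 : _ => //; first exact: radon0.
by move=> a b c d <- <-; exact: radonD.
Qed.

Lemma Cc_addE phi psi x : (phi + psi) x = phi x + psi x. Proof. by []. Qed.
Lemma Cc_oppE phi x : (- phi) x = - phi x. Proof. by []. Qed.
Lemma Cc_scaleE (a : C) phi x : (a *: phi) x = a * phi x. Proof. by []. Qed.
Lemma Cc_sumE n (f : 'I_n -> Cc) x : (\sum_(i < n) f i) x = \sum_(i < n) f i x.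
Proof. by elim/big_ind2 : _ => // a b c d <- <-. Qed.

Lemma Cc_mul_subproof phi (h : G -> C) : continuous h ->
  (fun x => phi x * h x) \in Cc_pred (G := G).
Proof.
move=> ch; apply/Cc_predP; split.
  by move=> x; apply: cvgM; [exact: Cc_continuous|exact: ch].
rewrite -precompactE.
apply: (@precompact_subset _ _ (closure [set x | phi x != 0])); last first.
  by rewrite precompact_closed; [exact: Cc_support|exact: closed_closure].
move=> x /=; rewrite mulf_eq0 negb_or => /andP[? _]; exact: subset_closure.
Qed.
Definition Cc_mul phi (h : G -> C) (ch : continuous h) : Cc :=
  MkCc (Cc_mul_subproof phi ch).

Lemma Cc_abs_subproof phi : (fun x => ofR (absC (phi x))) \in Cc_pred (G := G).
Proof.
apply/Cc_predP; split.
  by move=> x; apply: cvg_ofR; apply: cvg_absC; exact: Cc_continuous.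
rewrite (_ : [set x | _] = [set x | phi x != 0]); first exact: Cc_support.
apply/seteqP; split => x /=; rewrite -[0]ofR0 (inj_eq (@ofR_inj R)) absC_eq0//.
Qed.
Definition Cc_abs phi : Cc := MkCc (Cc_abs_subproof phi).

Lemma cvg_radon (T : Type) (F : set_system T) (FF : Filter F) (f : T -> radon) w :
  (forall phi, f t phi @[t --> F] --> w phi) -> f @ F --> w.
Proof.
move=> H; have h : radon_eval (f t) @[t --> F] --> radon_eval w.
  have FF' : Filter (radon_eval (f t) @[t --> F]) by apply: fmap_filter.
  apply: (snd (@cvg_sup (Cc -> C) Cc _ (radon_eval (f t) @[t --> F]) (radon_eval w) FF')).
  move=> phi W [_ [[V oV <-] Vf VW]].
  apply: (@filterS _ F _ _ _ _ (H phi V (open_nbhs_nbhs _))) => //.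
  by move=> t Vt; apply: VW.
by move=> U [_ [[V oV <-] Vw VU]]; apply: filterS VU _; apply: h;
  exact: open_nbhs_nbhs.
Qed.

Lemma radon_ev_continuous phi : continuous (fun w : radon => w phi).
Proof.
move=> w; apply: (@continuous_comp radon {ptws Cc -> C} C (@radon_eval R G)
  (fun f => f phi)).
  exact: (@initial_continuous radon {ptws Cc -> C} (@radon_eval R G)).
exact: (@proj_continuous Cc (fun=> C) phi (radon_eval w)).
Qed.

Variable mu : radon.
Local Notation X := (hull mu).

(** The hull carries the topology of pointwise convergence on test functions. *)
Lemma cvg_hull (T : Type) (F : set_system T) (FF : Filter F) (f : T -> X) (w : X) :
  (forall phi, val (f t) phi @[t --> F] --> val w phi) -> f @ F --> w.
Proof.
move=> H; have h : val (f t) @[t --> F] --> val w by exact: cvg_radon.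
move=> U [_ [[V oV <-] Vw VU]].
apply: (@filterS _ F FF (fun t => V (val (f t)))); first by move=> t Vt; exact: VU.
by apply: h; apply: open_nbhs_nbhs; split.
Qed.

Lemma hull_ev_continuous phi : continuous (fun w : X => val w phi).
Proof.
move=> w; apply: (@continuous_comp X radon C val (fun w => w phi)).
  exact: (@initial_continuous X radon set_val).
exact: radon_ev_continuous.
Qed.

Lemma hull_shift_continuous (t : G) : continuous (hull_shift (mu := mu) t).
Proof.
by move=> w; apply: (@cvg_hull _ (nbhs w) (nbhs_filter w)) => phi;
  have := @hull_ev_continuous (Cc_shift t phi) w.
Qed.

Lemma hull_ext (w w' : X) : (forall phi, val w phi = val w' phi) -> w = w'.
Proof. by move=> H; apply: val_inj; apply: radon_ext; apply/funext. Qed.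

Lemma hull_shiftD s t (w : X) : hull_shift s (hull_shift t w) = hull_shift (s + t) w.
Proof. by apply: val_inj; exact: radon_shiftD. Qed.
Lemma hull_shift0 (w : X) : hull_shift 0 w = w.
Proof. by apply: val_inj; exact: radon_shift0. Qed.
Lemma hull_shiftK t : cancel (hull_shift (mu := mu) t) (hull_shift (- t)).
Proof. by move=> w; rewrite hull_shiftD addNr hull_shift0. Qed.
Lemma hull_shiftNK t : cancel (hull_shift (mu := mu) (- t)) (hull_shift t).
Proof. by move=> w; rewrite hull_shiftD addrN hull_shift0. Qed.

(** The sign is that of the Wiener-Wintner averages; it also makes the
    convolution with a test function an evaluation along the orbit. *)
Definition orbit_pt (t : G) : X := hull_shift (- t) (hull_base mu).

(** This identity transfers almost periodicity between the convolutions of mu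
    and the continuous functions on the hull. *)
Lemma conv_orbit phi t : Defs.conv mu phi t = val (orbit_pt t) (Cc_refl 0 phi).
Proof.
rewrite /Defs.conv /=; congr (mu _); apply: val_inj; apply/funext => x /=.
by congr (phi _); rewrite add0r opprD opprK.
Qed.

(** A closed condition passes from the orbit to its closure. *)
Lemma hull_closed_ind (P : radon -> Prop) :
  (forall t, P (radon_shift t mu)) -> closed P -> forall w : X, P (val w).
Proof.
move=> Pt cP w; have hw : hull mu (val w) by exact: set_valP.
apply: cP; move: hw; apply: closureS => _ [t _ <-]; exact: Pt.
Qed.

End radon_basics.

(** * Compactness of the hull and continuity of the orbit *)

(** A closed subset of the continuous image of a square. *)
Lemma discC_compact (R : realType) (c : R) : compact [set z : Cx R | absC z <= c].
Proof.
pose S : set (R * R) := `[- c, c]%classic `*` `[- c, c]%classic.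
have cS : compact S by apply: compact_setX; exact: segment_compact.
pose h (p : R * R) : Cx R := ofR p.1 + 'i * ofR p.2.
have ch : continuous h.
  move=> p; apply: cvgD; first by apply: cvg_ofR; exact: cvg_fst.
  by apply: cvgM; [exact: cvg_cst|apply: cvg_ofR; exact: cvg_snd].
have chS : compact (h @` S).
  by apply: continuous_compact => //; exact: continuous_subspaceT.
apply: subclosed_compact chS _.
  rewrite (_ : mkset _ = (@absC R) @^-1` [set y | y <= c]) //.
  by apply: closed_comp; [move=> z _; exact: absC_continuous|exact: closed_le].
move=> z /= zc; exists (reC z, imC z); last by rewrite /h /= -Cx_rect.
split; rewrite /= in_itv /= -ler_norml.
  exact: le_trans (ler_reC z) zc.
exact: le_trans (ler_imC z) zc.
Qed.

Lemma ultra_fmap (T U : Type) (f : T -> U) (F : set_system T) :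
  UltraFilter F -> UltraFilter (fmap f F).
Proof.
move=> UF; split; first exact: fmap_proper_filter.
move=> H PH FH; rewrite predeqE => A; split=> [HA|]; last exact: FH.
have [//|FnA] := in_ultra_setVsetC (f @^-1` A) UF.
have /FH HnA : fmap f F (~` A) by [].
by have /filter_ex[x []] : H (A `&` ~` A) by exact: filterI.
Qed.

Section hull_compactness.
Context (R : realType) (G : topologicalZmodType).
Local Notation C := (Cx R).
Local Notation Cc := (Cc R G).
Local Notation radon := (radon R G).
Hypothesis hG : hausdorff_space G.
Hypothesis lcG : locally_compact [set: G].
Variable mu : radon.
Hypothesis tb : translation_bounded mu.
Local Notation X := (hull mu).

(** Translation boundedness, freed of total variations: mu is bounded
    uniformly on the test functions dominated by the indicator of a translate
    of one fixed open set V. *)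
Lemma translation_bound : exists (V : set G) (c : R), [/\ open V, V !=set0, 0 <= c &
  forall (t : G) (psi : Cc), (forall x, absC (psi x) <= \1_[set (t + v)%R | v in V] x) ->
    absC (mu psi) <= c].
Proof.
have [V [oV V0 _ hV]] := tb.
move: hV; set s := ereal_sup _ => sV.
have up (t : G) (psi : Cc) : (forall x, absC (psi x) <= \1_[set (t + v)%R | v in V] x) ->
    ((absC (mu psi))%:E <= s)%E.
  move=> h; apply: (@le_trans _ _ (tvar mu (Cc_abs psi))).
    by apply: ereal_sup_ubound; exists psi => // x; rewrite normr_absC.
  apply: (@le_trans _ _ (tvar_open mu [set (t + v)%R | v in V])).
    apply: ereal_sup_ubound; exists (Cc_abs psi) => // x /=.
    have -> : \1_[set (t + v)%R | v in V] x = ofR (\1_[set (t + v)%R | v in V] x) :> C.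
      by rewrite !indicE; case: (x \in _).
    by apply/andP; split; [rewrite lecR absC_ge0|rewrite ler_ofR].
  by apply: ereal_sup_ubound; exists t.
have s0 : (0 <= s)%E.
  apply: le_trans (up 0 0 _); last by move=> x; rewrite absC0 indicE; case: (_ \in _).
  by rewrite lee_fin absC_ge0.
have sf : s \is a fin_num by rewrite ge0_fin_numE.
exists V, (fine s); split=> //; first exact: fine_ge0.
by move=> t psi /up; rewrite -lee_fin fineK.
Qed.

(** A continuous bump eta supported in V is available by complete regularity.
    Finitely many translates of eta cover K, and dividing by their sum, which
    is at least one half on K, gives a partition of unity; each piece of a test
    function supported in K then falls under the bound on a translate of V. *)
Lemma uniform_bound (K : set G) : compact K -> exists2 c : R, 0 <= c &
  forall (t : G) (phi : Cc) (M : R), (forall x, ~ K x -> phi x = 0) ->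
    (forall x, absC (phi x) <= M) -> absC (radon_shift t mu phi) <= c * M.
Proof.
move=> cK; have [V [c0 [oV [v0 Vv0] c00 hc0]]] := translation_bound.
have crs : completely_regular_space G.
  exact: (@locally_compact_completely_regular G R lcG hG).
have [eta [ceta eta01 etaV etav0]] : exists eta : G -> R, [/\ continuous eta,
    forall x, 0 <= eta x <= 1, forall x, ~ V x -> eta x = 0 & eta v0 = 1].
  have /(@uniform_separatorP _ R)[f [cf f01 fv0 fV]] := crs v0 (~` V) (open_closedC oV)
    (fun h => h Vv0).
  exists (fun x => 1 - f x); split=> [x|x|x nVx|].
  - by apply: cvgB; [exact: cvg_cst|exact: cf].
  - have /f01 : range f (f x) by exists x.
    by rewrite /= in_itv /= => /andP[? ?]; apply/andP; split; lra.
  - by rewrite (fV (f x)) ?subrr//; exists x.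
  - by rewrite (fv0 (f v0)) ?subr0//; exists v0.
have csub (s : G) : continuous (fun x => eta (x - s)).
  move=> x; apply: (@continuous_comp _ _ _ (fun y : G => y - s) eta); last exact: ceta.
  by have := @addl_continuous G (- s) x; under eq_fun do rewrite addrC.
have [n [s sP]] : exists n (s : 'I_n -> G), forall x, K x -> exists i, 2^-1 < eta (x - s i).
  (* translates by k - v0 put the top of the bump at k *)
  have [|s0 hs0] := @compact_finite_nbhs G K (fun k => [set x | 2^-1 < eta (x - (k - v0))]) cK.
    move=> k Kk; rewrite -[X in nbhs _ X]/((fun x => eta (x - (k - v0))) @^-1` [set y | 2^-1 < y]).
    apply: open_nbhs_nbhs; split; last by rewrite /= opprB addrCA subrr addr0 etav0; lra.
    by apply: open_comp; [move=> x _; exact: csub|exact: open_gt].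
  exists (size s0), (fun i => nth 0 s0 i - v0) => x /hs0[k kD hk].
  have ik : (index k s0 < size s0)%N by rewrite index_mem.
  by exists (Ordinal ik); rewrite /= nth_index.
exists (n%:R * c0); first by rewrite mulr_ge0.
move=> t phi M phiK phiM.
have M0 : 0 <= M by apply: le_trans (phiM 0); exact: absC_ge0.
have [M00|Mn0] := eqVneq M 0.
  have -> : phi = 0.
    apply: val_inj; apply/funext => x /=; apply/eqP; rewrite -absC_eq0 eq_le absC_ge0 andbT.
    by rewrite -M00.
  by rewrite radon0 absC0 M00 mulr0.
have Mp : 0 < M by rewrite lt_def Mn0.
pose sg x := \sum_(i < n) eta (x - s i).
have csg : continuous sg.
  move=> x; rewrite /sg; apply: cvg_big; last by move=> i _; exact: csub.
  exact: add_continuous.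
(* the sum exceeds 1/2 on K; truncating it from below keeps the quotients continuous *)
pose mx x := Num.max (sg x) 2^-1.
have mx0 x : 0 < mx x by rewrite lt_max invr_gt0 ltr0n orbT.
pose w i x := eta (x - s i) / mx x.
have cw i : continuous (fun x => ofR (w i x)).
  move=> x; apply: cvg_ofR; apply: cvgM; first exact: csub.
  apply: cvgV; first by rewrite gt_eqF.
  apply: (@continuous_max R G sg (fun=> 2^-1)); first exact: csg.
  exact: cvg_cst.
pose ph i := Cc_mul phi (@cw i).
have phE : phi = \sum_(i < n) ph i.
  apply: val_inj; apply/funext => x; rewrite /= Cc_sumE.
  rewrite (eq_bigr (fun i => phi x * ofR (w i x)))// -mulr_sumr.
  have [Kx|nKx] := pselect (K x); last by rewrite phiK// mul0r.
  have -> : \sum_(i < n) ofR (w i x) = ofR (sg x / mx x).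
    rewrite /sg mulr_suml; apply: esym.
    by elim/big_ind2 : _ => // a b c d <- <-; rewrite ofRD.
  rewrite (_ : mx x = sg x); last first.
    apply/max_idPl; have [i /ltW hi] := sP x Kx; apply: le_trans hi _.
    rewrite /sg (bigD1 i)//= lerDl sumr_ge0// => j _.
    by have /andP[] := eta01 (x - s j).
  rewrite divff ?mulr1// gt_eqF//; have [i hi] := sP x Kx.
  have hs : eta (x - s i) <= sg x.
    rewrite /sg (bigD1 i)//= lerDl sumr_ge0// => j _.
    by have /andP[] := eta01 (x - s j).
  by apply: lt_le_trans hs; apply: lt_trans hi; rewrite invr_gt0.
have w01 i x : 0 <= w i x <= 1.
  have /andP[e0 e1] := eta01 (x - s i); rewrite divr_ge0 ?(ltW (mx0 _))//=.
  rewrite ler_pdivrMr// mul1r le_max; apply/orP; left.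
  rewrite /sg (bigD1 i)//= lerDl sumr_ge0// => j _.
  by have /andP[] := eta01 (x - s j).
rewrite phE radon_sum (le_trans (absC_sum _))//.
apply: (@le_trans _ _ (\sum_(i < n) c0 * M)); last first.
  by rewrite sumr_const card_ord -mulrA mulr_natl.
apply: ler_sum => i _; rewrite -ler_pdivrMr//.
have -> : absC (radon_shift t mu (ph i)) / M = absC (mu (ofR M^-1 *: Cc_shift t (ph i))).
  by rewrite radonZ absCM absC_ofR ger0_norm ?invr_ge0// mulrC.
(* the i-th piece, moved by - t, lives in the translate of V by - t + s i *)
apply: (hc0 (- t + s i)) => x; rewrite Cc_scaleE /= absCM absC_ofR ger0_norm ?invr_ge0//.
rewrite absCM absC_ofR ger0_norm; last by have /andP[] := w01 i (t + x).
rewrite indicE; have [_|/negP nx] := boolP (x \in _).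
  rewrite ler_pdivrMl// mulr1; apply: le_trans (phiM (t + x)).
  by rewrite ler_piMr ?absC_ge0//; have /andP[] := w01 i (t + x).
rewrite /w etaV ?mul0r ?mulr0// => Vx; apply: nx; rewrite mem_set//.
by exists (t + x - s i) => //; rewrite addrACA addKr subrr addr0.
Qed.

Lemma hull_bound (K : set G) : compact K -> exists2 c : R, 0 <= c &
  forall (w : X) (phi : Cc) (M : R), (forall x, ~ K x -> phi x = 0) ->
    (forall x, absC (phi x) <= M) -> absC (val w phi) <= c * M.
Proof.
move=> /uniform_bound[c c0 hc]; exists c => // w phi M phiK phiM.
apply: (@hull_closed_ind R G mu (fun w => absC (w phi) <= c * M)).
  by move=> t; exact: hc.
rewrite -[X in closed X]/((fun w : radon => absC (w phi)) @^-1` [set y | y <= c * M]).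
apply: closed_comp; last exact: closed_le.
by move=> w' _; apply: (@cvg_absC R radon (nbhs w') (nbhs_filter w') _ _ (@radon_ev_continuous R G phi w')).
Qed.

Lemma Cc_bounded (phi : Cc) : exists2 M, 0 <= M & forall x, absC (phi x) <= M.
Proof.
have cS := @Cc_support R G phi; set S := closure _ in cS.
have : compact ((fun x => absC (phi x)) @` S).
  apply: continuous_compact => //; apply: continuous_subspaceT => x.
  by apply: cvg_absC; exact: Cc_continuous.
move=> /compact_bounded[M [_ hM]]; exists (`|M| + 1); first by rewrite addr_ge0.
move=> x; have [Sx|nSx] := pselect (S x).
  apply: le_trans (ler_norm _) _; apply: (hM (`|M| + 1)); last by exists x.
  by rewrite (le_lt_trans (ler_norm _))// ltrDl.
have -> : phi x = 0.
  by apply: contrapT => /eqP px; apply: nSx; apply: subset_closure.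
by rewrite absC0 addr_ge0.
Qed.

Lemma hull_ev_bounded (phi : Cc) : exists c : R, forall w : X, absC (val w phi) <= c.
Proof.
have [M M0 hM] := Cc_bounded phi; have [c c0 hc] := hull_bound (@Cc_support R G phi).
exists (c * M) => w; apply: hc => // x nSx.
by apply: contrapT => /eqP px; apply: nSx; apply: subset_closure.
Qed.

(** Tychonoff argument. The values of the elements of the hull at a fixed
    test function stay in a disc, so that along an ultrafilter they converge;
    the limits form a linear functional with the same bounds, hence a Radon
    measure, which lies in the closed hull. *)
Lemma hull_compact : compact [set: X].
Proof.
rewrite compact_ultra => U UU _.
have ev (phi : Cc) : exists z : C, (fun w : X => val w phi) @ U --> z.
  have [c hc] := hull_ev_bounded phi; have := @discC_compact R c.
  rewrite compact_ultra => /(_ ((fun w : X => val w phi) @ U)).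
  have h1 : UltraFilter ((fun w : X => val w phi) @ U) by exact: ultra_fmap.
  have h2 : ((fun w : X => val w phi) @ U) [set z | absC z <= c].
    by apply: (@filterS _ U _ setT) => [w _|]; [exact: hc|exact: filterT].
  by move=> /(_ h1 h2)[z [_ Uz]]; exists z.
have /choice[l lP] := ev.
have llin (a : C) (phi psi : Cc) : l (a *: phi + psi) = a * l phi + l psi.
  have h : (fun w : X => val w (a *: phi + psi)) @ U --> a * l phi + l psi.
    under eq_fun do rewrite radon_linear.
    by apply: cvgD => //; apply: cvgM => //; exact: cvg_cst.
  exact: (cvg_unique _ (lP (a *: phi + psi)) h).
have lbd (K : set G) : compact K -> exists c : R, forall (phi : Cc) (M : R),
    (forall x, ~ K x -> phi x = 0) -> (forall x, absC (phi x) <= M) ->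
    absC (l phi) <= c * M.
  move=> /hull_bound[c _ hc]; exists c => phi M phiK phiM.
  have FU : Filter U by apply: filter_filter.
  have h := @cvg_absC R X U FU _ _ (lP phi).
  have hA : closed [set y : R | y <= c * M] by exact: closed_le.
  have hn : \near U, (fun w : X => absC (val w phi) <= c * M) U.
    by apply: (@filterS _ U _ setT) => [w _|]; [exact: hc|exact: filterT].
  exact: (closed_cvg _ hA hn _ h).
pose w0 : radon := Radon llin lbd.
have cw : (fun w : X => val w) @ U --> w0 by apply: cvg_radon.
have hw0 : hull mu w0.
  apply: (closed_cvg (hull mu) _ _ _ cw); first exact: closed_closure.
  by apply: (@filterS _ U _ setT) => [w _|]; [exact: set_valP|exact: filterT].
exists (exist _ w0 (mem_set hw0)); split => //.
by apply: cvg_hull => phi; exact: lP.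
Qed.

(** For t near t0 the shifted test functions have their supports in one compact
    set K and are uniformly close; the bound of mu on K concludes. *)
Lemma orbit_continuous : continuous (@orbit_pt R G mu).
Proof.
move=> t0; apply: (@cvg_hull _ _ _ _ (nbhs t0) (nbhs_filter t0)) => phi.
apply/cvgC_abs => e e0.
have [W nW [cW _]] := lcG (I : setT t0).
have {}nW : nbhs t0 W by move: nW; rewrite withinET.
pose S := closure [set x | phi x != 0].
pose K := (fun p : G * G => p.1 + p.2) @` (W `*` S).
have cK : compact K.
  apply: continuous_compact; last by apply: compact_setX => //; exact: (@Cc_support R G phi).
  by apply: continuous_subspaceT; exact: add_continuous.
have [c c0 hc] := uniform_bound cK.
have c1 : 0 < c + 1 by rewrite ltr_wpDl.
pose dl := e / (c + 1); have dl0 : 0 < dl by rewrite divr_gt0.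
have near1 : \forall t \near t0, K `<=`
    [set x | absC (phi (- t + x) - phi (- t0 + x)) < dl].
  have /compact_near_coveringP/(_ G (nbhs t0)
    (fun t x => absC (phi (- t + x) - phi (- t0 + x)) < dl)) := cK.
  apply => x _; have jc : continuous (fun p : G * G => phi (- p.2 + p.1)).
    move=> p; apply: (@continuous_comp _ _ _ (fun p : G * G => - p.2 + p.1) phi);
      last exact: Cc_continuous.
    apply: (@cvg_comp _ _ _ (fun p : G * G => (- p.2, p.1)) (fun q => q.1 + q.2)
      _ (nbhs (- p.2, p.1))); last exact: (@add_continuous G (- p.2, p.1)).
    apply: cvg_pair; last exact: cvg_fst.
    by apply: (@cvg_comp _ _ _ snd (@GRing.opp G) _ (nbhs p.2));
      [exact: cvg_snd|exact: opp_continuous].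
  have jc0 : continuous (fun p : G * G => phi (- t0 + p.1)).
    move=> p; apply: (@continuous_comp _ _ _ fst (fun x => phi (- t0 + x))).
      exact: cvg_fst.
    apply: (@continuous_comp _ _ _ (fun x => - t0 + x) phi); last exact: Cc_continuous.
    exact: addl_continuous.
  have hB : (fun p : G * G => phi (- p.2 + p.1) - phi (- t0 + p.1))
      @ nbhs (x, t0) --> (0 : C).
    by rewrite -[0](subrr (phi (- t0 + x))); apply: cvgB;
      [exact: (jc (x, t0))|exact: (jc0 (x, t0))].
  have /(_ _ dl0) := (@cvgC_abs R _ _ (nbhs_filter (x, t0)) _ _).1 hB.
  by apply: filterS => -[y t] /=; rewrite subr0.
have Wt0 : W t0 by exact: nbhs_singleton nW.
apply: filterS2 nW near1 => t Wt ht.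
have -> : val (orbit_pt mu t) phi - val (orbit_pt mu t0) phi =
    radon_shift 0 mu (Cc_shift (- t) phi - Cc_shift (- t0) phi).
  by rewrite radon_shift0 radonB.
have supp s x : W s -> ~ K x -> phi (- s + x) = 0.
  move=> Ws nKx; apply: contrapT => /eqP px; apply: nKx.
  exists (s, - s + x); last by rewrite /= addNKr.
  by split => //=; exact: subset_closure.
have h : absC (radon_shift 0 mu (Cc_shift (- t) phi - Cc_shift (- t0) phi)) <= c * dl.
  apply: hc => x; first by move=> nKx; rewrite Cc_addE Cc_oppE /= !supp// subrr.
  rewrite Cc_addE Cc_oppE /=; have [Kx|nKx] := pselect (K x); first exact/ltW/ht.
  by rewrite !supp// subrr absC0 ltW.
apply: le_lt_trans h _.
have -> : e = (c + 1) * dl by rewrite /dl mulrCA divff ?mulr1// gt_eqF.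
by rewrite ltr_pM2r// ltrDl.
Qed.

End hull_compactness.

(** * Averages along a van Hove sequence *)

Section normalized_restriction.
Context d (T : measurableType d) (R : realType).
Variables (th : {measure set T -> \bar R}) (A : set T).
Hypotheses (mA : measurable A) (A0 : (0 < th A)%E) (Afin : (th A < +oo)%E).

Lemma thA_gt0 : 0 < fine (th A).
Proof. by rewrite fine_gt0// A0. Qed.

(** Averaging over A is integration against this probability measure, so that
    the Hilbert space inequalities apply to averages. *)
Definition nrestr := mscale (NngNum (ltW (etrans (invr_gt0 _) thA_gt0)))
  (mrestr th mA).

Let nrestrE (B : set T) : nrestr B = ((fine (th A))^-1%:E * th (B `&` A))%E.
Proof. by []. Qed.

HB.instance Definition _ := Measure.on nrestr.

Let nrestrT : nrestr setT = 1%E.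
Proof.
rewrite nrestrE setTI -[X in (_ * X)%E]fineK; last by rewrite ge0_fin_numE.
by rewrite -EFinM mulVf// gt_eqF// thA_gt0.
Qed.

HB.instance Definition _ := Measure_isProbability.Build _ _ _ nrestr nrestrT.

Lemma ge0_integral_nrestr (f : T -> \bar R) : measurable_fun setT f ->
  (forall x, (0 <= f x)%E) ->
  (\int[nrestr]_x f x = (fine (th A))^-1%:E * \int[th]_(x in A) f x)%E.
Proof.
move=> mf f0; rewrite (ge0_integral_mscale _ _ _ mf)//=; congr (_ * _)%E.
rewrite -{1}(setUv A) ge0_integral_setU//; last 3 first.
- exact: measurableC.
- by rewrite setUv.
- by apply/disj_setPS => x [].
rewrite [X in (_ + X)%E]null_set_integral//; last 3 first.
- exact: measurableC.
- exact: measurable_funTS.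
- by rewrite /= /mrestr setICl measure0.
by rewrite adde0; apply: eq_measure_integral => B mB BA; rewrite /= /mrestr setIidl.
Qed.

Let Ri_cst (M : R) : Rintegral th A (fun=> M) = M * fine (th A).
Proof. by rewrite Rintegral_cst. Qed.

Lemma bounded_integrable_restr (u : T -> R) (B : set T) M : measurable B ->
  (th B < +oo)%E -> measurable_fun setT u ->
  (forall x, `|u x| <= M) -> th.-integrable B (EFin \o u).
Proof.
move=> mB fB mu uM; apply: measurable_bounded_integrable => //.
  exact: measurable_funTS.
exists M; split; first exact: num_real.
by move=> y My x _; exact: le_trans (uM x) (ltW My).
Qed.

(** The formula is additive in u and holds for nonnegative functions; the
    bounded function u is made nonnegative by adding M. *)
Lemma Rintegral_nrestr (u : T -> R) M : measurable_fun setT u ->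
  (forall x, `|u x| <= M) ->
  Rintegral nrestr setT u = (fine (th A))^-1 * Rintegral th A u.
Proof.
move=> mu uM; have a0 := thA_gt0.
have pos x : 0 <= u x + M by have := uM x; rewrite ler_norml => /andP[? _]; lra.
have muM : measurable_fun setT (fun x => u x + M) by exact: measurable_funD.
have iu : nrestr.-integrable setT (EFin \o u).
  have nT : (nrestr setT < +oo)%E by rewrite nrestrT ltry.
  apply: measurable_bounded_integrable => //.
  exists M; split; first exact: num_real.
  by move=> y My x _; exact: le_trans (uM x) (ltW My).
have iM : nrestr.-integrable setT (EFin \o (fun=> M)).
  exact: finite_measure_integrable_cst.
have itu := bounded_integrable_restr mA Afin mu uM.
have itM : th.-integrable A (EFin \o (fun=> M)).
  apply: (@bounded_integrable_restr (fun=> M) A `|M|) => //.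
have h : Rintegral nrestr setT (fun x => u x + M) =
    (fine (th A))^-1 * Rintegral th A (fun x => u x + M).
  rewrite /Rintegral ge0_integral_nrestr//; last by apply/measurable_EFinP.
  rewrite fineM//; have := integrableD mA itu itM => /(integrable_fin_num mA).
  by under eq_integral do rewrite /= -EFinD.
move: h; rewrite !RintegralD// mulrDr Ri_cst [X in _ = _ + X]mulrCA mulVf ?gt_eqF// mulr1.
have -> : Rintegral nrestr setT (fun=> M) = M.
  rewrite Rintegral_cst//; transitivity (M * fine (1%:E : \bar R)); last by rewrite mulr1.
  by congr (_ * fine _); exact: nrestrT.
by move=> /addIr.
Qed.

Lemma integralC_nrestr (f : T -> Cx R) : bmfun f ->
  integralC nrestr setT f = ofR (fine (th A))^-1 * integralC th A f.
Proof.
move=> [[mr mi] [M fM]]; rewrite /integralC.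
rewrite (@Rintegral_nrestr _ M)// => [|x]; last exact: le_trans (ler_reC _) (fM x).
rewrite (@Rintegral_nrestr _ M)// => [|x]; last exact: le_trans (ler_imC _) (fM x).
by rewrite !ofRM mulrDr mulrCA.
Qed.

End normalized_restriction.

Section haar_averages.
Context (R : realType) (G : topologicalZmodType).
Local Notation C := (Cx R).
Local Notation GB := (borel (0 : G)).
Variables (theta : {measure set GB -> \bar R}) (A : nat -> set G).
Hypothesis hG : hausdorff_space G.
Hypothesis haar : is_haar theta.
Hypothesis vh : van_hove theta A.

Lemma open_borel (U : set G) : open U -> measurable (U : set GB).
Proof. exact: sub_sigma_algebra. Qed.
Lemma closed_borel (U : set G) : closed U -> measurable (U : set GB).
Proof.
move=> cU; rewrite -[U]setCK; apply: (@measurableC _ GB).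
by apply: open_borel; exact: closed_openC.
Qed.

Lemma borel_A n : measurable (A n : set GB).
Proof. by apply: open_borel; case: vh. Qed.
Lemma A_gt0 n : (0 < theta (A n))%E.
Proof. by case: vh. Qed.
Lemma A_fin n : (theta (A n) < +oo)%E.
Proof.
case: vh => _ cA _ _; case: haar => _ hc _ _ _; apply: le_lt_trans (hc _ (cA n)).
apply: le_measure; rewrite ?inE; [exact: borel_A| |exact: subset_closure].
by apply: closed_borel; exact: closed_closure.
Qed.

Definition avg n : probability GB R :=
  nrestr (borel_A n) (A_gt0 n) (A_fin n).

Lemma translate_measurable (s : G) (B : set GB) : measurable B ->
  measurable ((fun x : GB => (x : G) + s) @^-1` B : set GB).
Proof.
move=> mB; have mf : measurable_fun setT ((fun x : G => x + s) : GB -> GB).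
  apply: (@measurability _ _ GB GB setT _ (@open G : set (set GB)) erefl) => _ [U oU <-]; rewrite setTI.
  apply: open_borel; apply: open_comp => // x _.
  by have := @addl_continuous G s x; under eq_fun do rewrite addrC.
by have := mf measurableT B mB; rewrite setTI.
Qed.

Lemma theta_translate (s : G) (B : set GB) : measurable B ->
  theta ((fun x : GB => (x : G) + s) @^-1` B : set GB) = theta B.
Proof.
move=> mB; case: haar => _ _ _ _ /(_ (- s) B mB) <-; congr (theta _).
apply/seteqP; split => [x /= Bx|_ [y By <-] /=].
  by exists (x + s) => //; rewrite addrC addrK.
by rewrite addrAC addNr add0r.
Qed.

Lemma ge0_integral_translate (s : G) (f : GB -> \bar R) (B : set GB) : measurable B ->
  measurable_fun setT f -> (forall x, (0 <= f x)%E) ->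
  (\int[theta]_(x in B) f x =
   \int[theta]_(x in (fun x : GB => (x : G) + s)%R @^-1` B) f ((x : G) + s)%R)%E.
Proof.
move=> mB mf f0; have mh : measurable_fun setT ((fun x : G => x + s) : GB -> GB).
  by move=> _ D mD; rewrite setTI; exact: translate_measurable.
rewrite -(@ge0_integral_pushforward _ _ GB GB R _ mh theta B f mB) //.
- by apply: eq_measure_integral => D mD _; apply: esym; exact: theta_translate.
- exact: measurable_funTS.
Qed.

(** The reason why van Hove sequences give asymptotically translation-invariant
    means. *)
Lemma boundary_symdiff n (s : G) :
  let sA := (fun x => x + s) @^-1` A n in
  (sA `\` A n) `|` (A n `\` sA) `<=` vh_boundary [set s; - s] (A n).
Proof.
move=> /= x [[/= Axs nAx]|[/= Ax nAxs]].
  left; split; last by apply: subset_closure.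
  apply: subset_closure; exists (x + s) => //; exists (- s); first by right.
  by rewrite addrK.
right; split; last by apply: subset_closure.
apply: subset_closure; exists (x + s) => //; exists s; first by left.
by rewrite addrK.
Qed.

Lemma boundary_fin n (s : G) :
  (theta (vh_boundary [set s; (- s)%R] (A n) : set GB) < +oo)%E.
Proof.
case: vh => oA cA _ _; case: haar => _ hc _ _ _.
pose K := ((fun x => s + x) @` closure (A n) `|` (fun x => - s + x) @` closure (A n))
  `|` closure (A n).
have cK : compact K.
  apply: compactU; last exact: cA.
  by apply: compactU; apply: continuous_compact (cA n); apply: continuous_subspaceT;
    exact: addl_continuous.
apply: le_lt_trans (hc _ cK); apply: le_measure; rewrite ?inE.
- apply: measurableU; apply: closed_borel; apply: closedI; exact: closed_closure.
- by apply: closed_borel; exact: compact_closed.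
- move=> x [[cx _]|[_ cx]]; last by right.
  have clK : closed K by exact: compact_closed.
  apply: clK; move: cx; apply: closureS => _ [a Aa [k [->|->] <-]]; left.
    by left; exists a; [exact: subset_closure|rewrite addrC].
  by right; exists a; [exact: subset_closure|rewrite addrC].
Qed.

(** After translating the domain instead of the function, the two integrals
    differ only over the symmetric difference of the domains. *)
Lemma Rintegral_translate_diff n (s : G) (u : GB -> R) M : measurable_fun setT u ->
  (forall x, 0 <= u x <= M) ->
  `|Rintegral theta (A n) (fun x : GB => u ((x : G) + s)) - Rintegral theta (A n) u|
    <= M * fine (theta (vh_boundary [set s; (- s)%R] (A n) : set GB)).
Proof.
move=> mu u0M; pose sA : set GB := (fun x => x - s) @^-1` A n.
have msA : measurable sA by apply: (@translate_measurable (- s)); exact: borel_A.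
have mAn := borel_A n.
have uM x : `|u x| <= M by have /andP[? ?] := u0M x; rewrite ger0_norm.
have fsA : (theta sA < +oo)%E by rewrite theta_translate ?A_fin.
have mE : measurable_fun setT (EFin \o u) by exact/measurable_EFinP.
have -> : Rintegral theta (A n) (fun x : GB => u ((x : G) + s)) = Rintegral theta sA u.
  rewrite /Rintegral (@ge0_integral_translate s (EFin \o u) sA)//; last first.
    by move=> x; rewrite lee_fin; have /andP[] := u0M x.
  by congr (fine (integral _ _ _)); apply/seteqP; split => x /=; rewrite /sA /= addrK.
set BD := vh_boundary _ _.
have mBD : measurable (BD : set GB).
  apply: measurableU; apply: closed_borel; apply: closedI; exact: closed_closure.
have fBD : (theta BD < +oo)%E by exact: boundary_fin.
have sub : (sA `\` A n) `|` (A n `\` sA) `<=` BD.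
  have := @boundary_symdiff n (- s); rewrite opprK [X in vh_boundary X]setUC; exact.
(* the two integrals share their part over the intersection *)
have split1 (P Q : set GB) : measurable P -> measurable Q -> (theta P < +oo)%E ->
    Rintegral theta P u = Rintegral theta (P `&` Q) u + Rintegral theta (P `\` Q) u.
  move=> mP mQ fP; rewrite -[in LHS](setUIDK P Q) Rintegral_setU//.
  - exact: measurableI.
  - exact: measurableD.
  - by rewrite setUIDK; exact: (bounded_integrable_restr mP fP mu uM).
  - by apply/disj_setPS => x [[_ Qx] [_ /(_ Qx)]].
have bnd (P : set GB) : measurable P -> P `<=` BD ->
    0 <= Rintegral theta P u <= M * fine (theta BD).
  move=> mP PB; have fP : (theta P < +oo)%E.
    by apply: le_lt_trans fBD; apply: le_measure; rewrite ?inE.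
  rewrite Rintegral_ge0/=; last by move=> x _; have /andP[] := u0M x.
  have M0 : 0 <= M by have /andP[h1 h2] := u0M 0; exact: le_trans h1 h2.
  apply: (@le_trans _ _ (Rintegral theta P (fun=> M))).
    apply: le_Rintegral => //.
    - exact: (bounded_integrable_restr mP fP mu uM).
    - by apply: (@bounded_integrable_restr _ _ _ theta (fun=> M) P `|M|).
    - by move=> x _; have /andP[] := u0M x.
  rewrite Rintegral_cst// ler_wpM2l// fine_le ?ge0_fin_numE//.
  by apply: le_measure; rewrite ?inE.
rewrite (split1 sA (A n))// (split1 (A n) sA) ?A_fin// [A n `&` sA]setIC.
have /andP[a1 a2] : 0 <= Rintegral theta (sA `\` A n) u <= M * fine (theta BD).
  by apply: bnd; [exact: measurableD|move=> x h; apply: sub; left].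
have /andP[b1 b2] : 0 <= Rintegral theta (A n `\` sA) u <= M * fine (theta BD).
  by apply: bnd; [exact: measurableD|move=> x h; apply: sub; right].
by rewrite ler_norml; apply/andP; split; lra.
Qed.

Lemma avg_translate_real n (s : G) (u : GB -> R) M : measurable_fun setT u ->
  (forall x, `|u x| <= M) ->
  `|Rintegral (avg n) setT (fun x : GB => u ((x : G) + s)) - Rintegral (avg n) setT u|
    <= 2 * M * (fine (theta (vh_boundary [set s; (- s)%R] (A n) : set GB)) /
                fine (theta (A n))).
Proof.
move=> mu uM.
have mh : measurable_fun setT ((fun x : G => x + s) : GB -> GB).
  by move=> _ D mD; rewrite setTI; exact: translate_measurable.
have mus : measurable_fun setT (fun x : GB => u ((x : G) + s)).
  exact: (measurableT_comp mu mh).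
have pos x : 0 <= u x + M <= 2 * M.
  by have := uM x; rewrite ler_norml => /andP[? ?]; apply/andP; split; lra.
have muM : measurable_fun setT (fun x => u x + M) by exact: measurable_funD.
have h := @Rintegral_translate_diff n s (fun x => u x + M) (2 * M) muM pos.
rewrite (Rintegral_nrestr _ _ _ mus (M := M))// (Rintegral_nrestr _ _ _ mu uM).
have a0 := thA_gt0 (A_gt0 n) (A_fin n).
rewrite -mulrBr normrM gtr0_norm ?invr_gt0//.
rewrite [leRHS]mulrA [leRHS]mulrC ler_pM2l ?invr_gt0//.
apply: le_trans h; rewrite le_eqVlt; apply/orP; left; apply/eqP; congr (`| _ |).
have iM : theta.-integrable (A n) (EFin \o (fun=> M)).
  by apply: (@bounded_integrable_restr _ _ _ theta (fun=> M) (A n) `|M|) => //;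
    [exact: borel_A|exact: A_fin].
have iu : theta.-integrable (A n) (EFin \o u).
  exact: (bounded_integrable_restr (borel_A n) (A_fin n) mu uM).
have ius : theta.-integrable (A n) (EFin \o (fun x : GB => u ((x : G) + s))).
  by apply: (bounded_integrable_restr (borel_A n) (A_fin n) mus (M := M)).
rewrite (RintegralD (borel_A n) iu iM) (RintegralD (borel_A n) ius iM).
ring.
Qed.

Lemma boundary_ratio_cvg (s : G) :
  fine (theta (vh_boundary [set s; (- s)%R] (A n) : set GB)) / fine (theta (A n))
    @[n --> \oo] --> (0 : R).
Proof.
case: vh => _ _ _; apply.
by apply: (@compactU _ [set s] [set - s]); exact: compact_set1.
Qed.

Lemma avg_asymp_invariant (F : G -> C) (s : G) : bcont F ->
  integralC (avg n) setT (fun t => F (t + s)) - integralC (avg n) setT F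
    @[n --> \oo] --> (0 : C).
Proof.
move=> bF; case: (bF) => cF [M FM].
have [mr mi] : mfunC (F : GB -> C) by exact: continuous_mfunC.
have M0 : 0 <= M by apply: le_trans (FM 0); exact: absC_ge0.
apply/cvgC_abs => e e0.
have := @boundary_ratio_cvg s => /cvgrPdist_lt/(_ (e / (4 * M + 1))).
have M4 : 0 < 4 * M + 1 by rewrite ltr_wpDl// mulr_ge0.
move=> /(_ (divr_gt0 e0 M4)); apply: filterS => n; set rho := _ / _.
rewrite sub0r normrN => /(le_lt_trans (ler_norm _)) hr.
have rho0 : 0 <= rho.
  by rewrite divr_ge0// fine_ge0.
rewrite subr0 (le_lt_trans (absC_le _))// !(reCB, imCB) /integralC !CE.
rewrite !mul0r !mulr0 !mul1r !subrr !addr0 !add0r.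
have hR := @avg_translate_real n s (fun x => reC (F x)) M mr
  (fun x => le_trans (ler_reC _) (FM x)).
have hI := @avg_translate_real n s (fun x => imC (F x)) M mi
  (fun x => le_trans (ler_imC _) (FM x)).
apply: (@le_lt_trans _ _ (4 * M * rho)); first by move: hR hI; rewrite -/rho; lra.
have -> : e = (4 * M + 1) * (e / (4 * M + 1)) by rewrite mulrCA divff ?mulr1// gt_eqF.
apply: (@le_lt_trans _ _ ((4 * M + 1) * rho)); first by rewrite ler_wpM2r// lerDl.
by rewrite ltr_pM2l.
Qed.

End haar_averages.

(** * The Stone-Weierstrass theorem for vector lattices *)

Section abs_approx.
Variable R : realType.
(** The iteration s + (x^2 - s^2) / 2, which starts at zero and increases to the
    absolute value of x. Its steps are polynomial; this is why uniformly closed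
    algebras are stable under absolute values. *)
Fixpoint sqrt_iter (k : nat) (x : R) : R :=
  if k is k'.+1 then sqrt_iter k' x + (x ^+ 2 - sqrt_iter k' x ^+ 2) / 2 else 0.

(** With y the absolute value of x, one step multiplies the error y - s by
    1 - (y + s) / 2 <= 1 - y / 2, hence the error after k steps is at most
    y / (1 + k y / 2). Written without division, this bound is uniform in x. *)
Lemma sqrt_iterP k x : `|x| <= 1 ->
  0 <= sqrt_iter k x <= `|x| /\
  (`|x| - sqrt_iter k x) * (1 + k%:R * (`|x| / 2)) <= `|x|.
Proof.
move=> x1; have y0 := normr_ge0 x.
elim: k => [|k [/andP[s0 sy] IH]] /=; first by rewrite lexx y0 subr0 mul0r addr0 mulr1.
have -> : x ^+ 2 = `|x| ^+ 2 by rewrite real_normK ?num_real.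
move: s0 sy IH; set s := sqrt_iter k x; set y := `|x| in x1 y0 * => s0 sy IH.
have E : y - (s + (y ^+ 2 - s ^+ 2) / 2) = (y - s) * (1 - (y + s) / 2) by field.
have h1 : 0 <= 1 - (y + s) / 2 <= 1 - y / 2 by apply/andP; split; lra.
have ys : 0 <= y - s by lra.
have := mulr_ge0 ys (proj1 (andP h1)); rewrite -E => h2.
split; first by apply/andP; split; nra.
rewrite E; case/andP: h1 => h1 h1'.
have k0 : 0 <= k%:R :> R by [].
have ky : 0 <= k%:R * y by exact: mulr_ge0.
have h3 : (1 - (y + s) / 2) * (1 + k.+1%:R * (y / 2)) <= 1 + k%:R * (y / 2).
  apply: (@le_trans _ _ ((1 - y / 2) * (1 + k.+1%:R * (y / 2)))).
    by rewrite ler_wpM2r// -natr1; nra.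
  rewrite -natr1; have : 0 <= k%:R * y * y by exact: mulr_ge0.
  nra.
apply: le_trans IH; rewrite -mulrA; exact: ler_wpM2l.
Qed.

Lemma sqrt_iter_cvg (e : R) : 0 < e -> exists k, forall x, `|x| <= 1 ->
  `| `|x| - sqrt_iter k x | <= e.
Proof.
move=> e0; pose k := (Num.truncn (2 / e)).+1; exists k => x x1.
have [/andP[s0 sy] h] := sqrt_iterP k x1; rewrite ger0_norm ?subr_ge0//.
have k1 : 2 / e <= k%:R by apply/ltW/truncnS_gt.
have y0 := normr_ge0 x; have [x0|xn0] := eqVneq `|x| 0; first by lra.
have yp : 0 < `|x| by rewrite lt_def xn0.
have ke : 2 <= k%:R * e by rewrite -ler_pdivrMr.
have k0 : 0 < k%:R :> R by rewrite ltr0n.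
move: h sy s0 yp; set y := `|x|; set s := sqrt_iter k x => h sy s0 yp.
rewrite leNgt; apply/negP => es.
have : y < (y - s) * (1 + k%:R * (y / 2)).
  apply: (@lt_le_trans _ _ (e * (1 + k%:R * (y / 2)))); last first.
    by rewrite ler_wpM2r ?(ltW es)// addr_ge0// mulr_ge0 ?divr_ge0// ltW.
  have : 2 * y <= k%:R * e * y by rewrite ler_pM2r.
  nra.
by rewrite ltNge h.
Qed.
End abs_approx.

Section stone_weierstrass.
Context (R : realType) (X : topologicalType).
Hypothesis cX : compact [set: X].
Variable L : set (X -> R).
Hypothesis Lcont : forall f, L f -> continuous f.
Hypothesis Lcst : forall c, L (fun=> c).
Hypothesis Llin : forall a f g, L f -> L g -> L (fun x => a * f x + g x).
Hypothesis Labs : forall f, L f -> L (fun x => `|f x|).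
Hypothesis Llim : forall f, continuous f ->
  (forall e, 0 < e -> exists2 g, L g & forall x, `|f x - g x| <= e) -> L f.
Hypothesis Lsep : forall x y, x <> y -> exists2 f, L f & f x <> f y.

Let Lmax f g : L f -> L g -> L (fun x => Num.max (f x) (g x)).
Proof.
move=> Lf Lg; have h : L (fun x => -1 * g x + f x) by exact: Llin.
have := Llin 2^-1 (Labs h) (Llin 2^-1 Lf (Llin 2^-1 Lg (Lcst 0))).
congr L; apply/funext => x; have [gf|fg] := leP (g x) (f x).
  by rewrite ger0_norm; lra.
by rewrite ltr0_norm; lra.
Qed.
Let Lmin f g : L f -> L g -> L (fun x => Num.min (f x) (g x)).
Proof.
move=> Lf Lg; have N h : L h -> L (fun x => -1 * h x).
  by move=> Lh; have := Llin (-1) Lh (Lcst 0); under eq_fun do rewrite addr0.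
have := N _ (Lmax (N _ Lf) (N _ Lg)).
by congr L; apply/funext => x; rewrite !mulN1r oppr_max !opprK.
Qed.

Let interp (f : X -> R) x y : exists2 g, L g & g x = f x /\ g y = f y.
Proof.
have [->|xy] := pselect (x = y); first by exists (fun=> f y).
have [h Lh hxy] := Lsep xy.
have d0 : h x - h y != 0 by rewrite subr_eq0; apply/eqP.
exists (fun z => (f x - f y) / (h x - h y) * h z + (f y - (f x - f y) / (h x - h y) * h y)).
  by apply: Llin => //; exact: Lcst.
by split; field.
Qed.

Let upper (f : X -> R) x e : continuous f -> 0 < e ->
  exists2 g, L g & g x = f x /\ forall z, g z < f z + e.
Proof.
move=> cf e0; have /choice[g gP] : forall y, exists g, L g /\ (g x = f x /\ g y = f y).
  by move=> y; have [g ? ?] := interp f x y; exists g.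
have [|s sP] := @compact_finite_nbhs X setT (fun y => [set z | g y z < f z + e]) cX.
  move=> y _; have Lg : L (g y) by case: (gP y).
  have : nbhs y ((fun z => g y z - f z) @^-1` [set r | r < e]).
    apply: open_nbhs_nbhs; split; last by rewrite /= (gP y).2.2 subrr.
    apply: open_comp; last exact: open_lt.
    by move=> z _; apply: cvgB; [exact: Lcont|exact: cf].
  by apply: filterS => z /=; rewrite ltrBlDl.
have : forall r : seq X, exists2 h, L h & h x = f x /\
    forall z, (exists2 y, y \in r & g y z < f z + e) -> h z < f z + e.
  elim=> [|y r [h Lh [hx hs]]].
    by exists (g x); [case: (gP x)|split; [exact: (gP x).2.1|move=> z []]].
  exists (fun z => Num.min (g y z) (h z)); first by apply: Lmin => //; case: (gP y).
  split; first by rewrite (gP y).2.1 hx minxx.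
  move=> z [y']; rewrite inE => /predU1P[->|y's] hz; rewrite gt_min ?hz//.
  by rewrite hs ?orbT//; exists y'.
by move=> /(_ s)[h Lh [hx hs]]; exists h => //; split => // z; apply: hs; exact: sP.
Qed.

(** Lattice form of the theorem. Two-point interpolation comes from separation
    of points and from constants; minima over a finite cover bring the
    interpolants below f + e, then maxima over a finite cover bring them above
    f - e. Absolute values take the place of products because they preserve
    approximation in the mean, as products do not directly. *)
Lemma stone_weierstrass (f : X -> R) : continuous f -> L f.
Proof.
move=> cf; apply: Llim => // e e0.
have /choice[g gP] : forall x, exists g, L g /\ (g x = f x /\ forall z, g z < f z + e).
  by move=> x; have [g ? ?] := @upper f x e cf e0; exists g.
have [|s sP] := @compact_finite_nbhs X setT (fun y => [set z | f z - e < g y z]) cX.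
  move=> y _; have Lg : L (g y) by case: (gP y).
  have : nbhs y ((fun z => f z - g y z) @^-1` [set r | r < e]).
    apply: open_nbhs_nbhs; split; last by rewrite /= (gP y).2.1 subrr.
    apply: open_comp; last exact: open_lt.
    by move=> z _; apply: cvgB; [exact: cf|exact: Lcont].
  by apply: filterS => z /=; rewrite ltrBlDl ltrBlDr.
have [[x0]|nX] := pselect (exists x : X, True); last first.
  by exists (fun=> 0) => // x; exfalso; apply: nX; exists x.
move=> _; have : forall r : seq X, exists2 h, L h & (forall z, h z < f z + e) /\
    forall z, (exists2 y, y \in r & f z - e < g y z) -> f z - e < h z.
  elim=> [|y r [h Lh [hx hs]]].
    by exists (g x0); [case: (gP x0)|split; [exact: (gP x0).2.2|move=> z []]].
  exists (fun z => Num.max (g y z) (h z)); first by apply: Lmax => //; case: (gP y).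
  split; first by move=> z; rewrite gt_max (gP y).2.2 hx.
  move=> z [y']; rewrite inE => /predU1P[->|y's] hz; rewrite lt_max ?hz//.
  by rewrite hs ?orbT//; exists y'.
move=> /(_ s)[h Lh [h1 h2]]; exists h => // z.
have := h1 z; have := h2 z (sP z I); rewrite ler_norml => *; apply/andP; split; lra.
Qed.
End stone_weierstrass.

(** * Characters, trigonometric polynomials and their uniform closure *)

Section bcont_more.
Context (R : realType) (T : topologicalType).
Local Notation C := (Cx R).
Implicit Types F H : T -> C.

Lemma bcontD F H : bcont F -> bcont H -> bcont (fun t => F t + H t).
Proof. by move=> bF bH; have := bcont_lin 1 bF bH; under eq_fun do rewrite mul1r. Qed.
Lemma bcontZ c F : bcont F -> bcont (fun t => c * F t).
Proof.
by move=> bF; have := bcont_lin c bF (bcont_cst T 0); under eq_fun do rewrite addr0.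
Qed.
Lemma bcontB F H : bcont F -> bcont H -> bcont (fun t => F t - H t).
Proof.
move=> bF bH; have := bcont_lin (-1) bH bF.
by under eq_fun do rewrite mulN1r addrC.
Qed.
Lemma bcontM F H : bcont F -> bcont H -> bcont (fun t => F t * H t).
Proof.
move=> [cF [M FM]] [cH [N HN]]; split.
  by move=> t; apply: cvgM; [exact: cF|exact: cH].
by exists (M * N) => t; rewrite absCM ler_pM ?absC_ge0.
Qed.
Lemma bcont_conj F : bcont F -> bcont (fun t => (F t)^*).
Proof.
move=> [cF [M FM]]; split; last by exists M => t; rewrite absC_conj.
by move=> t; apply: (@cvg_conjC R T (nbhs t) (nbhs_filter t)); exact: cF.
Qed.
Lemma bcont_abs F : bcont F -> bcont (fun t => ofR (absC (F t))).
Proof.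
move=> [cF [M FM]]; split.
  move=> t; apply: (@cvg_ofR R T (nbhs t) (nbhs_filter t)).
  by apply: (@cvg_absC R T (nbhs t) (nbhs_filter t)); exact: cF.
by exists M => t; rewrite absC_ofR ger0_norm ?absC_ge0.
Qed.
Lemma bcont_re F : bcont F -> bcont (fun t => ofR (reC (F t))).
Proof.
move=> [cF [M FM]]; split.
  move=> t; apply: (@cvg_ofR R T (nbhs t) (nbhs_filter t)).
  by apply: (@cvg_reC R T (nbhs t) (nbhs_filter t)); exact: cF.
by exists M => t; rewrite absC_ofR (le_trans (ler_reC _)).
Qed.
Lemma bcont_sum n (F : 'I_n -> T -> C) : (forall i, bcont (F i)) ->
  bcont (fun t => \sum_(i < n) F i t).
Proof.
elim: n F => [|n IH] F bF.
  by under eq_fun do rewrite big_ord0; exact: bcont_cst.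
under eq_fun do rewrite big_ord_recl; apply: bcontD => //; exact: IH.
Qed.
End bcont_more.

Section trigonometric_polynomials.
Context (R : realType) (G : topologicalZmodType).
Local Notation C := (Cx R).
Implicit Types (chi psi : G -> C) (F H P Q : G -> C).

Lemma char_abs chi t : is_character chi -> absC (chi t) = 1.
Proof. by case=> _ _ /(_ t)/absC_eq1. Qed.
Lemma char_bcont chi : is_character chi -> bcont chi.
Proof. by move=> h; split; [case: h|exists 1 => t; rewrite char_abs]. Qed.
Lemma char_mul chi psi : is_character chi -> is_character psi ->
  is_character (fun t => chi t * psi t).
Proof.
move=> [c1 m1 n1] [c2 m2 n2]; split=> [t|s t|t].
- by apply: cvgM; [exact: c1|exact: c2].
- by rewrite m1 m2 mulrACA.
- by rewrite normrM n1 n2 mulr1.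
Qed.
Lemma char_conj chi : is_character chi -> is_character (fun t => (chi t)^*).
Proof.
move=> h; split=> [t|s t|t].
- by have [+ _] := bcont_conj (char_bcont h); exact.
- by case: h => _ -> _; rewrite rmorphM.
- by rewrite norm_conjC; case: h.
Qed.
Lemma char_cst1 : is_character (fun _ : G => 1 : C).
Proof.
by split=> [|s t|t]; [exact: cst_continuous|rewrite mulr1|rewrite normr1].
Qed.
Lemma char0 chi : is_character chi -> chi 0 = 1.
Proof.
move=> h; have n0 : chi 0 != 0 by rewrite -absC_eq0 char_abs// oner_neq0.
by apply: (mulfI n0); case: (h) => _ m _; rewrite -m addr0 mulr1.
Qed.
Lemma char_conjM chi t : is_character chi -> (chi t)^* * chi t = 1.
Proof. by move=> h; rewrite mulrC mulr_conj char_abs// expr1n. Qed.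
Lemma charMn chi t k : is_character chi -> chi (t *+ k) = chi t ^+ k.
Proof.
move=> h; elim: k => [|k IH]; first by rewrite mulr0n char0.
by rewrite mulrS exprS; case: (h) => _ -> _; rewrite IH.
Qed.

Lemma trig_char chi : is_character chi -> trig_poly chi.
Proof.
move=> h; exists 1%N, (fun=> 1), (fun=> chi); split=> //.
by apply/funext => t; rewrite big_ord1 mul1r.
Qed.
Lemma trig_cst c : trig_poly (fun _ : G => c : C).
Proof.
exists 1%N, (fun=> c), (fun _ _ => 1); split; first by move=> _; exact: char_cst1.
by apply/funext => t; rewrite big_ord1 mulr1.
Qed.
Lemma trigZ c P : trig_poly P -> trig_poly (fun t => c * P t).
Proof.
move=> [n [a [chi [hc ->]]]]; exists n, (fun i => c * a i), chi; split=> //.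
by apply/funext => t; rewrite mulr_sumr; apply: eq_bigr => i _; rewrite mulrA.
Qed.
Lemma trigD P Q : trig_poly P -> trig_poly Q -> trig_poly (fun t => P t + Q t).
Proof.
move=> [n [a [chi [hc ->]]]] [k [b [psi [hp ->]]]].
exists (n + k)%N, (fun i => match fintype.split i with inl j => a j | inr j => b j end),
  (fun i => match fintype.split i with inl j => chi j | inr j => psi j end); split.
  by move=> i; case: fintype.split.
apply/funext => t; rewrite big_split_ord /=; congr (_ + _); apply: eq_bigr => i _.
  by rewrite (unsplitK (inl i)).
by rewrite (unsplitK (inr i)).
Qed.
Lemma trig_ind (K : (G -> C) -> Prop) : K (fun=> 0) ->
  (forall F H, K F -> K H -> K (fun t => F t + H t)) ->
  (forall a chi, is_character chi -> K (fun t => a * chi t)) ->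
  forall P, trig_poly P -> K P.
Proof.
move=> K0 KD Kc P [n [a [chi [hc ->]]]]; elim: n a chi hc => [|n IH] a chi hc.
  by under eq_fun do rewrite big_ord0.
under eq_fun do rewrite big_ord_recl; apply: KD; first exact: Kc.
by apply: (IH (fun i => a (lift ord0 i)) (fun i => chi (lift ord0 i))).
Qed.
Lemma trigM P Q : trig_poly P -> trig_poly Q -> trig_poly (fun t => P t * Q t).
Proof.
move=> tP tQ; apply: (@trig_ind (fun P => trig_poly (fun t => P t * Q t))) tP.
- by under eq_fun do rewrite mul0r; exact: trig_cst.
- by move=> F H tF tH; under eq_fun do rewrite mulrDl; exact: trigD.
move=> a chi hc; apply: (@trig_ind (fun Q => trig_poly (fun t => a * chi t * Q t))) tQ.
- by under eq_fun do rewrite mulr0; exact: trig_cst.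
- by move=> F H tF tH; under eq_fun do rewrite mulrDr; exact: trigD.
move=> b psi hp; rewrite (_ : (fun t => _) = (fun t => (a * b) * (chi t * psi t))).
  by apply: trigZ; apply: trig_char; exact: char_mul.
by apply/funext => t; rewrite mulrACA.
Qed.
Lemma trig_conj P : trig_poly P -> trig_poly (fun t => (P t)^*).
Proof.
apply: (@trig_ind (fun P => trig_poly (fun t => (P t)^*))).
- by under eq_fun do rewrite conjC0; exact: trig_cst.
- by move=> F H tF tH; under eq_fun do rewrite rmorphD; exact: trigD.
move=> a chi hc; under eq_fun do rewrite rmorphM.
by apply: trigZ; apply: trig_char; exact: char_conj.
Qed.
Lemma trig_bcont P : trig_poly P -> bcont P.
Proof.
apply: trig_ind; first exact: bcont_cst.
  by move=> F H; exact: bcontD.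
by move=> a chi hc; apply: bcontZ; exact: char_bcont.
Qed.

(** The Bohr almost periodic functions. *)
Definition bohr F := bcont F /\ forall e : R, 0 < e ->
  exists2 P, trig_poly P & forall t, absC (F t - P t) <= e.

Lemma bohr_trig P : trig_poly P -> bohr P.
Proof.
move=> tP; split; first exact: trig_bcont.
by move=> e e0; exists P => // t; rewrite subrr absC0 ltW.
Qed.
Lemma bohr_cst c : bohr (fun=> c).
Proof. by apply: bohr_trig; exact: trig_cst. Qed.
Lemma bohr_lim F : bcont F -> (forall e : R, 0 < e ->
  exists2 P, bohr P & forall t, absC (F t - P t) <= e) -> bohr F.
Proof.
move=> bF h; split=> // e e0; have e20 : 0 < e / 2 by rewrite divr_gt0.
have [Q [_ hQ] FQ] := h _ e20; have [P tP QP] := hQ _ e20; exists P => // t.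
by rewrite (le_trans (absC_dist _ (Q t) _))// [e]splitr lerD.
Qed.
Lemma bohrD F H : bohr F -> bohr H -> bohr (fun t => F t + H t).
Proof.
move=> [bF hF] [bH hH]; split; first exact: bcontD.
move=> e e0; have e20 : 0 < e / 2 by rewrite divr_gt0.
have [P tP FP] := hF _ e20; have [Q tQ HQ] := hH _ e20.
exists (fun t => P t + Q t); first exact: trigD.
move=> t; rewrite opprD addrACA (le_trans (absCD _ _))// [e]splitr lerD//.
Qed.
Lemma bohrM F H : bohr F -> bohr H -> bohr (fun t => F t * H t).
Proof.
move=> [bF hF] [bH hH]; split; first exact: bcontM.
move=> e e0; have [_ [M FM]] := bF.
have e20 : 0 < e / 2 by rewrite divr_gt0.
have M1 : 0 < `|M| + 1 by rewrite ltr_wpDl.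
have [Q tQ HQ] := hH _ (divr_gt0 e20 M1).
have [_ [N QN]] := trig_bcont tQ.
have N1 : 0 < `|N| + 1 by rewrite ltr_wpDl.
have [P tP FP] := hF _ (divr_gt0 e20 N1).
exists (fun t => P t * Q t); first exact: trigM.
move=> t; rewrite (_ : _ - _ = F t * (H t - Q t) + (F t - P t) * Q t); last by ring.
rewrite (le_trans (absCD _ _))// !absCM [e]splitr lerD//.
  have -> : e / 2 = (`|M| + 1) * (e / 2 / (`|M| + 1)).
    by rewrite mulrCA divff ?mulr1// gt_eqF.
  rewrite ler_pM ?absC_ge0//; apply: le_trans (FM t) _.
  by rewrite (le_trans (ler_norm _))// lerDl.
have -> : e / 2 = (e / 2 / (`|N| + 1)) * (`|N| + 1) by rewrite mulfVK// gt_eqF.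
rewrite ler_pM ?absC_ge0//; apply: le_trans (QN t) _.
by rewrite (le_trans (ler_norm _))// lerDl.
Qed.
Lemma bohrZ c F : bohr F -> bohr (fun t => c * F t).
Proof. by move=> bF; apply: bohrM => //; exact: bohr_cst. Qed.
Lemma bohr_conj F : bohr F -> bohr (fun t => (F t)^*).
Proof.
move=> [bF hF]; split; first exact: bcont_conj.
move=> e e0; have [P tP FP] := hF e e0; exists (fun t => (P t)^*).
  exact: trig_conj.
by move=> t; rewrite -rmorphB absC_conj.
Qed.
Lemma bohr_re F : bohr F -> bohr (fun t => ofR (reC (F t))).
Proof.
move=> bF; rewrite (_ : (fun t => _) = fun t => ofR 2^-1 * (F t + (F t)^*)).
  by apply: bohrZ; apply: bohrD => //; exact: bohr_conj.
by apply/funext => t; apply: Cx_ext; rewrite !CE; field.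
Qed.
Lemma bohr_im F : bohr F -> bohr (fun t => ofR (imC (F t))).
Proof.
move=> /(bohrZ (- 'i))/bohr_re; congr bohr; apply/funext => t.
by congr ofR; rewrite !CE; ring.
Qed.

(** The absolute value is a uniform limit of polynomials on a bounded interval,
    and the class is a uniformly closed algebra. *)
Lemma bohr_abs (u : G -> R) : bohr (fun t => ofR (u t)) -> bohr (fun t => ofR `|u t|).
Proof.
move=> bu; have [bcu _] := bu; have [_ [M uM]] := bcu.
have M1 : 0 < `|M| + 1 by rewrite ltr_wpDl.
set N := `|M| + 1 in M1.
have uN t : `|N^-1 * u t| <= 1.
  rewrite normrM normfV (gtr0_norm M1) ler_pdivrMl// mulr1.
  have := uM t; rewrite absC_ofR => /le_trans; apply.
  by rewrite (le_trans (ler_norm _))// lerDl.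
pose v t := N^-1 * u t.
have bv : bohr (fun t => ofR (v t)).
  by have := bohrZ (ofR N^-1) bu; under eq_fun do rewrite -ofRM.
have bs k : bohr (fun t => ofR (sqrt_iter k (v t))).
  elim: k => [|k IH]; first exact: (bohr_cst (ofR 0)).
  rewrite (_ : (fun t => _) = fun t => ofR (sqrt_iter k (v t)) + ofR 2^-1 *
      (ofR (v t) * ofR (v t) + (-1) * (ofR (sqrt_iter k (v t)) * ofR (sqrt_iter k (v t))))).
    apply: bohrD => //; apply: bohrZ; apply: bohrD; first exact: bohrM.
    by apply: bohrZ; exact: bohrM.
  apply/funext => t /=; rewrite mulN1r -!ofRM -ofRN -!ofRD -ofRM -ofRD; congr ofR.
  by rewrite !expr2; field.
have bva : bohr (fun t => ofR `|v t|).
  apply: bohr_lim; first by have := bcont_abs bv.1;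
    under eq_fun do rewrite absC_ofR.
  move=> e e0; have [k hk] := sqrt_iter_cvg e0.
  exists (fun t => ofR (sqrt_iter k (v t))) => // t.
  by rewrite -ofRN -ofRD absC_ofR hk// uN.
have := bohrZ (ofR N) bva; under eq_fun do rewrite -ofRM.
congr bohr; apply/funext => t; congr ofR.
by rewrite /v normrM normfV (gtr0_norm M1) mulrA divff ?gt_eqF// mul1r.
Qed.

(** The projection of the real line onto the interval between - c and c. *)
Definition clamp (c x : R) : R := Num.max (- c) (Num.min c x).

Lemma bohr_clamp c (u : G -> R) : bohr (fun t => ofR (u t)) ->
  bohr (fun t => ofR (clamp c (u t))).
Proof.
have bmax (v : G -> R) b : bohr (fun t => ofR (v t)) ->
    bohr (fun t => ofR (Num.max b (v t))).
  move=> bv; have h : bohr (fun t => ofR (b - v t)).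
    have := bohrD (bohr_cst (ofR b)) (bohrZ (-1) bv).
    by congr bohr; apply/funext => t; rewrite mulN1r -ofRN -ofRD.
  have := bohrZ (ofR 2^-1) (bohrD (bohrD (bohr_cst (ofR b)) bv) (bohr_abs h)).
  congr bohr; apply/funext => t; rewrite -!ofRD -ofRM; congr ofR.
  have [bv'|bv'] := leP b (v t); first by rewrite ler0_norm ?subr_le0//; lra.
  by rewrite gtr0_norm ?subr_gt0//; lra.
move=> bu; apply: (bmax _ (- c)).
have nu : bohr (fun t => ofR (- u t)).
  by have := bohrZ (-1) bu; under eq_fun do rewrite mulN1r -ofRN.
have := bohrZ (-1) (bmax _ (- c) nu); under eq_fun do rewrite mulN1r -ofRN.
by congr bohr; apply/funext => t; rewrite oppr_max !opprK.
Qed.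

Lemma clamp_le c x : 0 <= c -> `|clamp c x| <= c.
Proof.
move=> c0; rewrite /clamp ler_norml le_max lexx/= ge_max ge_min lexx/= andbT.
lra.
Qed.
Lemma clamp_dist c x y : `|x| <= c -> `|x - clamp c y| <= `|x - y|.
Proof.
move=> xc; rewrite /clamp; have := ler_normB x y; move: xc; rewrite ler_norml => /andP[h1 h2] _.
have [cy|cy] := leP c y.
  have -> : Num.max (- c) c = c by apply/max_idPr; lra.
  by rewrite !ler0_norm; lra.
have [cy'|cy'] := leP (- c) y; first exact: lexx.
by rewrite !ger0_norm; lra.
Qed.

End trigonometric_polynomials.

(** * Means and Besicovitch almost periodic functions *)

Section one_norm.
Context (R : realType) (T : topologicalType) (x0 : T) (m : probability (borel x0) R).
Local Notation C := (Cx R).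
Implicit Types F H : T -> C.

Definition nrm1 F : R := Rintegral m setT (fun t : borel x0 => absC (F t)).

Lemma bcont_L1 F : bcont F -> L1C m (F : borel x0 -> C).
Proof. by move=> bF; apply: L2_L1; exact: bcont_L2. Qed.
Lemma nrm1_int F : bcont F ->
  m.-integrable setT (EFin \o (fun t : borel x0 => absC (F t))).
Proof. by move=> bF; apply: L1C_abs; exact: bcont_L1. Qed.
Lemma nrm1_ge0 F : 0 <= nrm1 F.
Proof. by apply: Rintegral_ge0 => x _; exact: absC_ge0. Qed.
Lemma nrm1_le F H : bcont F -> bcont H -> (forall t, absC (F t) <= absC (H t)) ->
  nrm1 F <= nrm1 H.
Proof.
move=> bF bH FH; apply: le_Rintegral => //; [exact: nrm1_int|exact: nrm1_int].
Qed.
Lemma nrm1_cst c : nrm1 (fun=> c) = absC c.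
Proof.
rewrite /nrm1 Rintegral_cst//; transitivity (absC c * fine (1%:E : \bar R)).
  by congr (_ * fine _); exact: probability_setT.
by rewrite mulr1.
Qed.
Lemma nrm1D F H : bcont F -> bcont H -> nrm1 (fun t => F t + H t) <= nrm1 F + nrm1 H.
Proof.
move=> bF bH; rewrite /nrm1 -RintegralD//; [|exact: nrm1_int|exact: nrm1_int].
apply: le_Rintegral => //; first exact: (nrm1_int (bcontD bF bH)).
  by have := integrableD measurableT (nrm1_int bF) (nrm1_int bH); apply: eq_integrable.
by move=> x _; exact: absCD.
Qed.
Lemma nrm1Z c F : bcont F -> nrm1 (fun t => c * F t) = absC c * nrm1 F.
Proof.
move=> bF; rewrite /nrm1 -RintegralZl//; last exact: nrm1_int.
by congr Rintegral; apply/funext => t; rewrite absCM.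
Qed.
Lemma nrm1_sup F M : bcont F -> (forall t, absC (F t) <= M) -> nrm1 F <= M.
Proof.
move=> bF FM; have M0 : 0 <= M := le_trans (absC_ge0 _) (FM x0).
rewrite -[M](ger0_norm M0) -absC_ofR -nrm1_cst; apply: nrm1_le => //.
  exact: bcont_cst.
by move=> t; rewrite absC_ofR ger0_norm.
Qed.
Lemma mean_le_nrm1 F : bcont F -> absC (integralC m setT (F : borel x0 -> C)) <= nrm1 F.
Proof. by move=> bF; apply: le_absC_integralC; exact: bcont_L1. Qed.
Lemma nrm1_le_nrm F : bcont F -> nrm1 F <= nrm m (F : borel x0 -> C).
Proof. by move=> bF; apply: Rintegral_absC_le_nrm; exact: bcont_L2. Qed.
(** For uniformly bounded functions, closeness in the mean implies closeness in
    the quadratic mean. *)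
Lemma sqnorm_le_nrm1 F H M : bcont F -> bcont H ->
  (forall t, absC (F t) <= M) -> (forall t, absC (F t) <= absC (H t)) ->
  sqnorm m (F : borel x0 -> C) <= M * nrm1 H.
Proof.
move=> bF bH FM FH; have M0 : 0 <= M := le_trans (absC_ge0 _) (FM x0).
rewrite /nrm1 -RintegralZl//; last exact: nrm1_int.
apply: le_Rintegral => //.
- by apply: L2_int; exact: bcont_L2.
- by have := integrableZl measurableT M (nrm1_int bH); apply: eq_integrable.
- by move=> t _; rewrite expr2 ler_pM ?absC_ge0.
Qed.
End one_norm.

Section means.
Context (R : realType) (G : topologicalZmodType).
Local Notation C := (Cx R).
Local Notation GB := (borel (0 : G)).
Variable p : nat -> probability GB R.
Hypothesis asymp : forall (F : G -> C) (s : G), bcont F ->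
  integralC (p n) setT (fun t : GB => F ((t : G) + s)) - integralC (p n) setT (F : GB -> C)
    @[n --> \oo] --> (0 : C).
Implicit Types (chi psi : G -> C) (F H P Q D : G -> C).

Definition mean n F : C := integralC (p n) setT (F : GB -> C).
Definition has_mean F (l : C) := mean n F @[n --> \oo] --> l.

Lemma bcont_translateG (s : G) F : bcont F -> bcont (fun t => F (t + s)).
Proof.
move=> [cF [M FM]]; split; last by exists M.
move=> x; apply: (@continuous_comp _ _ _ (fun y : G => y + s) F); last exact: cF.
by have := @addl_continuous G s x; under eq_fun do rewrite addrC.
Qed.

Lemma has_meanP F l : has_mean F l <->
  forall e : R, 0 < e -> \forall n \near \oo, absC (mean n F - l) < e.
Proof. exact: cvgC_abs. Qed.

Lemma has_mean_unique F l l' : has_mean F l -> has_mean F l' -> l = l'.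
Proof. exact: cvg_unique. Qed.

Lemma mean_lin n c F H : bcont F -> bcont H ->
  mean n (fun t => c * F t + H t) = c * mean n F + mean n H.
Proof.
by move=> bF bH; have [] := integralC_lin c (bcont_L1 (p n) bF) (bcont_L1 (p n) bH).
Qed.
Lemma has_meanD F H l l' : bcont F -> bcont H -> has_mean F l -> has_mean H l' ->
  has_mean (fun t => F t + H t) (l + l').
Proof.
move=> bF bH hF hH; rewrite /has_mean (_ : (fun n => _) = (fun n => mean n F + mean n H)).
  by apply: cvgD; [exact: hF|exact: hH].
by apply/funext => n; have := mean_lin n 1 bF bH; under eq_fun do rewrite mul1r;
  rewrite mul1r.
Qed.
Lemma mean_cst n c : mean n (fun=> c) = c.
Proof. exact: integralC_cst. Qed.
Lemma has_mean_cst c : has_mean (fun=> c) c.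
Proof. by rewrite /has_mean; under eq_fun do rewrite mean_cst; exact: cvg_cst. Qed.
Lemma has_meanZ c F l : bcont F -> has_mean F l -> has_mean (fun t => c * F t) (c * l).
Proof.
move=> bF hF; rewrite /has_mean (_ : (fun n => _) = (fun n => c * mean n F)).
  by apply: cvgM; [exact: cvg_cst|exact: hF].
apply/funext => n; have := mean_lin n c bF (bcont_cst G 0).
by under eq_fun do rewrite addr0; rewrite mean_cst addr0.
Qed.
Lemma has_mean_conj F l : bcont F -> has_mean F l -> has_mean (fun t => (F t)^*) l^*.
Proof.
move=> bF hF; rewrite /has_mean (_ : (fun n => _) = (fun n => (mean n F)^*)).
  exact: (@cvg_conjC R nat \oo eventually_filter _ _ hF).
by apply/funext => n; rewrite /mean -integralC_conj//; exact: bcont_L1.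
Qed.
Lemma has_mean_translate s F l : bcont F -> has_mean F l ->
  has_mean (fun t => F (t + s)) l.
Proof.
move=> bF hF; rewrite /has_mean -[l]add0r.
rewrite (_ : (fun n => _) = fun n => (mean n (fun t => F (t + s)) - mean n F) + mean n F).
  by apply: cvgD; [exact: (asymp s bF)|exact: hF].
by apply/funext => n; rewrite subrK.
Qed.

(** Translation by s multiplies the mean by chi s, which differs from one for
    some s, and asymptotically preserves it. *)
Lemma char_mean chi : is_character chi -> chi <> (fun=> 1) -> has_mean chi 0.
Proof.
move=> hc nc; have [s ns] : exists s, chi s <> 1.
  by apply/existsNP => h; apply: nc; apply/funext.
have n0 : chi s - 1 != 0 by rewrite subr_eq0; apply/eqP.
have h := asymp s (char_bcont hc).
have h2 : (chi s - 1)^-1 * (integralC (p n) setT (fun t : GB => chi ((t : G) + s)) -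
    integralC (p n) setT (chi : GB -> C)) @[n --> \oo] --> (0 : C).
  have := @cvgM _ _ _ _ _ _ _ _ (@cvg_cst _ ((chi s - 1)^-1 : C) _ \oo _) h.
  by rewrite mulr0; exact.
suff E : (fun n => mean n chi) = (fun n => (chi s - 1)^-1 *
    (integralC (p n) setT (fun t : GB => chi ((t : G) + s)) -
     integralC (p n) setT (chi : GB -> C))) by rewrite /has_mean E; exact: h2.
apply/funext => n.
have -> : integralC (p n) setT (fun t : GB => chi ((t : G) + s)) = chi s * mean n chi.
  rewrite /mean -integralCZ; last exact: (bcont_L1 (p n) (char_bcont hc)).
  by congr integralC; apply/funext => t; case: hc => _ -> _; rewrite mulrC.
have -> : chi s * mean n chi - integralC (p n) setT (chi : GB -> C) =
    (chi s - 1) * mean n chi by rewrite mulrBl mul1r.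
by rewrite mulrA mulVf// mul1r.
Qed.

Lemma char_orth chi psi : is_character chi -> is_character psi -> chi <> psi ->
  has_mean (fun t => chi t * (psi t)^*) 0.
Proof.
move=> hc hp ne; apply: char_mean; first by apply: char_mul => //; exact: char_conj.
move=> h; apply: ne; apply/funext => t; have := congr1 (fun f => f t * psi t) h.
by rewrite -mulrA char_conjM// mulr1 mul1r.
Qed.

Lemma trig_has_mean P : trig_poly P -> exists l, has_mean P l.
Proof.
move=> tP; suff : bcont P /\ exists l, has_mean P l by case.
apply: (@trig_ind R G (fun P => bcont P /\ exists l, has_mean P l)) tP.
- by split; [exact: bcont_cst|exists 0; exact: has_mean_cst].
- move=> F H [bF [l hl]] [bH [l' hl']]; split; first exact: bcontD.
  by exists (l + l'); exact: has_meanD.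
move=> a chi hc; have bc := char_bcont hc; split; first exact: bcontZ.
have [->|nc] := pselect (chi = fun=> 1).
  by exists (a * 1); apply: has_meanZ; [exact: bcont_cst|exact: has_mean_cst].
by exists (a * 0); apply: has_meanZ => //; exact: char_mean.
Qed.

(** Besicovitch almost periodicity of bounded continuous functions; the upper
    limit of the averages is bounded by eventual inequalities. *)
Definition bap F := bcont F /\ forall e : R, 0 < e ->
  exists2 P, trig_poly P & \forall n \near \oo, nrm1 (p n) (fun t => F t - P t) < e.

(** Trigonometric polynomials may be replaced by Bohr almost periodic
    functions, which unlike them are stable under lattice operations. *)
Lemma bap_bohr F : bcont F -> (forall e : R, 0 < e ->
  exists2 Q, bohr Q & \forall n \near \oo, nrm1 (p n) (fun t => F t - Q t) < e) -> bap F.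
Proof.
move=> bF h; split=> // e e0; have e20 : 0 < e / 2 by rewrite divr_gt0.
have e40 : 0 < e / 2 / 2 by rewrite divr_gt0.
have [Q [bQ hQ] FQ] := h _ e20; have [P tP QP] := hQ _ e40; exists P => //.
have bP := trig_bcont tP; apply: filterS FQ => n hn.
rewrite (_ : (fun t => _) = fun t => (F t - Q t) + (Q t - P t)); last first.
  by apply/funext => t; rewrite subrKA.
apply: le_lt_trans (nrm1D _ (bcontB bF bQ) (bcontB bQ bP)) _.
rewrite [e]splitr ltr_leD//; apply: nrm1_sup; first exact: bcontB.
by move=> t; apply: le_trans (QP t) _; rewrite ler_pdivrMr// ler_peMr ?ler1n// ltW.
Qed.

Lemma bap_trig P : trig_poly P -> bap P.
Proof.
move=> tP; split; first exact: trig_bcont.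
move=> e e0; exists P => //; apply: nearW => n.
by rewrite (_ : (fun t => _) = fun=> 0) ?nrm1_cst ?absC0//; apply/funext => t; rewrite subrr.
Qed.

Lemma bap_lim F : bcont F -> (forall e : R, 0 < e ->
  exists2 H, bap H & forall t, absC (F t - H t) <= e) -> bap F.
Proof.
move=> bF h; split=> // e e0; have e20 : 0 < e / 2 by rewrite divr_gt0.
have [H [bH hH] FH] := h _ e20; have [P tP HP] := hH _ e20; exists P => //.
have bP := trig_bcont tP; apply: filterS HP => n hn.
rewrite (_ : (fun t => _) = fun t => (F t - H t) + (H t - P t)); last first.
  by apply/funext => t; rewrite subrKA.
apply: le_lt_trans (nrm1D _ (bcontB bF bH) (bcontB bH bP)) _.
by rewrite [e]splitr ler_ltD//; apply: nrm1_sup => //; exact: bcontB.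
Qed.

Lemma bapD F H : bap F -> bap H -> bap (fun t => F t + H t).
Proof.
move=> [bF hF] [bH hH]; split; first exact: bcontD.
move=> e e0; have e20 : 0 < e / 2 by rewrite divr_gt0.
have [P tP FP] := hF _ e20; have [Q tQ HQ] := hH _ e20.
have bP := trig_bcont tP; have bQ := trig_bcont tQ.
exists (fun t => P t + Q t); first exact: trigD.
apply: filterS2 FP HQ => n h1 h2.
rewrite (_ : (fun t => _) = fun t => (F t - P t) + (H t - Q t)); last first.
  by apply/funext => t; rewrite opprD addrACA.
by apply: le_lt_trans (nrm1D _ (bcontB bF bP) (bcontB bH bQ)) _; rewrite [e]splitr ltrD.
Qed.

Lemma bap_trigM P F : trig_poly P -> bap F -> bap (fun t => P t * F t).
Proof.
move=> tP [bF hF]; have bP := trig_bcont tP; split; first exact: bcontM.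
move=> e e0; have [_ [M PM]] := bP.
have M1 : 0 < `|M| + 1 by rewrite ltr_wpDl.
have [Q tQ FQ] := hF _ (divr_gt0 e0 M1); have bQ := trig_bcont tQ.
exists (fun t => P t * Q t); first exact: trigM.
apply: filterS FQ => n h.
apply: (@le_lt_trans _ _ ((`|M| + 1) * nrm1 (p n) (fun t => F t - Q t))); last first.
  by rewrite mulrC -ltr_pdivlMr.
rewrite -[X in X * _](gtr0_norm M1) -absC_ofR -nrm1Z; last exact: bcontB.
apply: nrm1_le; [|by apply: bcontZ; exact: bcontB|].
  by apply: bcontB; exact: bcontM.
move=> t; rewrite -mulrBr !absCM ler_wpM2r ?absC_ge0// absC_ofR gtr0_norm//.
by apply: le_trans (PM t) _; rewrite (le_trans (ler_norm _))// lerDl.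
Qed.

Lemma bapZ c F : bap F -> bap (fun t => c * F t).
Proof. by move=> bF; apply: bap_trigM => //; exact: trig_cst. Qed.

Lemma bap_re F : bap F -> bap (fun t => ofR (reC (F t))).
Proof.
move=> [bF hF]; apply: bap_bohr; first exact: bcont_re.
move=> e /hF[P tP FP]; exists (fun t => ofR (reC (P t))).
  by apply: bohr_re; exact: bohr_trig.
have bP := trig_bcont tP; apply: filterS FP => n; apply: le_lt_trans.
apply: nrm1_le; [|exact: bcontB|].
  by apply: bcontB; exact: bcont_re.
by move=> t; rewrite -ofRN -ofRD absC_ofR -reCB ler_reC.
Qed.

(** If P approximates the real function u in the mean, so does its real part,
    and the absolute value of the latter approximates that of u. *)
Lemma bap_abs (u : G -> R) : bap (fun t => ofR (u t)) -> bap (fun t => ofR `|u t|).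
Proof.
move=> [bu hu].
have bau : bcont (fun t => ofR `|u t|).
  by have := bcont_abs bu; under eq_fun do rewrite absC_ofR.
apply: bap_bohr => // e /hu[P tP uP].
have hP := bohr_re (bohr_trig tP).
exists (fun t => ofR `|reC (P t)|); first exact: bohr_abs.
have bP := trig_bcont tP; apply: filterS uP => n; apply: le_lt_trans.
apply: nrm1_le; [|exact: bcontB|].
  by apply: bcontB => //; exact: (bohr_abs hP).1.
move=> t; rewrite -ofRN -ofRD absC_ofR; apply: le_trans (ler_dist_dist _ _) _.
by rewrite -[u t](reC_ofR) -reCB ler_reC.
Qed.

(** The averages of F are, up to e, eventually those of a trigonometric
    polynomial; therefore they form a Cauchy sequence. *)
Lemma bap_has_mean F : bap F -> exists l, has_mean F l.
Proof.
move=> [bF hF].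
have key (e : R) : 0 < e -> exists l : C, \forall n \near \oo, absC (mean n F - l) < e.
  move=> e0; have e20 : 0 < e / 2 by rewrite divr_gt0.
  have [P tP FP] := hF _ e20; have [l /has_meanP/(_ _ e20) hl] := trig_has_mean tP.
  have bP := trig_bcont tP.
  exists l; apply: filterS2 FP hl => n h1 h2.
  rewrite (le_lt_trans (absC_dist _ (mean n P) _))// [e]splitr ltrD//.
  apply: le_lt_trans h1; rewrite /mean -integralCB; [|exact: bcont_L1|exact: bcont_L1].
  by apply: mean_le_nrm1; exact: bcontB.
have cvgre (f : C -> R) : (forall z w, `|f z - f w| <= absC (z - w)) ->
    cvg (f (mean n F) @[n --> \oo]).
  move=> hf; apply/cauchy_cvgP; apply: cauchy_exP => e e0.
  have [l hl] := key _ e0; exists (f l); apply: filterS hl => n hn.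
  by rewrite /ball /= distrC (le_lt_trans (hf _ _)).
have hr : cvg (reC (mean n F) @[n --> \oo]).
  by apply: (cvgre (@reC R)) => z w; rewrite -reCB ler_reC.
have hi : cvg (imC (mean n F) @[n --> \oo]).
  by apply: (cvgre (@imC R)) => z w; rewrite -imCB ler_imC.
exists (ofR (lim (reC (mean n F) @[n --> \oo])) +
  'i * ofR (lim (imC (mean n F) @[n --> \oo]))).
apply: cvg_reimC.
  by rewrite !CE mul0r mul1r subrr addr0.
by rewrite !CE mul0r mul1r !add0r.
Qed.

Lemma bap_char_mean chi F : is_character chi -> bap F ->
  exists l, has_mean (fun t => F t * (chi t)^*) l.
Proof.
move=> hc bF; have := bap_has_mean (bap_trigM (trig_conj (trig_char hc)) bF).
by case=> l hl; exists l; under eq_fun do rewrite mulrC.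
Qed.

(** The seminorm limsup_n of the L2 norms with respect to p n is at most r. *)
Definition bnle F (r : R) := forall e : R, 0 < e ->
  \forall n \near \oo, nrm (p n) (F : GB -> C) < r + e.

Lemma bnle_mono F r r' : r <= r' -> bnle F r -> bnle F r'.
Proof.
move=> rr h e /h; apply: filterS => n hn; apply: lt_le_trans hn _.
by rewrite lerD2r.
Qed.
Lemma bnleD F H r r' : bcont F -> bcont H -> bnle F r -> bnle H r' ->
  bnle (fun t => F t + H t) (r + r').
Proof.
move=> bF bH hF hH e e0; have e20 : 0 < e / 2 by rewrite divr_gt0.
apply: filterS2 (hF _ e20) (hH _ e20) => n h1 h2.
apply: le_lt_trans (nrmD (bcont_L2 (p n) bF) (bcont_L2 (p n) bH)) _.
by have := ltrD h1 h2; lra.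
Qed.
Lemma bnleZ c F r : bcont F -> 0 <= r -> bnle F r -> bnle (fun t => c * F t) (absC c * r).
Proof.
move=> bF r0 hF e e0; have c1 : 0 < absC c + 1 by rewrite ltr_wpDl ?absC_ge0.
apply: filterS (hF _ (divr_gt0 e0 c1)) => n h.
rewrite nrmZ; last exact: (bcont_L2 (p n) bF).
apply: (@le_lt_trans _ _ (absC c * (r + e / (absC c + 1)))).
  by rewrite ler_wpM2l ?absC_ge0// ltW.
rewrite mulrDr ltrD2l mulrCA gtr_pMr// ltr_pdivrMr// mul1r ltrDl//.
Qed.
Lemma bnle_sup F r : bcont F -> (forall t, absC (F t) <= r) -> bnle F r.
Proof.
move=> bF Fr e e0; apply: nearW => n; rewrite (@le_lt_trans _ _ r) ?ltrDl//.
apply: nrm_le => //; first exact: le_trans (absC_ge0 _) (Fr 0).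
exact: (bcont_L2 (p n) bF).
Qed.
Lemma bnle_lim F l r : nrm (p n) (F : GB -> C) @[n --> \oo] --> l -> bnle F r -> l <= r.
Proof.
move=> Fl hr; apply/ler_addgt0Pr => e e0.
have hA : closed [set y : R | y <= r + e] by exact: closed_le.
have hn : \forall n \near \oo, nrm (p n) (F : GB -> C) <= r + e.
  by apply: filterS (hr e e0) => n /ltW.
exact: (closed_cvg _ hA hn _ Fl).
Qed.

Lemma mean_sqnorm n F : bcont F ->
  mean n (fun t => F t * (F t)^*) = ofR (sqnorm (p n) (F : GB -> C)).
Proof. by move=> bF; rewrite -innerL2_self//; exact: (bcont_L2 (p n) bF). Qed.

Lemma bnle_translate s F r : 0 <= r -> bcont F -> bnle F r -> bnle (fun t => F (t + s)) r.
Proof.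
move=> r0 bF hF e e0; have e20 : 0 < e / 2 by rewrite divr_gt0.
have bFF : bcont (fun t => F t * (F t)^*) by apply: bcontM => //; exact: bcont_conj.
have h := (@cvgC_abs R nat \oo eventually_filter _ _).1 (asymp s bFF) _ (exprn_gt0 2 e20).
apply: filterS2 (hF _ e20) h => n h1 /=.
have E1 := mean_sqnorm n bF; have E2 := mean_sqnorm n (bcont_translateG s bF).
rewrite /mean in E1 E2; rewrite subr0 E1 E2 -ofRN -ofRD absC_ofR => h2.
rewrite -(@ltr_pXn2r _ 2)// ?nnegrE ?nrm_ge0 ?addr_ge0 ?(ltW e0)// nrm_sq.
have h3 : sqnorm (p n) (F : GB -> C) < (r + e / 2) ^+ 2.
  by rewrite -nrm_sq ltr_pXn2r// ?nnegrE ?nrm_ge0 ?addr_ge0 ?(ltW e20).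
move: h2; rewrite ltr_norml => /andP[_ h2].
have re : 0 <= r * (e / 2) by rewrite mulr_ge0// ltW.
nra.
Qed.

Lemma bnle_sum k (F : 'I_k -> G -> C) r : (forall i, bcont (F i)) ->
  (forall i, bnle (F i) r) -> bnle (fun t => \sum_(i < k) F i t) (k%:R * r).
Proof.
elim: k F => [|k IH] F bF hF.
  rewrite mul0r; under eq_fun do rewrite big_ord0; apply: bnle_sup.
    exact: bcont_cst.
  by move=> t; rewrite absC0.
under eq_fun do rewrite big_ord_recl; rewrite -natr1 mulrDl mul1r addrC.
apply: bnleD => //; first by apply: bcont_sum.
by apply: IH.
Qed.

(** Approximation in the mean improves to approximation in the quadratic mean.
    The approximating polynomial is first truncated to the range of F, which
    brings it closer to F and makes the difference bounded; the truncation is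
    Bohr almost periodic, hence a uniform limit of polynomials. *)
Lemma bap_bnle F e : bap F -> 0 < e ->
  exists2 P, trig_poly P & bnle (fun t => F t - P t) e.
Proof.
move=> [bF hF] e0; have e20 : 0 < e / 2 by rewrite divr_gt0.
have [_ [M FM]] := bF; pose c := `|M|; have c0 : 0 <= c by exact: normr_ge0.
have Fc t : absC (F t) <= c by rewrite (le_trans (FM t))// ler_norm.
have K0 : 0 < 4 * c * 2 + 1 by rewrite ltr_wpDl// !mulr_ge0.
have [P1 tP1 FP1] := hF _ (divr_gt0 (exprn_gt0 2 e20) K0).
have bP1 := trig_bcont tP1.
(* real and imaginary parts are truncated separately, whence the factor 2 in FQ1 *)
pose Q t := ofR (clamp c (reC (P1 t))) + 'i * ofR (clamp c (imC (P1 t))).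
have hQ : bohr Q.
  apply: bohrD; last apply: bohrZ; apply: bohr_clamp.
    by apply: bohr_re; exact: bohr_trig.
  by apply: bohr_im; exact: bohr_trig.
have [bQ /(_ _ e20)[P tP QP]] := hQ; exists P => //.
have bP := trig_bcont tP.
have FQ1 t : absC (F t - Q t) <= absC (2 * (F t - P1 t)).
  rewrite absCM (_ : absC 2 = 2); last by rewrite (_ : 2 = ofR 2) ?absC_ofR ?ger0_norm//;
    apply: Cx_ext; rewrite // -[2 : C]/(1 + 1) !CE; lra.
  rewrite (le_trans (absC_le _))// !(reCB, imCB).
  have -> : reC (Q t) = clamp c (reC (P1 t)) by rewrite !CE; ring.
  have -> : imC (Q t) = clamp c (imC (P1 t)) by rewrite !CE; ring.
  rewrite mulr_natl mulr2n; apply: lerD.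
    apply: le_trans (clamp_dist _ _) _; first exact: le_trans (ler_reC _) (Fc t).
    by rewrite -reCB ler_reC.
  apply: le_trans (clamp_dist _ _) _; first exact: le_trans (ler_imC _) (Fc t).
  by rewrite -imCB ler_imC.
have FQ2 t : absC (F t - Q t) <= 4 * c.
  rewrite (le_trans (absCD _ _))// absCN.
  have : absC (Q t) <= c + c.
    rewrite (le_trans (absC_le _))//.
    have -> : reC (Q t) = clamp c (reC (P1 t)) by rewrite !CE; ring.
    have -> : imC (Q t) = clamp c (imC (P1 t)) by rewrite !CE; ring.
    by rewrite lerD ?clamp_le.
  by have := Fc t; lra.
have bFQ := bcontB bF bQ.
have hFQ : bnle (fun t => F t - Q t) (e / 2).
  move=> d d0; apply: filterS FP1 => n h.
  apply: (@le_lt_trans _ _ (e / 2)); last by rewrite ltrDl.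
  rewrite -(@ler_pXn2r _ 2)// ?nnegrE ?nrm_ge0 ?(ltW e20)// nrm_sq.
  apply: le_trans (sqnorm_le_nrm1 (p n) bFQ _ FQ2 FQ1) _; first by apply: bcontZ; exact: bcontB.
  rewrite nrm1Z; last exact: bcontB.
  rewrite (_ : absC 2 = 2); last by rewrite (_ : 2 = ofR 2) ?absC_ofR ?ger0_norm//;
    apply: Cx_ext; rewrite // -[2 : C]/(1 + 1) !CE; lra.
  rewrite mulrA; apply: (@le_trans _ _ ((4 * c * 2 + 1) * nrm1 (p n) (fun t => F t - P1 t))).
    by rewrite ler_wpM2r ?nrm1_ge0// lerDl.
  by rewrite -ler_pdivlMl// mulrC ltW.
rewrite (_ : (fun t => _) = fun t => (F t - Q t) + (Q t - P t)); last first.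
  by apply/funext => t; rewrite subrKA.
rewrite [e]splitr; apply: bnleD => //; first exact: bcontB.
by apply: bnle_sup => //; exact: bcontB.
Qed.

Lemma has_mean_sum k (F : 'I_k -> G -> C) (l : 'I_k -> C) : (forall i, bcont (F i)) ->
  (forall i, has_mean (F i) (l i)) ->
  has_mean (fun t => \sum_(i < k) F i t) (\sum_(i < k) l i).
Proof.
elim: k F l => [|k IH] F l bF hF.
  by under eq_fun do rewrite big_ord0; rewrite big_ord0; exact: has_mean_cst.
under eq_fun do rewrite big_ord_recl; rewrite big_ord_recl; apply: has_meanD => //.
  exact: bcont_sum.
exact: IH.
Qed.

Lemma mean_bnle D K M l r : bcont D -> bcont K -> (forall t, absC (K t) <= M) ->
  bnle D r -> has_mean (fun t => D t * (K t)^*) l -> absC l <= M * r.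
Proof.
move=> bD bK KM hD hl; have M0 : 0 <= M := le_trans (absC_ge0 _) (KM 0).
apply/ler_addgt0Pr => e e0.
have M1 : 0 < M + 1 by rewrite ltr_wpDl.
have e20 : 0 < e / 2 by rewrite divr_gt0.
have bcc := bcont_conj bK.
have /has_meanP/(_ _ e20) h := hl.
have [n [h1 h2]] := @filter_ex _ \oo _ _ (filterI (hD _ (divr_gt0 e20 M1)) h).
rewrite -[l](subrK (mean n (fun t => D t * (K t)^*))).
rewrite (le_trans (absCD _ _))// absCB.
have h3 : absC (mean n (fun t => D t * (K t)^*)) <= M * (r + e / 2 / (M + 1)).
  apply: le_trans (mean_le_nrm1 (p n) (bcontM bD bcc)) _.
  apply: (@le_trans _ _ (M * nrm1 (p n) D)).
    rewrite -[X in X * _](ger0_norm M0) -absC_ofR -(nrm1Z _ _ bD).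
    apply: nrm1_le; [exact: (bcontM bD bcc)|exact: (bcontZ _ bD)|].
    by move=> t; rewrite !absCM absC_conj absC_ofR ger0_norm// mulrC ler_wpM2r ?absC_ge0.
  by rewrite ler_wpM2l//; apply: le_trans (ltW h1); exact: nrm1_le_nrm.
have h4 : M * (e / 2 / (M + 1)) <= e / 2.
  by rewrite mulrCA ger_pMr// ler_pdivrMr// mul1r lerDl.
by have := lerD (ltW h2) h3; rewrite mulrDr; lra.
Qed.

(** * Isolating one frequency *)

Section kill_frequencies.
Variable chi : G -> C.
Hypothesis hchi : is_character chi.

(** The Cesaro average of the translates of F along the multiples of s, weighted
    so that the frequency chi is left unchanged. *)
Definition twisted_avg (s : G) (N : nat) F : G -> C := fun t =>
  ofR N%:R^-1 * \sum_(k < N) (chi (s *+ k))^* * F (t + s *+ k).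

Lemma twisted_avg_lin s N c F H t :
  twisted_avg s N (fun t => c * F t + H t) t =
  c * twisted_avg s N F t + twisted_avg s N H t.
Proof.
rewrite /twisted_avg mulrCA -mulrDr; congr (_ * _).
rewrite mulr_sumr -big_split /=; apply: eq_bigr => k _; ring.
Qed.

Lemma twisted_avg_sum s N n (a : 'I_n -> C) (F : 'I_n -> G -> C) t :
  twisted_avg s N (fun t => \sum_(i < n) a i * F i t) t =
  \sum_(i < n) a i * twisted_avg s N (F i) t.
Proof.
elim: n a F => [|n IH] a F.
  rewrite big_ord0 /twisted_avg big1 ?mulr0// => k _.
  by rewrite big_ord0 mulr0.
rewrite big_ord_recl -IH -twisted_avg_lin /twisted_avg; congr (_ * _).
by apply: eq_bigr => k _; rewrite big_ord_recl.
Qed.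

Lemma bcont_twisted_avg s N F : bcont F -> bcont (twisted_avg s N F).
Proof.
move=> bF; apply: bcontZ; apply: bcont_sum => k; apply: bcontZ.
exact: bcont_translateG.
Qed.

Lemma bnle_twisted_avg s N F r : (0 < N)%N -> 0 <= r -> bcont F -> bnle F r ->
  bnle (twisted_avg s N F) r.
Proof.
move=> N0 r0 bF hF; have NR : 0 < N%:R :> R by rewrite ltr0n.
have b1 (k : 'I_N) : bcont (fun t => (chi (s *+ k))^* * F (t + s *+ k)).
  by apply: bcontZ; exact: bcont_translateG.
have -> : r = absC (ofR N%:R^-1) * (N%:R * r).
  by rewrite absC_ofR gtr0_norm ?invr_gt0// mulrA mulVf ?mul1r// gt_eqF.
apply: bnleZ; first exact: bcont_sum.
  by rewrite mulr_ge0// ltW.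
apply: bnle_sum => // k.
rewrite -[r]mul1r -(char_abs (s *+ k) hchi) -absC_conj.
apply: bnleZ => //; first exact: bcont_translateG.
exact: bnle_translate.
Qed.

Lemma twisted_avg_char s N psi t : is_character psi ->
  twisted_avg s N psi t =
  ofR N%:R^-1 * (\sum_(k < N) ((chi s)^* * psi s) ^+ k) * psi t.
Proof.
move=> hp; rewrite /twisted_avg -mulrA mulr_suml; congr (_ * _).
apply: eq_bigr => k _; case: (hp) => _ -> _; rewrite !charMn// exprMn.
by rewrite rmorphXn; ring.
Qed.

Lemma twisted_avg_self s N t : (0 < N)%N -> twisted_avg s N chi t = chi t.
Proof.
move=> N0; rewrite twisted_avg_char// (eq_bigr (fun=> 1)); last first.
  by move=> k _; rewrite char_conjM// expr1n.
rewrite sumr_const card_ord (_ : 1 *+ N = ofR N%:R :> C); last first.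
  by elim: N {N0} => // N IH; rewrite mulrS IH -natr1 ofRD addrC.
by rewrite -ofRM mulVf ?mul1r// pnatr_eq0 -lt0n.
Qed.

(** A geometric sum whose ratio has modulus one and differs from one is
    bounded. *)
Lemma twisted_avg_decay s psi (e : R) : is_character psi -> psi s <> chi s -> 0 < e ->
  exists2 N, (0 < N)%N &
    absC (ofR N%:R^-1 * (\sum_(k < N) ((chi s)^* * psi s) ^+ k)) <= e.
Proof.
move=> hp ne e0; set z := (chi s)^* * psi s.
have z1 : absC (z - 1) != 0.
  rewrite absC_eq0 subr_eq0; apply/eqP => h; apply: ne.
  have := congr1 (fun x => chi s * x) h.
  by rewrite /z mulrA mulr_conj (char_abs s hchi) expr1n mul1r mulr1.
have zp : 0 < absC (z - 1) by rewrite lt_def z1 absC_ge0.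
have za : absC z = 1 by rewrite absCM absC_conj (char_abs s hchi) (char_abs s hp) mulr1.
pose N := (Num.truncn (2 / (e * absC (z - 1)))).+1.
have hN : 2 / (e * absC (z - 1)) <= N%:R by apply/ltW/truncnS_gt.
exists N => //; have NR : 0 < N%:R :> R by rewrite ltr0n.
have S2 : absC (z - 1) * absC (\sum_(k < N) z ^+ k) <= 2.
  rewrite -absCM -subrX1 (le_trans (absCD _ _))// absCN absC1 absCX za expr1n.
  lra.
rewrite absCM absC_ofR gtr0_norm ?invr_gt0// ler_pdivrMl//.
rewrite -(ler_pM2l zp) (le_trans S2)// mulrA [_ * e]mulrC.
move: hN; rewrite ler_pdivrMr ?mulr_gt0// => /le_trans; apply.
by rewrite le_eqVlt; apply/orP; left; apply/eqP; ring.
Qed.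

Variable A : set (G -> C).
Hypothesis Ab : forall F, A F -> bcont F.
Hypothesis A0 : A (fun=> 0).
Hypothesis Alin : forall c F H, A F -> A H -> A (fun t => c * F t + H t).
Hypothesis Atrans : forall s F, A F -> A (fun t => F (t + s)).

Let A_twisted_avg s N F : A F -> A (twisted_avg s N F).
Proof.
move=> AF; have AZ c H : A H -> A (fun t => c * H t).
  by move=> AH; have := Alin c AH A0; under eq_fun do rewrite addr0.
apply: AZ; elim: N => [|N IH]; first by under eq_fun do rewrite big_ord0.
rewrite (_ : (fun t => _) = fun t => (chi (s *+ N))^* * F (t + s *+ N) +
    \sum_(k < N) (chi (s *+ k))^* * F (t + s *+ k)).
  exact: (Alin _ (Atrans (s *+ N) AF) IH).
by apply/funext => t; rewrite big_ord_recr /= [LHS]addrC.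
Qed.

(** The other frequencies are removed one at a time. For the first of them
    choose s where it differs from chi; the twisted average along s keeps chi,
    does not increase the seminorm, multiplies every other coefficient by a
    constant, and makes the chosen coefficient negligible. *)
Lemma kill_frequencies n (a : 'I_n -> C) (psi : 'I_n -> G -> C) F r e :
  0 <= r -> 0 < e -> A F -> (forall i, is_character (psi i)) ->
  (forall i, psi i <> chi \/ a i = 0) ->
  bnle (fun t => F t - chi t - \sum_(i < n) a i * psi i t) r ->
  exists2 H, A H & bnle (fun t => H t - chi t) (r + e).
Proof.
elim: n a psi F r e => [|n IH] a psi F r e r0 e0 AF hp hne hF.
  exists F => //; apply: (@bnle_mono _ r); first by rewrite lerDl ltW.
  by move: hF; under eq_fun do rewrite big_ord0 subr0.
have [ne|a0] := hne ord0; last first.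
  apply: (IH (fun i => a (lift ord0 i)) (fun i => psi (lift ord0 i)) F r e r0 e0 AF
    (fun i => hp (lift ord0 i)) (fun i => hne (lift ord0 i))).
  by move: hF; under eq_fun do rewrite big_ord_recl a0 mul0r add0r.
have e20 : 0 < e / 2 by rewrite divr_gt0.
have [s ns] : exists s, psi ord0 s <> chi s.
  by apply/existsNP => h; apply: ne; apply/funext.
have a1 : 0 < absC (a ord0) + 1 by rewrite ltr_wpDl ?absC_ge0.
have [N N0 hN] := twisted_avg_decay (hp ord0) ns (divr_gt0 e20 a1).
(* lam i is the factor by which the average multiplies the frequency psi i *)
pose lam i : C := ofR N%:R^-1 * (\sum_(k < N) ((chi s)^* * psi i s) ^+ k).
have bchi := char_bcont hchi.
pose D t := F t - chi t - \sum_(i < n.+1) a i * psi i t.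
have bS : bcont (fun t => \sum_(i < n.+1) a i * psi i t).
  by apply: bcont_sum => i; apply: bcontZ; exact: char_bcont.
have bD : bcont D by apply: bcontB => //; apply: bcontB => //; exact: Ab.
have E t : twisted_avg s N F t - chi t -
    \sum_(i < n) (a (lift ord0 i) * lam (lift ord0 i)) * psi (lift ord0 i) t =
    twisted_avg s N D t + (a ord0 * lam ord0) * psi ord0 t.
  have -> : twisted_avg s N D t = twisted_avg s N F t - chi t -
      \sum_(i < n.+1) a i * (lam i * psi i t).
    have -> : D = fun t => (-1) * (\sum_(i < n.+1) a i * psi i t) +
        (fun t => (-1) * chi t + F t) t.
      by apply/funext => u; rewrite /D; ring.
    rewrite twisted_avg_lin twisted_avg_lin twisted_avg_self// twisted_avg_sum.
    rewrite (eq_bigr (fun i => a i * (lam i * psi i t))); first by ring.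
    by move=> i _; rewrite twisted_avg_char.
  rewrite big_ord_recl (eq_bigr (fun i => a (lift ord0 i) * (lam (lift ord0 i) *
    psi (lift ord0 i) t))); first by ring.
  by move=> i _; rewrite mulrA.
have h : bnle (fun t => twisted_avg s N F t - chi t -
    \sum_(i < n) (a (lift ord0 i) * lam (lift ord0 i)) * psi (lift ord0 i) t) (r + e / 2).
  under eq_fun do rewrite E; apply: bnleD.
  - exact: bcont_twisted_avg.
  - by apply: bcontZ; exact: char_bcont.
  - exact: bnle_twisted_avg.
  apply: bnle_sup; first by apply: bcontZ; exact: char_bcont.
  move=> t; rewrite 2!absCM (char_abs t (hp ord0)) mulr1.
  apply: (@le_trans _ _ ((absC (a ord0) + 1) * (e / 2 / (absC (a ord0) + 1)))).
    by apply: ler_pM; [exact: absC_ge0|exact: absC_ge0|rewrite lerDl|exact: hN].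
  by rewrite mulrCA divff ?mulr1// gt_eqF.
have [|||H AH hH] := IH _ _ _ _ _ _ e20 (A_twisted_avg s N AF) _ _ h.
- by rewrite addr_ge0// ltW.
- by move=> i; exact: hp.
- by move=> i; have [?|->] := hne (lift ord0 i); [left|right; rewrite mul0r].
by exists H => //; move: hH; rewrite -addrA -splitr.
Qed.

(** If F0 has a nonzero Fourier-Bohr coefficient at chi, normalise it to one and
    approximate F0 by a polynomial. The coefficient of that polynomial at chi
    is close to one, and its other frequencies can be removed by operations
    under which A is stable. *)
Lemma approx_char F0 c e : A F0 -> bap F0 -> has_mean (fun t => F0 t * (chi t)^*) c ->
  c != 0 -> 0 < e -> exists2 H, A H & bnle (fun t => H t - chi t) e.
Proof.
move=> AF0 bF0 hc c0 e0; pose dl := e / 4; have d0 : 0 < dl by rewrite divr_gt0.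
pose F t := c^-1 * F0 t.
have AF : A F by have := Alin c^-1 AF0 A0; under eq_fun do rewrite addr0.
have bF : bap F by exact: bapZ.
have bchi := char_bcont hchi.
have mF : has_mean (fun t => F t * (chi t)^*) 1.
  have h := @has_meanZ c^-1 _ _ (bcontM bF0.1 (bcont_conj bchi)) hc.
  rewrite (mulVf c0) in h; rewrite (_ : (fun t => _) =
    fun t => c^-1 * (F0 t * (chi t)^*)); first exact: h.
  by apply/funext => t; rewrite mulrA.
have [_ [n [a [psi [hp ->]]]] hP] := bap_bnle bF d0.
(* the psi i need not be distinct: b is the total coefficient of chi *)
pose b := \sum_(i < n) a i * (`[< psi i = chi >])%:R.
have bS : bcont (fun t => \sum_(i < n) a i * psi i t).
  by apply: bcont_sum => i; apply: bcontZ; exact: char_bcont.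
have mP : has_mean (fun t => (\sum_(i < n) a i * psi i t) * (chi t)^*) b.
  under eq_fun do rewrite mulr_suml; apply: has_mean_sum => i.
    apply: bcontM; last exact: bcont_conj.
    by apply: bcontZ; exact: char_bcont.
  under eq_fun do rewrite -mulrA; apply: has_meanZ.
    by apply: bcontM; [exact: char_bcont|exact: bcont_conj].
  case: asboolP => [->|ne]; last exact: char_orth.
  rewrite (_ : (fun t => _) = fun=> 1); first exact: has_mean_cst.
  by apply/funext => t; rewrite mulrC char_conjM.
have b1 : absC (1 - b) <= dl.
  rewrite -[dl]mul1r; apply: (mean_bnle (bcontB bF.1 bS) bchi _ hP).
    by move=> t; rewrite (char_abs t hchi).
  have bFc : bcont (fun t => F t * (chi t)^*).
    exact: (bcontM bF.1 (bcont_conj bchi)).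
  have bPc : bcont (fun t => (\sum_(i < n) a i * psi i t) * (chi t)^*).
    exact: (bcontM bS (bcont_conj bchi)).
  have := has_meanD (bcontZ (-1) bPc) bFc (@has_meanZ (-1) _ _ bPc mP) mF.
  rewrite mulN1r addrC; congr has_mean; apply/funext => t; ring.
pose a' i := if `[< psi i = chi >] then 0 else a i.
have [||||||H AH hH] := @kill_frequencies n a' psi F (dl + dl) dl.
- by rewrite addr_ge0// ltW.
- exact: d0.
- exact: AF.
- exact: hp.
- by move=> i; rewrite /a'; case: asboolP => [_|ne]; [right|left].
- have -> : (fun t => F t - chi t - \sum_(i < n) a' i * psi i t) =
      fun t => (F t - \sum_(i < n) a i * psi i t) + (b - 1) * chi t.
    apply/funext => t; have -> : \sum_(i < n) a i * psi i t =
        b * chi t + \sum_(i < n) a' i * psi i t; last by ring.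
    rewrite /b mulr_suml -big_split /=; apply: eq_bigr => i _; rewrite /a'.
    by case: asboolP => [->|_]; rewrite ?mulr1 ?mulr0 mul0r ?addr0 ?add0r.
  apply: (bnleD (bcontB bF.1 bS) (bcontZ _ bchi) hP).
  apply: bnle_sup; first exact: (bcontZ _ bchi).
  by move=> t; rewrite absCM (char_abs t hchi) mulr1 absCB.
exists H => //; apply: bnle_mono hH; rewrite /dl; lra.
Qed.

End kill_frequencies.

(** The part of an approximating polynomial which carries the frequencies where
    the Fourier-Bohr coefficients of F vanish is orthogonal, in the mean, to the
    rest of the difference; dropping it does not worsen the approximation. *)
Lemma restrict_frequencies (S : set (G -> C)) F e : bap F -> 0 < e ->
  (forall chi, is_character chi -> ~ S chi -> has_mean (fun t => F t * (chi t)^*) 0) ->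
  exists n (a : 'I_n -> C) (psi : 'I_n -> G -> C),
    [/\ forall i, is_character (psi i), forall i, S (psi i) \/ a i = 0 &
        bnle (fun t => F t - \sum_(i < n) a i * psi i t) e].
Proof.
move=> bF e0 hS; have [_ [n [a [psi [hp ->]]]] hP] := bap_bnle bF e0.
pose a' i := if `[< S (psi i) >] then a i else 0.
pose c i := if `[< S (psi i) >] then 0 else a i.
exists n, a', psi; split=> [//|i|]; first by rewrite /a'; case: asboolP; [left|right].
have bbF : bcont F by case: bF.
have bpol (w : 'I_n -> C) : bcont (fun t => \sum_(i < n) w i * psi i t).
  by apply: bcont_sum => i; apply: bcontZ; exact: char_bcont.
pose D t := F t - \sum_(i < n) a' i * psi i t.
pose Q t := \sum_(i < n) c i * psi i t.
have bD : bcont D by exact: (bcontB bbF (bpol a')).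
have bQ : bcont Q by exact: bpol.
have DQ : (fun t => F t - \sum_(i < n) a i * psi i t) = fun t => D t - Q t.
  apply/funext => t; rewrite /D /Q -addrA -opprD -big_split /=; congr (_ - _).
  by apply: eq_bigr => i _; rewrite /a' /c; case: asboolP => _; ring.
have mD chi : is_character chi -> ~ S chi -> has_mean (fun t => D t * (chi t)^*) 0.
  move=> hc nS; have bcc := bcont_conj (char_bcont hc).
  have mP : has_mean (fun t => \sum_(i < n) a' i * (psi i t * (chi t)^*)) (\sum_(i < n) 0).
    apply: has_mean_sum => i.
      apply: bcontZ; exact: (bcontM (char_bcont (hp i)) bcc).
    rewrite /a'; case: asboolP => [Si|_].
      rewrite -(mulr0 (a i)); apply: has_meanZ.
        exact: (bcontM (char_bcont (hp i)) bcc).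
      by apply: (char_orth (hp i) hc) => h; apply: nS; rewrite -h.
    by under eq_fun do rewrite mul0r; exact: has_mean_cst.
  rewrite big1// in mP.
  have bP : bcont (fun t => \sum_(i < n) a' i * (psi i t * (chi t)^*)).
    apply: bcont_sum => i; apply: bcontZ; exact: (bcontM (char_bcont (hp i)) bcc).
  have := has_meanD (bcontZ (-1) bP) (bcontM bbF bcc) (@has_meanZ (-1) _ _ bP mP) (hS chi hc nS).
  rewrite mulr0 addr0; congr has_mean; apply/funext => t.
  rewrite /D mulrBl mulr_suml mulN1r addrC; congr (_ - _).
  by apply: eq_bigr => i _; rewrite mulrA.
have mDQ : has_mean (fun t => D t * (Q t)^*) 0.
  have -> : (fun t => D t * (Q t)^*) =
      fun t => \sum_(i < n) (c i)^* * (D t * (psi i t)^*).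
    apply/funext => t; rewrite /Q rmorph_sum mulr_sumr; apply: eq_bigr => i _.
    by rewrite rmorphM; ring.
  have mS : has_mean (fun t => \sum_(i < n) (c i)^* * (D t * (psi i t)^*)) (\sum_(i < n) 0).
    apply: has_mean_sum => i.
      apply: bcontZ; exact: (bcontM bD (bcont_conj (char_bcont (hp i)))).
    rewrite /c; case: asboolP => [_|nS].
      by under eq_fun do rewrite conjC0 mul0r; exact: has_mean_cst.
    rewrite -(mulr0 (a i)^*); apply: has_meanZ; last exact: (mD _ (hp i) nS).
    exact: (bcontM bD (bcont_conj (char_bcont (hp i)))).
  by rewrite big1 in mS.
rewrite DQ in hP => d d0; have d20 : 0 < d / 2 by rewrite divr_gt0.
have d80 : 0 < d ^+ 2 / 8 by rewrite divr_gt0// exprn_gt0.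
have /has_meanP/(_ _ d80) h := mDQ.
apply: filterS2 (hP _ d20) h => k h1; rewrite subr0 => h2.
have LD := bcont_L2 (p k) bD; have LQ := bcont_L2 (p k) bQ.
rewrite -(@ltr_pXn2r _ 2)// ?nnegrE ?nrm_ge0 ?addr_ge0 ?(ltW e0) ?(ltW d0)// nrm_sq.
have h3 : sqnorm (p k) (fun t : GB => D t - Q t) < (e + d / 2) ^+ 2.
  by rewrite -nrm_sq ltr_pXn2r// ?nnegrE ?nrm_ge0 ?addr_ge0 ?(ltW e0) ?(ltW d20).
move: h3; rewrite sqnormB// => h3.
have q0 := sqnorm_ge0 (p k) (Q : GB -> C).
have h4 : reC (innerL2 (p k) (D : GB -> C) Q) < d ^+ 2 / 8.
  apply: le_lt_trans h2; apply: le_trans (ler_norm _) _; exact: ler_reC.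
have ed : 0 <= e * d by rewrite mulr_ge0 ?ltW.
nra.
Qed.

End means.

(** * Completeness of the space of square-integrable functions *)

Section riesz_fischer.
Context d (T : measurableType d) (R : realType) (m : probability T R).
Local Notation C := (Cx R).
Implicit Types f g : T -> C.

Lemma limn_einf_le (u : nat -> \bar R) (c : \bar R) :
  (forall n, (u n <= c)%E) -> (limn_einf u <= c)%E.
Proof.
move=> uc; rewrite limn_einf_lim; apply: lime_le; first exact: is_cvg_einfs.
apply: nearW => n; apply: le_trans (uc n); apply: ereal_inf_lbound.
by exists n => //=.
Qed.

(** Absolutely convergent series converge. *)
Lemma bounded_increments_cvg (u : nat -> R) (D : nat -> R) (M : R) :
  (forall k, `|u k.+1 - u k| <= D k) -> (forall n, \sum_(k < n) D k <= M) ->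
  cvgn u.
Proof.
move=> uD DM.
have -> : u = (fun n => u 0%N + series (telescope u) n).
  by apply/funext => n; exact: eq_sum_telescope.
apply: is_cvgD; first exact: is_cvg_cst.
apply: normed_cvg; apply: nondecreasing_is_cvgn.
  apply/nondecreasing_seqP => n; rewrite /= -subr_ge0.
  by rewrite (seriesSB (fun k => `|telescope u k|)) normr_ge0.
exists M => _ [n _ <-]; apply: le_trans (DM n).
rewrite (_ : [normed _] n = \sum_(k < n) `|telescope u k|).
  by apply: ler_sum => k _; exact: uD.
exact: (congr1 (fun v => v n) (seriesEord (fun k => `|telescope u k|))).
Qed.

Lemma mfunC_cvg (g : nat -> T -> C) (e : T -> C) : (forall k, mfunC (g k)) ->
  (forall x, g k x @[k --> \oo] --> e x) -> mfunC e.
Proof.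
move=> mg ge; split.
  apply: (@measurable_fun_cvg _ _ _ _ (fun k x => reC (g k x))).
    by move=> k; exact: (mg k).1.
  by move=> x _; apply: cvg_reC; exact: ge.
apply: (@measurable_fun_cvg _ _ _ _ (fun k x => imC (g k x))).
  by move=> k; exact: (mg k).2.
by move=> x _; apply: cvg_imC; exact: ge.
Qed.

(** Lower semicontinuity of the norm under pointwise convergence, from the
    Fatou lemma. *)
Lemma L2_fatou (g : nat -> T -> C) (e : T -> C) r : 0 <= r ->
  (forall k, L2 m (g k)) -> (forall x, g k x @[k --> \oo] --> e x) ->
  (forall k, nrm m (g k) <= r) -> L2 m e /\ nrm m e <= r.
Proof.
move=> r0 L2g ge gr.
have me : mfunC e by apply: mfunC_cvg ge => k; exact: (L2g k).1.
have le : (\int[m]_x (absC (e x) ^+ 2)%:E <= (r ^+ 2)%:E)%E.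
  pose h k x := ((absC (g k x) ^+ 2)%:E : \bar R).
  have -> : (fun x => (absC (e x) ^+ 2)%:E) = (fun x => limn_einf (h^~ x)).
    apply/funext => x; apply: esym; apply: (cvg_limn_einf_sup _).1.
    apply: cvg_EFin; first exact: nearW.
    have hx : absC (g k x) @[k --> \oo] --> absC (e x) by apply: cvg_absC; exact: ge.
    exact: (cvgM hx hx).
  apply: le_trans (@fatou _ _ _ m setT measurableT h _ _) _.
  - by move=> k; apply/measurable_EFinP; exact: mfunC_abs2 (L2g k).1.
  - by move=> k x _; rewrite lee_fin sqr_ge0.
  apply: limn_einf_le => k; rewrite EFin_sqnorm// lee_fin -nrm_sq.
  by rewrite ler_sqr ?nnegrE ?nrm_ge0//; exact: gr.
have L2e : L2 m e by split => //; apply: le_lt_trans le _; rewrite ltry.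
split=> //; move: le; rewrite EFin_sqnorm// lee_fin -nrm_sq.
by rewrite ler_sqr ?nnegrE ?nrm_ge0.
Qed.

(** The Riesz-Fischer theorem for rapidly Cauchy sequences. The sum of the
    moduli of the increments has a finite integral, hence is finite almost
    everywhere and the sequence converges pointwise off a null set. *)
Lemma L2_complete (f : nat -> T -> C) : (forall k, L2 m (f k)) ->
  (forall k, nrm m (fun x => f k.+1 x - f k x) <= 2^-1 ^+ k) ->
  exists2 e, L2 m e & forall k, nrm m (fun x => e x - f k x) <= 2 * 2^-1 ^+ k.
Proof.
move=> L2f fk.
pose D k x := absC (f k.+1 x - f k x).
have mD k : measurable_fun setT (D k) by apply: mfunC_abs; exact: (L2B (L2f _) (L2f _)).1.
have D0 k x : 0 <= D k x by exact: absC_ge0.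
(* S is the total variation of the sequence at x *)
pose S x := (\sum_(k <oo) (D k x)%:E)%E.
have mS : measurable_fun setT S.
  apply: ge0_emeasurable_sum => [k x _ _|k _]; first by rewrite lee_fin.
  exact/measurable_EFinP.
have S0 x : (0 <= S x)%E by apply: nneseries_ge0 => k _ _; rewrite lee_fin.
have iS : m.-integrable setT S.
  apply/integrableP; split=> //.
  under eq_integral do rewrite gee0_abs//.
  rewrite integral_nneseries//; last 2 first.
  - by move=> k; exact/measurable_EFinP.
  - by move=> k x _; rewrite lee_fin.
  apply: (@le_lt_trans _ _ (\sum_(k <oo) (2^-1 ^+ k)%:E)%E).
    apply: lee_nneseries => k *; first by apply: integral_ge0 => x _; rewrite lee_fin.
    have iD := L1C_abs (L2_L1 (L2B (L2f k.+1) (L2f k))).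
    rewrite -[leLHS]fineK; last exact: integrable_fin_num.
    rewrite lee_fin; apply: le_trans (fk k).
    exact: (Rintegral_absC_le_nrm (L2B (L2f k.+1) (L2f k))).
  have h : series (fun k => 2^-1 ^+ k : R) @ \oo --> ((1 - 2^-1)^-1 : R).
    have := @cvg_geometric_series R 1 2^-1; rewrite div1r /geometric /=.
    by under eq_fun do rewrite mul1r; apply; rewrite ger0_norm// invf_lt1// ltr1n.
  rewrite (@cvg_lim _ _ _ _ _ _ ((1 - 2^-1)^-1)%:E)//; first by rewrite ltry.
  under eq_fun do rewrite sumEFin.
  by apply: cvg_EFin; [exact: nearW|exact: h].
pose N := [set x | S x \is a fin_num].
have mN : measurable N by rewrite -[N]setTI; exact: emeasurable_fin_num.
(* the sequence is set to zero on the null set where S is infinite *)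
pose g k x := ofR (\1_N x) * f k x.
have g_ae k : {ae m, forall x, g k x = f k x}.
  have := integrable_ae measurableT iS; apply: filterS => x /(_ I) Nx.
  by rewrite /g indicE mem_set//= mul1r.
have L2g k : L2 m (g k).
  apply: (L2_le _ (L2_int (L2f k))).
    apply: mfunCM; last exact: (L2f k).1.
    by split=> /=; rewrite ?(CE)/=; [exact: measurable_indic|exact: measurable_cst].
  move=> x; rewrite /g indicE; case: (x \in N); rewrite /= ?mul1r//.
  by rewrite mul0r absC0 expr0n/= sqr_ge0.
have DS x n : N x -> \sum_(k < n) D k x <= fine (S x).
  move=> Nx; rewrite -lee_fin fineK// -sumEFin -(big_mkord xpredT (fun k => (D k x)%:E)).
  by apply: nneseries_lim_ge => k _ _; rewrite lee_fin.
have cg x : exists l : C, g k x @[k --> \oo] --> l.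
  have [Nx|Nx] := pselect (N x); last first.
    exists 0; rewrite (_ : (fun k => g k x) = (fun=> 0)); first exact: cvg_cst.
    by apply/funext => k; rewrite /g indicE memNset//= mul0r.
  have hr : cvgn (fun k => reC (f k x)).
    apply: (@bounded_increments_cvg _ (D^~ x) (fine (S x))) => [k|n]; last exact: DS.
    by rewrite -reCB; exact: ler_reC.
  have hi : cvgn (fun k => imC (f k x)).
    apply: (@bounded_increments_cvg _ (D^~ x) (fine (S x))) => [k|n]; last exact: DS.
    by rewrite -imCB; exact: ler_imC.
  exists (ofR (limn (fun k => reC (f k x))) + 'i * ofR (limn (fun k => imC (f k x)))).
  rewrite (_ : (fun k => g k x) = f^~ x); last first.
    by apply/funext => k; rewrite /g indicE mem_set//= mul1r.
  apply: cvg_reimC; rewrite !CE mul0r mul1r ?mulr0 ?subr0 ?addr0 ?add0r;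
    [exact: hr|exact: hi].
have [e ge] := choice cg.
have gd j k : nrm m (fun x => g (k + j)%N x - g k x) <= 2 * 2^-1 ^+ k.
  have -> : nrm m (fun x => g (k + j)%N x - g k x) = nrm m (fun x => f (k + j)%N x - f k x).
    apply: ae_nrm; [exact: L2B|exact: L2B|].
    by apply: filterS2 (g_ae (k + j)%N) (g_ae k) => x -> ->.
  suff : nrm m (fun x => f (k + j)%N x - f k x) <= 2 * 2^-1 ^+ k - 2 * 2^-1 ^+ (k + j).
    move/le_trans; apply; by rewrite lerBlDr lerDl mulr_ge0 ?exprn_ge0 ?invr_ge0.
  elim: j => [|j IH].
    rewrite addn0 subrr; under eq_fun do rewrite subrr; by rewrite nrm0.
  rewrite addnS; apply: le_trans (nrm_tri (L2f _) (L2f (k + j)%N) (L2f _)) _.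
  have := lerD (fk (k + j)%N) IH; move/le_trans; apply.
  by rewrite exprS; lra.
have L2e k : L2 m (fun x => e x - g k x) /\ nrm m (fun x => e x - g k x) <= 2 * 2^-1 ^+ k.
  apply: (@L2_fatou (fun j x => g (k + j)%N x - g k x)).
  - by rewrite mulr_ge0// exprn_ge0// invr_ge0.
  - by move=> j; exact: L2B.
  - move=> x; apply: cvgB; last exact: cvg_cst.
    have := ge x; rewrite -(cvg_shiftn k (fun j => g j x)) => h.
    by under eq_fun do rewrite addnC; exact: h.
  - by move=> j; exact: gd.
have L2ee : L2 m e.
  have := L2D (L2e 0%N).1 (L2g 0%N); congr L2.
  by apply/funext => x; rewrite subrK.
exists e => // k; rewrite -(ae_nrm (L2B L2ee (L2g k)) (L2B L2ee (L2f k))); first exact: (L2e k).2.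
by apply: filterS (g_ae k) => x ->.
Qed.

End riesz_fischer.

(** * Measure-preserving maps *)

Section measure_preserving.
Context d (T : measurableType d) (R : realType) (m : probability T R).
Local Notation C := (Cx R).
Variable h : T -> T.
Hypothesis mh : measurable_fun setT h.
Hypothesis hm : forall B, measurable B -> m (h @^-1` B) = m B.
Implicit Types f g : T -> C.

Lemma ge0_integral_comp (u : T -> \bar R) : measurable_fun setT u ->
  (forall x, 0 <= u x)%E -> (\int[m]_x u (h x) = \int[m]_x u x)%E.
Proof.
move=> mu u0; rewrite -[LHS](@ge0_integral_pushforward _ _ T T R _ mh m setT u) //.
by apply: eq_measure_integral => B mB _; exact: hm.
Qed.

Lemma Rintegral_comp (u : T -> R) : m.-integrable setT (EFin \o u) ->
  Rintegral m setT (u \o h) = Rintegral m setT u.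
Proof.
move=> iu; have mu := measurable_int _ iu.
rewrite /Rintegral; congr fine.
rewrite -[LHS](@integral_pushforward _ _ T T R _ mh m setT (EFin \o u)) //.
- by apply: eq_measure_integral => B mB _; exact: hm.
- apply/integrableP; split; first exact: measurableT_comp.
  have /integrableP[_] := iu.
  by rewrite -(ge0_integral_comp (u := fun x => `|(EFin \o u) x|%E)) //; exact: measurableT_comp.
Qed.

Lemma mfunC_comp f : mfunC f -> mfunC (f \o h).
Proof. by case=> f1 f2; split; [exact: (measurableT_comp f1 mh)|exact: (measurableT_comp f2 mh)]. Qed.

Lemma L2_comp f : L2 m f -> L2 m (f \o h).
Proof.
move=> [mf fi]; split; first exact: mfunC_comp.
rewrite (ge0_integral_comp (u := fun x => (absC (f x) ^+ 2)%:E)) //.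
- by apply/measurable_EFinP; exact: mfunC_abs2.
- by move=> x; rewrite lee_fin sqr_ge0.
Qed.

Lemma innerL2_comp f g : L2 m f -> L2 m g ->
  innerL2 m (f \o h) (g \o h) = innerL2 m f g.
Proof.
move=> lf lg; have [i1 i2] := L2_mul lf lg.
by rewrite /innerL2 /integralC; congr (ofR _ + 'i * ofR _);
  [exact: (Rintegral_comp i1)|exact: (Rintegral_comp i2)].
Qed.

End measure_preserving.

(** * Correlations along the orbit *)

Section orbit_means.
Context (R : realType) (G : topologicalZmodType).
Local Notation C := (Cx R).
Local Notation GB := (borel (0 : G)).
Variables (mu : radon R G) (p : nat -> probability GB R).
Hypothesis asymp : forall (F : G -> C) (s : G), bcont F ->
  integralC (p n) setT (fun t : GB => F ((t : G) + s)) -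
  integralC (p n) setT (F : GB -> C) @[n --> \oo] --> (0 : C).
Local Notation X := (hull mu).
Local Notation XB := (borel (hull_base mu)).
Hypothesis contb : forall f : X -> C, continuous f -> bcont f.
Hypothesis oX : open_approx R X.
Hypothesis corb : continuous (orbit_pt mu).
Implicit Types (f g : X -> C) (F H : G -> C).

Definition along_orbit f : G -> C := fun t => f (orbit_pt mu t).

Lemma along_bcont f : continuous f -> bcont (along_orbit f).
Proof.
move=> cf; have [_ [M fM]] := contb cf; split; last by exists M => t; exact: fM.
by move=> t; apply: continuous_comp; [exact: corb|exact: cf].
Qed.

Section invariant.
Variable m : probability XB R.
Hypothesis im : invariant_measure m.

Local Notation hs t := (hull_shift (mu := mu) t : XB -> XB).

Lemma shift_measurable t : measurable_fun setT (hs t).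
Proof.
apply: (@measurability _ _ XB XB setT _ (@open X : set (set XB)) erefl) => _ [U oU <-].
rewrite setTI; apply: sub_sigma_algebra; apply: open_comp => // x _.
exact: hull_shift_continuous.
Qed.

Lemma ae_innerL2r (f g g' : XB -> C) : L2 m f -> L2 m g -> L2 m g' ->
  {ae m, forall x, g x = g' x} -> innerL2 m f g = innerL2 m f g'.
Proof.
move=> lf lg lg' gg; rewrite (innerL2_conj lg lf) (innerL2_conj lg' lf).
by congr (_^*); exact: ae_innerL2 gg.
Qed.

(** By invariance, <h, h'> is multiplied by chi t times the conjugate of chi' t
    under the action of t, and this factor differs from one for some t. *)
Lemma eigenspaces_orth chi chi' (h h' : XB -> C) : is_character chi -> is_character chi' ->
  chi <> chi' -> dyn_eigenspace m chi h -> dyn_eigenspace m chi' h' -> innerL2 m h h' = 0.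
Proof.
move=> hc hc' ne [lh eh] [lh' eh'].
have [t ct] : exists t, chi t <> chi' t.
  by apply/existsNP => e; apply: ne; exact/funext.
have im' B (mB : measurable B) : m (hs (- t) @^-1` B) = m B by exact: im.
have lhs := L2_comp (shift_measurable (- t)) im' lh.
have lhs' := L2_comp (shift_measurable (- t)) im' lh'.
have E : innerL2 m h h' = chi t * (chi' t)^* * innerL2 m h h'.
  rewrite -[LHS](innerL2_comp (shift_measurable (- t)) im' lh lh').
  rewrite (ae_innerL2 lhs (L2Z (chi t) lh) lhs' (eh t)).
  rewrite (ae_innerL2r (L2Z (chi t) lh) lhs' (L2Z (chi' t) lh') (eh' t)).
  by rewrite (innerL2Zr _ (L2Z (chi t) lh) lh') (innerL2Z _ lh lh') mulrA [_^* * _]mulrC.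
apply/eqP; apply: contra_notT ct => h0.
have : chi t * (chi' t)^* = 1 by apply: (mulIf h0); rewrite mul1r -E.
by move/(congr1 (fun z => z * chi' t)); rewrite -mulrA (char_conjM t hc') mulr1 mul1r.
Qed.

End invariant.

(** In this section the vectors e chi are the candidates for the eigenfunctions;
    the hypotheses are those shared by the two implications of the theorem. *)
Section wiener_wintner_systems.
Variable m : probability XB R.
Hypothesis mean_int : forall f, continuous f -> has_mean p (along_orbit f) (integralC m setT (f : XB -> C)).
Variables (S : set (G -> C)) (e : (G -> C) -> XB -> C).
Hypothesis Schar : forall chi, S chi -> is_character chi.
Hypothesis eL2 : forall chi, S chi -> L2 m (e chi).
Hypothesis e1 : forall chi, S chi -> innerL2 m (e chi) (e chi) = 1.
Hypothesis eorth : forall chi psi, S chi -> S psi -> chi <> psi -> innerL2 m (e chi) (e psi) = 0.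
Hypothesis eww : forall chi f, S chi -> continuous f ->
  has_mean p (fun t => along_orbit f t * (chi t)^*) (innerL2 m (f : XB -> C) (e chi)).

Definition matched (hH : (XB -> C) * (G -> C)) := L2 m hH.1 /\ bcont hH.2.
(** Correlation is sesquilinear, hence passes from generators to all
    combinations. It stands in for the values along the orbit, which have no
    meaning for a square-integrable function. *)
Definition correlated (hH kK : (XB -> C) * (G -> C)) :=
  has_mean p (fun t => hH.2 t * (kK.2 t)^*) (innerL2 m hH.1 kK.1).

Lemma correlated_sym hH kK : matched hH -> matched kK -> correlated hH kK -> correlated kK hH.
Proof.
move=> [lh bH] [lk bK] c; have bHK := bcontM bH (bcont_conj bK).
have := has_mean_conj bHK c; rewrite /correlated (innerL2_conj lh lk).
by congr has_mean; apply/funext => t; rewrite rmorphM /= conjCK mulrC.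
Qed.

Lemma correlated_lin c hH hH' kK : matched hH -> matched hH' -> matched kK ->
  correlated hH kK -> correlated hH' kK ->
  correlated (fun w => c * hH.1 w + hH'.1 w, fun t => c * hH.2 t + hH'.2 t) kK.
Proof.
move=> [lh bH] [lh' bH'] [lk bK] c1 c2.
rewrite /correlated /= (innerL2_lin c lh lh' lk).
have b1 := bcontM bH (bcont_conj bK); have b2 := bcontM bH' (bcont_conj bK).
have := has_meanD (bcontZ c b1) b2 (has_meanZ (c := c) b1 c1) c2.
by congr has_mean; apply/funext => t; ring.
Qed.

Lemma correlated_nrm hH : matched hH -> correlated hH hH ->
  nrm (p k) (hH.2 : GB -> C) @[k --> \oo] --> nrm m hH.1.
Proof.
move=> [lh bH]; rewrite /correlated (innerL2_self lh) => c.
have {}c : sqnorm (p k) (hH.2 : GB -> C) @[k --> \oo] --> sqnorm m hH.1.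
  have := cvg_reC eventually_filter c; rewrite reC_ofR.
  apply: cvg_trans; apply: near_eq_cvg; apply: nearW => k.
  by rewrite (mean_sqnorm p k bH) reC_ofR.
by apply: (cvg_comp _ _ c); exact: sqrt_continuous.
Qed.

Definition generator (hH : (XB -> C) * (G -> C)) :=
  (exists2 f, continuous f & hH = (f : XB -> C, along_orbit f)) \/
  (exists2 chi, S chi & hH = (e chi, chi)).

Lemma generator_matched hH : generator hH -> matched hH.
Proof.
case=> [[f cf ->]|[chi Sc ->]]; split => /=.
- exact: bcont_L2 (contb cf).
- exact: along_bcont.
- exact: eL2.
- exact: char_bcont (Schar Sc).
Qed.

Lemma generator_correlated hH kK : generator hH -> generator kK -> correlated hH kK.
Proof.
have ww f chi : continuous f -> S chi -> correlated (f : XB -> C, along_orbit f) (e chi, chi).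
  by move=> cf Sc; exact: eww.
case=> [[f cf ->]|[chi Sc ->]] [[g cg ->]|[psi Sp ->]].
- have cfg : continuous (fun w => f w * (g w)^*).
    by have := bcontM (contb cf) (bcont_conj (contb cg)) => -[].
  exact: mean_int cfg.
- exact: ww.
- apply: correlated_sym (ww g chi cg Sc).
  + by apply: generator_matched; left; exists g.
  + by apply: generator_matched; right; exists chi.
- rewrite /correlated /=; have [->|ne] := pselect (chi = psi).
    rewrite (e1 Sp) (_ : (fun t => _) = (fun=> 1)); first exact: has_mean_cst.
    by apply/funext => t; rewrite mulrC (char_conjM t (Schar Sp)).
  by rewrite (eorth Sc Sp ne); exact: (char_orth asymp (Schar Sc) (Schar Sp) ne).
Qed.

Definition dual (K : (XB -> C) * (G -> C) -> Prop) hH := matched hH /\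
  forall kK, K kK -> correlated hH kK.

(** The induction is over the number of terms; it only uses that K-correlation is
    linear in the left argument. *)
Lemma dual_sum (K : (XB -> C) * (G -> C) -> Prop) f n (a : 'I_n -> C) (chi : 'I_n -> G -> C) :
  (forall kK, K kK -> matched kK) -> (forall hH, generator hH -> dual K hH) ->
  continuous f -> (forall i, S (chi i)) ->
  dual K (fun w => f w - \sum_(i < n) a i * e (chi i) w,
          fun t => along_orbit f t - \sum_(i < n) a i * chi i t).
Proof.
move=> Km gK cf; elim: n a chi => [|n IH] a chi Sc.
  rewrite (_ : (_, _) = (f : XB -> C, along_orbit f)); first by apply: gK; left; exists f.
  by congr pair; apply/funext => w; rewrite big_ord0 subr0.
have [m1 c1] := IH (a \o widen_ord (leqnSn n)) (chi \o widen_ord (leqnSn n)) (fun i => Sc _).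
have [m2 c2] : dual K (e (chi ord_max), chi ord_max).
  by apply: gK; right; exists (chi ord_max).
rewrite (_ : (_, _) = (fun w => - a ord_max * e (chi ord_max) w +
    (f w - \sum_(i < n) (a \o widen_ord (leqnSn n)) i * e ((chi \o widen_ord (leqnSn n)) i) w),
  fun t => - a ord_max * chi ord_max t +
    (along_orbit f t - \sum_(i < n) (a \o widen_ord (leqnSn n)) i * (chi \o widen_ord (leqnSn n)) i t))).
  split=> [|kK KkK].
    split; first exact: (L2_lin (- a ord_max) m2.1 m1.1).
    exact: (bcont_lin (- a ord_max) m2.2 m1.2).
  exact (correlated_lin (c := - a ord_max) m2 m1 (Km _ KkK) (c2 _ KkK) (c1 _ KkK)).
by congr pair; apply/funext => w; rewrite big_ord_recr /=; ring.
Qed.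

(** The combination is correlated with itself. Linearity is used on the left,
    then, after exchanging the arguments, on the right. *)
Lemma nrm_combination_cvg f n (a : 'I_n -> C) (chi : 'I_n -> G -> C) :
  continuous f -> (forall i, S (chi i)) ->
  nrm (p k) (fun t : GB => along_orbit f t - \sum_(i < n) a i * chi i t) @[k --> \oo] -->
  nrm m (fun w => f w - \sum_(i < n) a i * e (chi i) w).
Proof.
move=> cf Sc; set hH := (fun w : XB => f w - \sum_(i < n) a i * e (chi i) w,
          fun t => along_orbit f t - \sum_(i < n) a i * chi i t).
have gg kK : generator kK -> dual generator kK.
  by move=> gk; split=> [|hH' gh]; [exact: generator_matched|exact: generator_correlated].
(* first against generators, then against everything correlated with them *)
have gd kK : generator kK -> dual (dual generator) kK.
  move=> gk; have mk := generator_matched gk; split=> [//|hH' [mh ch]].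
  by apply: (correlated_sym mh mk); exact: ch.
have dm kK : dual generator kK -> matched kK by case.
have [[lh bH] _] := dual_sum a generator_matched gg cf Sc.
have [_ c2] := dual_sum a dm gd cf Sc.
have := c2 _ (dual_sum a generator_matched gg cf Sc); rewrite /correlated /= => c.
exact: (@correlated_nrm hH (conj lh bH) c).
Qed.

End wiener_wintner_systems.
End orbit_means.

(** * Consequences of the convergence of the Wiener-Wintner averages *)

Section from_wiener_wintner.
Context (R : realType) (G : topologicalZmodType).
Local Notation C := (Cx R).
Local Notation GB := (borel (0 : G)).
Variables (mu : radon R G) (p : nat -> probability GB R).
Hypothesis asymp : forall (F : G -> C) (s : G), bcont F ->
  integralC (p n) setT (fun t : GB => F ((t : G) + s)) -
  integralC (p n) setT (F : GB -> C) @[n --> \oo] --> (0 : C).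
Local Notation X := (hull mu).
Local Notation XB := (borel (hull_base mu)).
Hypothesis contb : forall f : X -> C, continuous f -> bcont f.
Hypothesis oX : open_approx R X.
Hypothesis corb : continuous (orbit_pt mu).
Variable m : probability XB R.
Hypothesis im : invariant_measure m.
Implicit Types (f g : X -> C) (F H : G -> C).

Definition ww_averages chi (e : XB -> C) := forall f, continuous f ->
  has_mean p (fun t => along_orbit (mu := mu) f t * (chi t)^*) (innerL2 m (f : XB -> C) e).

Hypothesis ww : forall chi, dyn_eigenvalue m chi -> exists B : set (XB -> C),
  [/\ ae_basis m (dyn_eigenspace m chi) B,
      forall e, B e -> innerL2 m e e = 1 &
      forall e, B e -> ww_averages chi e].

Lemma orth_continuous_ae_eq (h k : XB -> C) : L2 m h -> L2 m k ->
  (forall f, continuous f -> innerL2 m (f : XB -> C) h = innerL2 m (f : XB -> C) k) ->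
  {ae m, forall x, h x = k x}.
Proof.
move=> lh lk hk.
have H g : bcont g -> innerL2 m (fun x => h x - k x) (g : XB -> C) = 0.
  move=> bg; have lg : L2 m (g : XB -> C) := bcont_L2 m bg.
  rewrite (innerL2B lh lk lg) (innerL2_conj lg lh) (innerL2_conj lg lk).
  by rewrite (hk g bg.1) subrr.
by apply: filterS (orth_bcont_ae0 oX (L2B lh lk) H) => x /eqP; rewrite subr_eq0 => /eqP.
Qed.

(** All elements of a basis have the same inner products with continuous
    functions, since these are limits of the same averages; by density they
    coincide almost everywhere. *)
Lemma ww_line chi : dyn_eigenvalue m chi -> exists e : XB -> C,
  [/\ dyn_eigenspace m chi e, innerL2 m e e = 1, ww_averages chi e &
      forall h, dyn_eigenspace m chi h -> exists b, {ae m, forall x, h x = b * e x}].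
Proof.
move=> ev; have [B [[BE _ Bspan] B1 Bww]] := ww ev.
have [h0 [_ Eh0 nh0]] := ev.
have [n [a [e [Be h0e]]]] := Bspan _ Eh0.
case: n a e Be h0e => [|n] a e Be h0e.
  by case: nh0; apply: filterS h0e => x ->; rewrite big_ord0.
have Bae e1 : B e1 -> {ae m, forall x, e1 x = e ord0 x}.
  move=> Be1; apply: orth_continuous_ae_eq; [exact: (BE _ Be1).1|exact: (BE _ (Be ord0)).1|].
  move=> f cf; exact: (has_mean_unique (Bww _ Be1 f cf) (Bww _ (Be ord0) f cf)).
exists (e ord0); split; [exact: BE|exact: B1|exact: Bww|].
move=> h Eh; have [k [b [e' [Be' he']]]] := Bspan _ Eh.
exists (\sum_(i < k) b i).
have : {ae m, forall x, forall i, e' i x = e ord0 x}.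
  by apply: filter_forall => i; exact: Bae.
apply: filterS2 he' => x -> ex; rewrite mulr_suml.
by apply: eq_bigr => i _; rewrite ex.
Qed.

Lemma cst_eigenspace c : dyn_eigenspace m (fun=> 1 : C) (fun=> c : C).
Proof. by split; [exact: L2_cst|move=> t; apply: nearW => w; rewrite mul1r]. Qed.

Lemma trivial_eigenvalue : dyn_eigenvalue m (fun=> 1 : C).
Proof.
exists (fun=> 1); split; [exact: char_cst1|exact: cst_eigenspace|].
move=> h; have := ae_nrm0 (L2_cst m 1) h => /eqP.
rewrite /nrm sqrtr_eq0 leNgt => /negP; apply.
have := innerL2_self (L2_cst m 1).
rewrite /innerL2; under [X in integralC _ _ X]eq_fun do rewrite conjC1 mulr1.
by rewrite integralC_cst => /(congr1 (@reC R)); rewrite reC_ofR => <-; rewrite reC1.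
Qed.

(** The constant 1 is a multiple of the normalised vector e of its eigenspace;
    the average of 1 against the trivial character shows that the factor is 1. *)
Lemma trivial_line : exists e : XB -> C,
  [/\ dyn_eigenspace m (fun=> 1) e, ww_averages (fun=> 1) e,
      {ae m, forall x, e x = 1} &
      forall h, dyn_eigenspace m (fun=> 1) h -> exists b, {ae m, forall x, h x = b * e x}].
Proof.
have [e [Ee e1 wwe line]] := ww_line trivial_eigenvalue.
exists e; split => //.
have [b be] := line _ (cst_eigenspace 1).
have b1 : b = 1.
  have h1 : innerL2 m (fun=> 1) e = b.
    rewrite (ae_innerL2 (L2_cst m 1) (L2Z b Ee.1) Ee.1 be).
    by rewrite (innerL2Z b Ee.1 Ee.1) e1 mulr1.
  have := wwe (fun=> 1) (bcont_cst _ (1 : C)).1; rewrite h1.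
  rewrite (_ : (fun t => _) = (fun=> 1)) => [h2|].
    exact: (has_mean_unique h2 (@has_mean_cst R G p 1)).
  by apply/funext => t; rewrite /along_orbit conjC1 mulr1.
by apply: filterS be => x; rewrite b1 mul1r => <-.
Qed.

(** The Wiener-Wintner averages for the trivial character. *)
Lemma ww_mean f : continuous f -> has_mean p (along_orbit (mu := mu) f) (integralC m setT (f : XB -> C)).
Proof.
move=> cf; have [e [Ee wwe e1 _]] := trivial_line.
have lf : L2 m (f : XB -> C) := bcont_L2 m (contb cf).
have := wwe f cf; rewrite (ae_innerL2r lf Ee.1 (L2_cst m 1) e1).
rewrite /innerL2; under [X in integralC _ _ X]eq_fun do rewrite conjC1 mulr1.
by congr has_mean; apply/funext => t; rewrite conjC1 mulr1.
Qed.

(** The indicator of an invariant set is an eigenfunction for the trivial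
    character, hence is constant almost everywhere. *)
Theorem ww_ergodic : ergodic m.
Proof.
move=> B mB Binv.
have [e [Ee _ e1 line]] := trivial_line.
have [b hb] : exists b, {ae m, forall x, indC R B x = b * e x}.
  apply: line; split; first exact: indC_L2.
  move=> t; apply: nearW => w; rewrite mul1r /indC; congr ofR.
  by rewrite -[in RHS](Binv (- t)) !indicE; congr (nat_of_bool _)%:R; apply/idP/idP => /set_mem h; exact: mem_set.
have {}hb : {ae m, forall x, indC R B x = b} by apply: filterS2 hb e1 => x -> ->; rewrite mulr1.
(* b is the almost sure value of the indicator of B *)
have [b0|b0] := eqVneq b 0; [left|right].
  apply: (measure_negligible mB); apply: negligibleS hb => x Bx /=.
  by rewrite b0 /indC indicE mem_set//= => /eqP; rewrite oner_eq0.
have : m (~` B) = 0%E.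
  apply: (measure_negligible (measurableC mB)); apply: negligibleS hb => x Bx /=.
  by rewrite /indC indicE memNset//= => /eqP; rewrite eq_sym (negbTE b0).
move=> h0; rewrite -[B]setCK probability_setC; last exact: measurableC.
by rewrite h0 sube0.
Qed.

Lemma ww_system : exists e : (G -> C) -> XB -> C, forall chi, dyn_eigenvalue m chi ->
  [/\ dyn_eigenspace m chi (e chi), innerL2 m (e chi) (e chi) = 1, ww_averages chi (e chi) &
      forall h, dyn_eigenspace m chi h -> exists b, {ae m, forall x, h x = b * e chi x}].
Proof.
have H chi : exists e : XB -> C, dyn_eigenvalue m chi ->
  [/\ dyn_eigenspace m chi e, innerL2 m e e = 1, ww_averages chi e &
      forall h, dyn_eigenspace m chi h -> exists b, {ae m, forall x, h x = b * e x}].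
  have [ev|nev] := pselect (dyn_eigenvalue m chi).
    by have [e he] := ww_line ev; exists e.
  by exists (fun=> 0).
by have [e he] := choice H; exists e.
Qed.

(** Approximate f in L2 by a combination of eigenfunctions; the distance is the
    limit of the quadratic means of the difference between f along the orbit and
    the corresponding trigonometric polynomial. *)
Theorem ww_bap f : pure_point_spectrum m -> continuous f -> bap p (along_orbit (mu := mu) f).
Proof.
move=> [B [BL2 _ _ Bdense] Beig] cf.
have [e he] := ww_system.
have bf := along_bcont contb corb cf.
split=> // eps eps0.
have lf : L2 m (f : XB -> C) := bcont_L2 m (contb cf).
have [n [a [b [Bb]]]] := Bdense _ lf (eps ^+ 2) (exprn_gt0 _ eps0).
have lb i : L2 m (fun x => a i * b i x) by apply: L2Z; exact: BL2.
rewrite (dist2L2_nrm lf (L2_sum lb)) lte_fin ltr_sqr ?nnegrE ?nrm_ge0 ?ltW// => fb.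
have [chi hchi] := choice (fun i => Beig _ (Bb i)).
have evc i : dyn_eigenvalue m (chi i) by exists (b i).
have Hc i : exists c, {ae m, forall x, b i x = c * e (chi i) x}.
  by have [_ _ _ line] := he _ (evc i); apply: line; have [] := hchi i.
have [c hc] := choice Hc.
have le i : L2 m (e (chi i)) by have [[]] := he _ (evc i).
have fe : nrm m (fun x : XB => f x - \sum_(i < n) (a i * c i) * e (chi i) x) < eps.
  rewrite (ae_nrm _ _ (g := fun x : XB => f x - \sum_(i < n) a i * b i x)) //.
  - by apply: (L2B lf); apply: L2_sum => i; exact: L2Z.
  - by apply: (L2B lf); exact: L2_sum.
  have : {ae m, forall x, forall i, b i x = c i * e (chi i) x} by exact: filter_forall.
  apply: filterS => x hx; congr (_ - _); apply: eq_bigr => i _.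
  by rewrite hx mulrA.
have tP : trig_poly (fun t => \sum_(i < n) (a i * c i) * chi i t).
  exists n, (fun i => a i * c i), chi; split => // i.
  by have [] := hchi i.
exists (fun t => \sum_(i < n) (a i * c i) * chi i t) => //.
have evchar psi : dyn_eigenvalue m psi -> is_character psi by case=> h [].
have cv := nrm_combination_cvg asymp contb corb ww_mean evchar
  (fun psi ev => let: And4 E _ _ _ := he psi ev in E.1)
  (fun psi ev => let: And4 _ E _ _ := he psi ev in E)
  (fun psi psi' ev ev' ne => let: And4 E _ _ _ := he psi ev in let: And4 E' _ _ _ := he psi' ev' in
     eigenspaces_orth im (evchar _ ev) (evchar _ ev') ne E E')
  (fun psi f ev cf => let: And4 _ _ E _ := he psi ev in E f cf) cf (a := fun i => a i * c i) evc.
apply: (@filterS _ \oo _ _ _ _ (cvgr_lt _ cv _ fe)) => k; apply: le_lt_trans.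
exact: nrm1_le_nrm (bcontB bf (trig_bcont tP)).
Qed.

End from_wiener_wintner.

(** * Eigenfunctions produced by an almost periodic orbit *)

Lemma absC_geometric_eq0 (R : realType) (z : Cx R) (K : R) :
  (forall k, absC z <= K * 2^-1 ^+ k) -> z = 0.
Proof.
move=> zK; apply/eqP; rewrite -absC_eq0; apply/eqP/le_anti; rewrite absC_ge0 andbT.
have h : K * 2^-1 ^+ k @[k --> \oo] --> (0 : R).
  rewrite -[X in _ --> X](mulr0 K); apply: cvgMr; apply: cvg_expr.
  by rewrite ger0_norm// invf_lt1// ltr1n.
rewrite -(cvg_lim _ h)//; apply: limr_ge; first by apply/cvg_ex; exists 0.
exact: nearW.
Qed.

Section from_besicovitch.
Context (R : realType) (G : topologicalZmodType).
Local Notation C := (Cx R).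
Local Notation GB := (borel (0 : G)).
Variables (mu : radon R G) (p : nat -> probability GB R).
Hypothesis asymp : forall (F : G -> C) (s : G), bcont F ->
  integralC (p n) setT (fun t : GB => F ((t : G) + s)) -
  integralC (p n) setT (F : GB -> C) @[n --> \oo] --> (0 : C).
Local Notation X := (hull mu).
Local Notation XB := (borel (hull_base mu)).
Hypothesis contb : forall f : X -> C, continuous f -> bcont f.
Hypothesis oX : open_approx R X.
Hypothesis corb : continuous (orbit_pt mu).
Local Notation along := (@along_orbit R G mu).
Hypothesis along_bap : forall f : X -> C, continuous f -> bap p (along f).
Variable m : probability XB R.
Hypothesis im : invariant_measure m.
Hypothesis mean_int : forall f : X -> C, continuous f ->
  has_mean p (along f) (integralC m setT (f : XB -> C)).
Implicit Types (f g : X -> C) (F H : G -> C).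

Local Notation ww_averages := (@ww_averages R G mu p m).
Local Notation alongb cf := (along_bcont contb corb cf).
Local Notation contL2 cf := (bcont_L2 m (contb cf)).

Lemma mean_inner f g : continuous f -> continuous g ->
  has_mean p (fun t => along f t * (along g t)^*) (innerL2 m (f : XB -> C) (g : XB -> C)).
Proof.
move=> cf cg; have cfg : continuous (fun w => f w * (g w)^*).
  by have := bcontM (contb cf) (bcont_conj (contb cg)) => -[].
exact: mean_int cfg.
Qed.

(** A bound in quadratic mean along the orbit is a bound in L2, so that Cauchy
    sequences for the seminorm give Cauchy sequences in L2. *)
Lemma nrm_bnle f r : continuous f -> bnle p (along f) r -> nrm m (f : XB -> C) <= r.
Proof.
move=> cf; apply: bnle_lim.
exact: (@correlated_nrm _ _ mu p m (f : XB -> C, along f) (conj (contL2 cf) (alongb cf))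
  (mean_inner cf cf)).
Qed.

Section one_frequency.
Variable chi : G -> C.
Hypothesis hchi : is_character chi.

(** The functions along the orbit form a class that is stable under
    combinations and translations. *)
Lemma approximants f c : continuous f -> has_mean p (fun t => along f t * (chi t)^*) c ->
  c != 0 -> exists g : nat -> X -> C, forall k, continuous (g k) /\
    bnle p (fun t => along (g k) t - chi t) (2^-1 ^+ k / 4).
Proof.
move=> cf hc c0; suff H k : exists g, continuous g /\ bnle p (fun t => along g t - chi t) (2^-1 ^+ k / 4).
  by have [g hg] := choice H; exists g.
pose A := [set F | exists2 f, continuous f & F = along f].
have e0 : 0 < 2^-1 ^+ k / 4 :> R by rewrite divr_gt0// exprn_gt0// invr_gt0.
have Ab F : A F -> bcont F by move=> [g cg ->]; exact: (alongb cg).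
have A0 : A (fun=> 0) by exists (fun=> 0); [exact (bcont_cst _ (0 : C)).1|].
have Alin (d : C) F H : A F -> A H -> A (fun t => d * F t + H t).
  move=> [g cg ->] [h ch ->]; exists (fun w => d * g w + h w); last by [].
  exact: (bcont_lin d (contb cg) (contb ch)).1.
have Atr s F : A F -> A (fun t => F (t + s)).
  move=> [g cg ->]; exists (g \o hull_shift (- s)).
    by move=> w; apply: continuous_comp; [exact: hull_shift_continuous|exact: cg].
  by apply/funext => t; rewrite /along_orbit /orbit_pt /= hull_shiftD opprD addrC.
have Af : A (along f) by exists f.
have [_ [g cg ->] hg] := approx_char asymp hchi Ab A0 Alin Atr Af (along_bap cf) hc c0 e0.
by exists g.
Qed.

(** Continuous functions g k whose values along the orbit approach chi at a
    geometric rate form a Cauchy sequence in L2; its limit e is the sought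
    vector. The averages against chi are close to those against the values of
    g k, which converge to the inner product with g k. *)
Lemma frequency_vector f c : continuous f -> has_mean p (fun t => along f t * (chi t)^*) c ->
  c != 0 -> exists e : XB -> C,
    [/\ L2 m e, innerL2 m e e = 1 & ww_averages chi e].
Proof.
move=> cf hc c0; have [g hg] := approximants cf hc c0.
have cg k := (hg k).1.
have bchi := char_bcont hchi.
have bD k : bcont (fun t => along (g k) t - chi t) := bcontB (alongb (cg k)) bchi.
have hp k : 0 <= 2^-1 ^+ k :> R by rewrite exprn_ge0 // invr_ge0.
have [] := @L2_complete _ XB R m (fun k => g k : XB -> C).
- by move=> k; exact: (contL2 (cg k)).
- move=> k; have cd : continuous (fun w => g k.+1 w - g k w).
    exact: (bcontB (contb (cg k.+1)) (contb (cg k))).1.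
  apply: (nrm_bnle cd).
  have h4 : 0 <= 2^-1 ^+ k / 4 :> R by rewrite divr_ge0.
  have h := bnleD (bD k.+1) (bcontZ (-1) (bD k)) (hg k.+1).2 (bnleZ (-1) (bD k) h4 (hg k).2).
  have -> : along (fun w => g k.+1 w - g k w) =
      (fun t => (along (g k.+1) t - chi t) + -1 * (along (g k) t - chi t)).
    by apply/funext => t; rewrite /along_orbit; ring.
  apply: bnle_mono h; rewrite absCN absC1 mul1r exprS; have := hp k; lra.
move=> e le ge.
have e_g f1 k : continuous f1 -> absC (innerL2 m (f1 : XB -> C) e - innerL2 m (f1 : XB -> C) (g k : XB -> C))
    <= nrm m (f1 : XB -> C) * (2 * 2^-1 ^+ k).
  move=> cf1; have lf1 := contL2 cf1; have lg := contL2 (cg k).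
  rewrite -(innerL2Br le lg lf1); apply: le_trans (Cauchy_Schwarz lf1 (L2B le lg)) _.
  by rewrite ler_wpM2l ?nrm_ge0.
have ww : ww_averages chi e.
  move=> f1 cf1; have [l hl] := bap_char_mean asymp hchi (along_bap cf1).
  suff -> : innerL2 m (f1 : XB -> C) e = l by [].
  have [_ [M f1M]] := contb cf1.
  apply/eqP; rewrite -subr_eq0; apply/eqP.
  apply: (@absC_geometric_eq0 _ _ (nrm m (f1 : XB -> C) * 2 + M)) => k.
  have M0 : 0 <= M := le_trans (absC_ge0 _) (f1M (hull_base mu)).
  have b1 := bcontM (alongb cf1) (bcont_conj (alongb (cg k))).
  have b2 := bcontM (alongb cf1) (bcont_conj bchi).
  have hD : has_mean p (fun t => (along (g k) t - chi t) * (along f1 t)^*)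
      (innerL2 m (f1 : XB -> C) (g k : XB -> C) - l)^*.
    have := has_mean_conj (bcontD b1 (bcontZ (-1) b2))
      (has_meanD b1 (bcontZ (-1) b2) (mean_inner cf1 (cg k)) (has_meanZ (c := -1) b2 hl)).
    rewrite mulN1r; congr has_mean; apply/funext => t.
    by rewrite rmorphD !rmorphM /= rmorphN rmorph1 !conjCK; ring.
  have := mean_bnle (bD k) (alongb cf1) (fun t => f1M _) (hg k).2 hD.
  rewrite absC_conj => h1; have h2 := e_g f1 k cf1.
  rewrite -[X in absC X](subrKA (innerL2 m (f1 : XB -> C) (g k : XB -> C))).
  apply: le_trans (absCD _ _) _; apply: le_trans (lerD h2 h1) _.
  have := mulr_ge0 M0 (hp k); lra.
exists e; split => //.
apply/eqP; rewrite -subr_eq0; apply/eqP.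
apply: (@absC_geometric_eq0 _ _ (2 * nrm m e + 1)) => k.
have lg := contL2 (cg k).
have hD : has_mean p (fun t => (along (g k) t - chi t) * (chi t)^*)
    (innerL2 m (g k : XB -> C) e - 1).
  have b1 := bcontM (alongb (cg k)) (bcont_conj bchi).
  have := has_meanD b1 (bcont_cst _ (-1)) (ww _ (cg k)) (@has_mean_cst _ _ p (-1)).
  by congr has_mean; apply/funext => t; rewrite mulrBl [chi t * _]mulrC (char_conjM t hchi).
have cle t : absC (chi t) <= 1 by rewrite (char_abs t hchi).
have := mean_bnle (bD k) bchi cle (hg k).2 hD; rewrite mul1r => h1.
have h2 : absC (innerL2 m e e - innerL2 m (g k : XB -> C) e) <= 2 * 2^-1 ^+ k * nrm m e.
  rewrite -(innerL2B le lg le); apply: le_trans (Cauchy_Schwarz (L2B le lg) le) _.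
  by rewrite ler_wpM2r ?nrm_ge0.
rewrite -[X in absC X](subrKA (innerL2 m (g k : XB -> C) e)).
apply: le_trans (absCD _ _) _; apply: le_trans (lerD h2 h1) _.
have := hp k; lra.
Qed.

(** Both sides have the same inner products with continuous functions, because
    the averages of f(tau_t) against chi are those of f, up to the conjugate of
    chi t. *)
Lemma frequency_eigen (e : XB -> C) : L2 m e -> ww_averages chi e -> dyn_eigenspace m chi e.
Proof.
move=> le ww; split=> // t.
have im' (B : set XB) (mB : measurable B) : m (hull_shift (mu := mu) (- t) @^-1` B) = m B by exact: im.
have mt := shift_measurable (mu := mu) (- t).
have les := L2_comp mt im' le.
apply: (orth_continuous_ae_eq oX les (L2Z (chi t) le)) => f cf.
have lf := contL2 cf.
have cft : continuous (f \o hull_shift t).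
  by move=> w; apply: continuous_comp; [exact: hull_shift_continuous|exact: cf].
have lft := contL2 cft.
rewrite (innerL2Zr _ lf le).
have -> : (f : XB -> C) = (f \o hull_shift t : XB -> C) \o hull_shift (- t).
  by apply/funext => w /=; rewrite hull_shiftNK.
rewrite (innerL2_comp mt im' lft le).
apply: (has_mean_unique (ww _ cft)).
have b1 := bcontM (alongb cf) (bcont_conj (char_bcont hchi)).
have := has_mean_translate asymp (- t) (bcontZ (chi t)^* b1)
  (has_meanZ (c := (chi t)^*) b1 (ww _ cf)).
have [_ chiD _] := hchi.
have -> : (f \o hull_shift t : XB -> C) \o hull_shift (- t) = (f : XB -> C).
  by apply/funext => w /=; rewrite hull_shiftNK.
congr has_mean; apply/funext => s.
have ct : (chi (- t))^* * (chi t)^* = 1.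
  by rewrite -rmorphM -chiD addNr (char0 hchi) rmorph1.
rewrite /along_orbit /= /orbit_pt hull_shiftD opprB chiD rmorphM /= -[RHS]mulr1 -ct; ring.
Qed.

End one_frequency.

(** The Fourier-Bohr spectrum of the orbit. *)
Definition frequency chi := is_character chi /\
  exists2 f, continuous f & exists2 c, has_mean p (fun t => along f t * (chi t)^*) c & c != 0.

Lemma frequency_system : exists e : (G -> C) -> XB -> C, forall chi, frequency chi ->
  [/\ dyn_eigenspace m chi (e chi), innerL2 m (e chi) (e chi) = 1 & ww_averages chi (e chi)].
Proof.
have H chi : exists e : XB -> C, frequency chi ->
  [/\ dyn_eigenspace m chi e, innerL2 m e e = 1 & ww_averages chi e].
  have [|nf] := pselect (frequency chi); last by exists (fun=> 0).
  move=> [hchi [f cf [c hc c0]]]; have [e [le e1 ww]] := frequency_vector hchi cf hc c0.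
  by exists e => _; split => //; exact: frequency_eigen.
by have [e he] := choice H; exists e.
Qed.

Lemma trivial_frequency : frequency (fun=> 1).
Proof.
split; first exact: char_cst1.
exists (fun=> 1); first exact (bcont_cst _ (1 : C)).1.
exists 1; last exact: oner_neq0.
rewrite (_ : (fun t => _) = (fun=> 1)); first exact: (@has_mean_cst R G p 1).
by apply/funext => t; rewrite /along_orbit conjC1 mulr1.
Qed.

Section system.
Variable e : (G -> C) -> XB -> C.
Hypothesis he : forall chi, frequency chi ->
  [/\ dyn_eigenspace m chi (e chi), innerL2 m (e chi) (e chi) = 1 & ww_averages chi (e chi)].

Let fchar chi (h : frequency chi) : is_character chi := h.1.
Let eE chi (h : frequency chi) : dyn_eigenspace m chi (e chi).
Proof. by have [] := he h. Qed.
Let eL2 chi (h : frequency chi) : L2 m (e chi) := (eE h).1.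
Let e1 chi (h : frequency chi) : innerL2 m (e chi) (e chi) = 1.
Proof. by have [] := he h. Qed.
Let eww chi f (h : frequency chi) : continuous f ->
  has_mean p (fun t => along f t * (chi t)^*) (innerL2 m (f : XB -> C) (e chi)).
Proof. by move=> cf; have [_ _ /(_ f cf)] := he h. Qed.
Let eorth chi psi : frequency chi -> frequency psi -> chi <> psi ->
  innerL2 m (e chi) (e psi) = 0.
Proof.
move=> hc hp ne; exact: (eigenspaces_orth im (fchar hc) (fchar hp) ne (eE hc) (eE hp)).
Qed.

(** The function f is approximated along the orbit by a polynomial with
    frequencies of the orbit only, and the quality of the approximation is
    the same in L2. *)
Lemma system_approx_cont f eps : continuous f -> 0 < eps ->
  exists n (a : 'I_n -> C) (chi : 'I_n -> G -> C), (forall i, frequency (chi i)) /\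
    nrm m (fun x : XB => f x - \sum_(i < n) a i * e (chi i) x) <= eps.
Proof.
move=> cf eps0.
have nof psi : is_character psi -> ~ frequency psi ->
    has_mean p (fun t => along f t * (psi t)^*) 0.
  move=> hpsi nf; have [l hl] := bap_char_mean asymp hpsi (along_bap cf).
  have [l0|l0] := eqVneq l 0; first by rewrite -l0.
  by case: nf; split=> //; exists f => //; exists l.
have [n [a [psi [hpsi Spsi hb]]]] := restrict_frequencies asymp (along_bap cf) eps0 nof.
(* frequencies with a zero coefficient are replaced by the trivial one, which
   always is a frequency *)
pose chi i := if a i == 0 then (fun=> 1) else psi i.
have Sc i : frequency (chi i).
  rewrite /chi; case: eqVneq => [_|a0]; first exact: trivial_frequency.
  by case: (Spsi i) => // a0'; rewrite a0' eqxx in a0.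
exists n, a, chi; split=> //.
have cv := nrm_combination_cvg asymp contb corb mean_int fchar eL2 e1 eorth
  (fun psi f h cf => eww h cf) cf (a := a) Sc.
apply: (bnle_lim cv); rewrite (_ : (fun t => _) = (fun t => along f t - \sum_(i < n) a i * psi i t)) //.
apply/funext => t; congr (_ - _); apply: eq_bigr => i _; rewrite /chi.
by case: eqVneq => [->|//]; rewrite !mul0r.
Qed.

Lemma system_approx (h : XB -> C) eps : L2 m h -> 0 < eps ->
  exists n (a : 'I_n -> C) (chi : 'I_n -> G -> C), (forall i, frequency (chi i)) /\
    nrm m (fun x : XB => h x - \sum_(i < n) a i * e (chi i) x) < eps.
Proof.
move=> lh eps0; have e2 : 0 < eps / 2 by rewrite divr_gt0.
have [_ /(_ _ e2)[g bg hg]] := bcont_dense oX lh.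
have [n [a [chi [Sc hn]]]] := system_approx_cont bg.1 e2.
exists n, a, chi; split=> //.
have ls : L2 m (fun x : XB => \sum_(i < n) a i * e (chi i) x).
  by apply: L2_sum => i; apply: L2Z; exact: eL2.
apply: le_lt_trans (nrm_tri lh (bcont_L2 m bg) ls) _.
by have := ltr_leD hg hn; rewrite -splitr.
Qed.

Lemma system_total (h : XB -> C) : L2 m h ->
  (forall chi, frequency chi -> innerL2 m h (e chi) = 0) -> {ae m, forall x, h x = 0}.
Proof.
move=> lh h0; apply: nrm_eq0 => //.
have hle eps : 0 < eps -> nrm m h <= eps.
  move=> eps0; have [n [a [chi [Sc hn]]]] := system_approx lh eps0.
  have le i : L2 m (fun x => a i * e (chi i) x) by apply: L2Z; exact: eL2.
  have ls := L2_sum le.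
  have i0 : innerL2 m (fun x => \sum_(i < n) a i * e (chi i) x) h = 0.
    rewrite (innerL2_suml le lh) big1// => i _.
    by rewrite (innerL2Z _ (eL2 (Sc i)) lh) (innerL2_conj lh (eL2 (Sc i))) (h0 _ (Sc i)) conjC0 mulr0.
  have E : innerL2 m h (fun x => h x - \sum_(i < n) a i * e (chi i) x) = ofR (nrm m h ^+ 2).
    rewrite (innerL2Br lh ls lh) (innerL2_self lh) nrm_sq.
    by rewrite (innerL2_conj ls lh) i0 conjC0 subr0.
  have := Cauchy_Schwarz lh (L2B lh ls); rewrite E absC_ofR ger0_norm ?sqr_ge0//.
  have [->|n0] := eqVneq (nrm m h) 0; first by move=> _; exact: ltW.
  have n1 : 0 < nrm m h by rewrite lt_neqAle eq_sym n0 nrm_ge0.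
  by rewrite expr2 ler_pM2l// => /le_trans; apply; exact: ltW.
apply/le_anti; rewrite nrm_ge0 andbT; apply/ler_addgt0Pr => eps eps0.
by rewrite add0r; exact: hle.
Qed.

(** The difference is orthogonal to all the vectors of a total system. *)
Lemma system_line chi (h : XB -> C) : frequency chi -> dyn_eigenspace m chi h ->
  {ae m, forall x, h x = innerL2 m h (e chi) * e chi x}.
Proof.
move=> hc Eh; have lz := L2Z (innerL2 m h (e chi)) (eL2 hc).
have : {ae m, forall x, h x - innerL2 m h (e chi) * e chi x = 0}.
  apply: system_total (L2B Eh.1 lz) _ => psi hp.
  rewrite (innerL2B Eh.1 lz (eL2 hp)) (innerL2Z _ (eL2 hc) (eL2 hp)).
  have [<-|ne] := pselect (chi = psi); first by rewrite (e1 hc) mulr1 subrr.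
  rewrite (eorth hc hp ne) mulr0 subr0.
  exact: (eigenspaces_orth im (fchar hc) (fchar hp) ne Eh (eE hp)).
by apply: filterS => x /eqP; rewrite subr_eq0 => /eqP.
Qed.

(** An eigenfunction for another character would be orthogonal to a
    total system. *)
Lemma eigenvalue_frequency chi : dyn_eigenvalue m chi -> frequency chi.
Proof.
move=> [h [hc Eh nh]]; apply: contrapT => nf; apply: nh.
apply: (system_total Eh.1) => psi hp.
apply: (eigenspaces_orth im hc (fchar hp) _ Eh (eE hp)) => cp.
by apply: nf; rewrite cp.
Qed.

Lemma system_neq0 chi : frequency chi -> ~ {ae m, forall x, e chi x = 0}.
Proof.
move=> hc h0; have := innerL2_self (eL2 hc); rewrite (e1 hc) -nrm_sq (ae_nrm0 (eL2 hc) h0).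
by rewrite expr0n/= => /(congr1 (@reC R)); rewrite reC_ofR reC1 => /eqP; rewrite oner_eq0.
Qed.

Lemma system_pure_point : pure_point_spectrum m.
Proof.
exists [set e chi | chi in frequency]; last first.
  move=> _ [chi hc <-]; exists chi; split; [exact: fchar|exact: eE|exact: system_neq0].
split.
- by move=> _ [chi hc <-]; exact: eL2.
- by move=> _ [chi hc <-]; exact: e1.
- move=> _ _ [chi hc <-] [psi hp <-] ne; apply: eorth => // cp.
  by apply: ne; rewrite cp.
move=> h lh eps eps0.
have s0 : 0 < Num.sqrt eps by rewrite sqrtr_gt0.
have [n [a [chi [Sc hn]]]] := system_approx lh s0.
exists n, a, (fun i => e (chi i)); split; first by move=> i; exists (chi i).
have le i : L2 m (fun x => a i * e (chi i) x) by apply: L2Z; exact: eL2.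
rewrite (dist2L2_nrm lh (L2_sum le)) lte_fin -[ltRHS](sqr_sqrtr (ltW eps0)).
by rewrite ltr_sqr ?nnegrE ?nrm_ge0 ?sqrtr_ge0.
Qed.

Lemma system_basis chi : frequency chi -> ae_basis m (dyn_eigenspace m chi) [set e chi].
Proof.
move=> hc; split.
- by move=> _ ->; exact: eE.
- move=> n a f finj fe h0 i.
  have ai : {ae m, forall x, a i * e chi x = 0}.
    apply: filterS h0 => x; rewrite (bigD1 i)//= big1 ?addr0 ?fe// => j ji.
    by case/eqP: ji; apply: finj; rewrite !fe.
  apply/eqP; rewrite -absC_eq0.
  have := ae_nrm0 (L2Z (a i) (eL2 hc)) ai; rewrite (nrmZ _ (eL2 hc)) => /eqP.
  rewrite mulf_eq0 => /orP[//|/eqP n0]; case: (system_neq0 hc).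
  exact: (nrm_eq0 (eL2 hc)).
- move=> h Eh; exists 1%N, (fun=> innerL2 m h (e chi)), (fun=> e chi); split=> //.
  by apply: filterS (system_line hc Eh) => x ->; rewrite big_ord1.
Qed.

End system.

Theorem besicovitch_pure_point : pure_point_spectrum m.
Proof. by have [e he] := frequency_system; exact: system_pure_point he. Qed.

Theorem besicovitch_wiener_wintner chi : dyn_eigenvalue m chi ->
  exists B : set (XB -> C),
  [/\ ae_basis m (dyn_eigenspace m chi) B,
      forall e, B e -> innerL2 m e e = 1 &
      forall e, B e -> ww_averages chi e].
Proof.
have [e he] := frequency_system => ev; have hc := eigenvalue_frequency he ev.
have [_ e1 ww] := he _ hc.
by exists [set e chi]; split; [exact: system_basis he _ hc|move=> _ ->|move=> _ ->].
Qed.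

End from_besicovitch.

(** * The invariant measure of an almost periodic orbit *)

Section continuous_real.
Context (R : realType) (T : topologicalType).

Lemma cstR_continuous (c : R) : continuous (fun _ : T => c).
Proof. by move=> x; exact: cvg_cst. Qed.

Lemma linR_continuous (a : R) (f g : T -> R) : continuous f -> continuous g ->
  continuous (fun x => a * f x + g x).
Proof.
move=> cf cg x; apply: cvgD; last exact: cg.
by apply: cvgM; [exact: cvg_cst|exact: cf].
Qed.

Lemma normR_continuous (f : T -> R) : continuous f -> continuous (fun x => `|f x|).
Proof. by move=> cf x; apply: cvg_norm; exact: cf. Qed.

End continuous_real.

Section hull_system.
Context (R : realType) (G : topologicalZmodType).
Local Notation C := (Cx R).
Local Notation GB := (borel (0 : G)).
Variables (mu : radon R G) (p : nat -> probability GB R).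
Hypothesis asymp : forall (F : G -> C) (s : G), bcont F ->
  integralC (p n) setT (fun t : GB => F ((t : G) + s)) -
  integralC (p n) setT (F : GB -> C) @[n --> \oo] --> (0 : C).
Local Notation X := (hull mu).
Local Notation XB := (borel (hull_base mu)).
Hypothesis cX : compact [set: X].
Hypothesis oX : open_approx R X.
Hypothesis corb : continuous (orbit_pt mu).
Local Notation along := (@along_orbit R G mu).

Lemma compact_bcont (f : X -> C) : continuous f -> bcont f.
Proof.
move=> cf; split=> //.
have ca : continuous (fun w => absC (f w)).
  by move=> w; apply: (@cvg_absC R X (nbhs w) (nbhs_filter w)); exact: cf.
have : compact (range (fun w => absC (f w))).
  by apply: continuous_compact => //; exact: continuous_subspaceT.
move=> /compact_bounded[M [_ hM]]; exists (`|M| + 1) => w.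
rewrite -[leLHS]ger0_norm ?absC_ge0//; apply: (hM (`|M| + 1)); last by exists w.
by rewrite (le_lt_trans (ler_norm _))// ltrDl.
Qed.

Local Notation contb := compact_bcont.

Lemma continuous_ofR (u : X -> R) : continuous u -> continuous (fun w => ofR (u w) : C).
Proof. by move=> cu w; apply: (@cvg_ofR R X (nbhs w) (nbhs_filter w)); exact: cu. Qed.

Lemma continuous_reC (f : X -> C) : continuous f -> continuous (fun w => reC (f w)).
Proof. by move=> cu w; apply: (@cvg_reC R X (nbhs w) (nbhs_filter w)); exact: cu. Qed.

Lemma continuous_imC (f : X -> C) : continuous f -> continuous (fun w => imC (f w)).
Proof. by move=> cu w; apply: (@cvg_imC R X (nbhs w) (nbhs_filter w)); exact: cu. Qed.

Lemma along_reim (f : X -> C) : along f =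
  (fun t => along (fun w => ofR (reC (f w))) t + 'i * along (fun w => ofR (imC (f w))) t).
Proof. by apply/funext => t; rewrite /along_orbit -Cx_rect. Qed.

Section almost_periodic_orbit.
Hypothesis ev_bap : forall phi : Cc R G, bap p (along (fun w => val w phi)).

(** The real functions on the hull that are Besicovitch almost periodic along the
    orbit form a uniformly closed vector lattice. It contains the real and
    imaginary parts of the evaluations at test functions, which separate the
    points of the hull. *)
Lemma along_bap_real (u : X -> R) : continuous u -> bap p (along (fun w => ofR (u w))).
Proof.
pose L := [set u : X -> R | continuous u /\ bap p (along (fun w => ofR (u w)))].
have reL (f : X -> C) : continuous f -> bap p (along f) -> L (fun w => reC (f w)).
  by move=> cf bf; split; [exact: continuous_reC|exact: bap_re bf].
suff H : forall u : X -> R, continuous u -> L u by move=> cu; exact: (H u cu).2.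
move=> {}u cu; apply: (stone_weierstrass cX _ _ _ _ _ _ cu).
- by move=> f [].
- move=> c; split; first exact: cstR_continuous.
  exact (bap_trig p (trig_cst G (ofR c))).
- move=> a f g [cf bf] [cg bg]; split; first exact: linR_continuous.
  have := bapD (bapZ (ofR a) bf) bg; congr (bap p _).
  by apply/funext => t; rewrite /along_orbit ofRD ofRM.
- move=> f [cf bf]; split; last exact: (bap_abs bf).
  exact: normR_continuous.
- move=> f cf hf; split=> //.
  apply: bap_lim (along_bcont contb corb (continuous_ofR cf)) _ => e e0.
  have [g [_ bg] fg] := hf e e0; exists (along (fun w => ofR (g w))) => // t.
  rewrite /along_orbit (_ : _ - _ = ofR (f (orbit_pt mu t) - g (orbit_pt mu t))).
    by rewrite absC_ofR.
  by rewrite ofRD ofRN.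
- move=> x y xy.
  have [phi hphi] : exists phi : Cc R G, val x phi <> val y phi.
    by apply/existsNP => h; apply: xy; exact: hull_ext.
  (* points are separated by the real part or by the imaginary part, which is
     the real part after multiplication by - i *)
  have [re|re] := pselect (reC (val x phi) = reC (val y phi)).
    exists (fun w : X => reC (- 'i * (val w phi : C))).
      apply: reL; last exact: bapZ (ev_bap phi).
      exact: (bcontZ _ (contb (hull_ev_continuous (phi := phi)))).1.
    by move=> h; apply: hphi; apply: Cx_ext => //; move: h; rewrite !CE; lra.
  exists (fun w : X => reC (val w phi : C)) => //; apply: reL (ev_bap phi).
  exact: hull_ev_continuous.
Qed.

Lemma along_bap (f : X -> C) : continuous f -> bap p (along f).
Proof.
move=> cf; rewrite along_reim; apply: bapD; first exact: along_bap_real (continuous_reC cf).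
by apply: bapZ; exact: along_bap_real (continuous_imC cf).
Qed.

(** The mean along the orbit is a positive normalised functional on the continuous
    functions, hence an integral. It is translation invariant, and so is the
    representing measure. *)
Lemma orbit_measure : exists m : probability XB R, invariant_measure m /\
  forall f : X -> C, continuous f -> has_mean p (along f) (integralC m setT (f : XB -> C)).
Proof.
have H (u : X -> R) : exists l : R, continuous u -> has_mean p (along (fun w => ofR (u w))) (ofR l).
  have [cu|] := pselect (continuous u); last by exists 0.
  have bu := along_bap_real cu; have [l hl] := bap_has_mean asymp bu.
  exists (reC l) => _.
  (* a real function equals its conjugate, hence so does its mean *)
  suff -> : ofR (reC l) = l by [].
  have := has_mean_conj bu.1 hl.
  have -> : (fun t => (along (fun w => ofR (u w)) t)^*) = along (fun w => ofR (u w)).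
    by apply/funext => t; rewrite /along_orbit (Cx_ext (z := _^*) (w := ofR (u (orbit_pt mu t)))) ?CE ?oppr0.
  move=> /(has_mean_unique hl) E; apply: Cx_ext; rewrite !CE//.
  by have := congr1 (@imC R) E; rewrite imC_conj; lra.
have [L hL] := choice H.
have bo u : continuous u -> bcont (along (fun w => ofR (u w))).
  by move=> cu; exact: (along_bcont contb corb (continuous_ofR cu)).
have ofR_inj (a b : R) : ofR a = ofR b -> a = b.
  by move/(congr1 (@reC R)); rewrite !reC_ofR.
have Llin (a : R) (f g : X -> R) : continuous f -> continuous g ->
    L (fun x => a * f x + g x) = a * L f + L g.
  move=> cf cg; apply: ofR_inj; rewrite ofRD ofRM.
  have cfg : continuous (fun x => a * f x + g x).
    exact: linR_continuous.
  apply: (has_mean_unique (hL _ cfg)).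
  have := has_meanD (bcontZ (ofR a) (bo _ cf)) (bo _ cg) (has_meanZ (c := ofR a) (bo _ cf) (hL _ cf)) (hL _ cg).
  by congr has_mean; apply/funext => t; rewrite /along_orbit ofRD ofRM.
have Lpos (f : X -> R) : continuous f -> (forall x, 0 <= f x) -> 0 <= L f.
  move=> cf f0; have h := cvg_reC eventually_filter (hL _ cf); rewrite reC_ofR in h.
  rewrite -(cvg_lim _ h)//; apply: limr_ge; first by apply/cvg_ex; exists (L f).
  apply: nearW => n; rewrite /mean /integralC !CE mul0r mul1r subr0 addr0.
  by apply: Rintegral_ge0 => t _; rewrite /along_orbit reC_ofR.
have c1 : continuous (fun _ : X => 1 : R) by exact: cstR_continuous.
have L1 : L (fun=> 1) = 1.
  by apply: ofR_inj; apply: (has_mean_unique (hL _ c1)); exact: (@has_mean_cst R G p (ofR 1)).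
have [m [mL minv]] := riesz_representation (hull_base mu) cX oX Llin Lpos L1.
exists m; split.
  move=> t B mB; apply: (minv _ (hull_shift (- t))) => //.
  - exact: hull_shift_continuous.
  - exact: hull_shift_continuous.
  - exact: hull_shiftK.
  - exact: hull_shiftNK.
  move=> f cf; apply: ofR_inj.
  have cft : continuous (f \o hull_shift t).
    by move=> w; apply: continuous_comp; [exact: hull_shift_continuous|exact: cf].
  apply: (has_mean_unique (hL _ cft)).
  have := has_mean_translate asymp (- t) (bo _ cf) (hL _ cf).
  congr has_mean; apply/funext => s.
  by rewrite /along_orbit /= /orbit_pt hull_shiftD opprB.
move=> f cf; rewrite along_reim /integralC (mL _ (continuous_reC cf)) (mL _ (continuous_imC cf)).
have b1 := bo _ (continuous_reC cf); have b2 := bo _ (continuous_imC cf).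
exact: (has_meanD b1 (bcontZ 'i b2) (hL _ (continuous_reC cf)) (has_meanZ (c := 'i) b2 (hL _ (continuous_imC cf)))).
Qed.

End almost_periodic_orbit.
End hull_system.

(** * Besicovitch almost periodic measures *)

Lemma limn_esup_lt_near (R : realType) (u : nat -> \bar R) (c : \bar R) :
  (limn_esup u < c)%E -> \forall n \near \oo, (u n < c)%E.
Proof.
move=> /ereal_inf_lt[_ [V hV <-] Vc]; apply: filterS hV => n Vn.
by apply: le_lt_trans Vc; apply: ereal_sup_ubound; exists n.
Qed.

Lemma near_limn_esup_le (R : realType) (u : nat -> \bar R) (c : \bar R) :
  (\forall n \near \oo, (u n <= c)%E) -> (limn_esup u <= c)%E.
Proof.
move=> h; apply: (@le_trans _ _ (ereal_sup (u @` [set n | (u n <= c)%E]))).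
  by apply: ereal_inf_lbound; exists [set n | (u n <= c)%E].
by apply: ub_ereal_sup => _ [n /= un <-].
Qed.

Section besicovitch_functions.
Context (R : realType) (G : topologicalZmodType).
Local Notation C := (Cx R).
Local Notation GB := (borel (0 : G)).
Variables (theta : {measure set GB -> \bar R}) (A : nat -> set G).
Hypothesis hG : hausdorff_space G.
Hypothesis haar : is_haar theta.
Hypothesis vh : van_hove theta A.
Local Notation p := (avg haar vh).

Lemma mean_avgE n (F : G -> C) : bcont F ->
  mean p n F = ofR (fine (theta (A n)))^-1 * integralC theta (A n) F.
Proof.
move=> bF; apply: integralC_nrestr; split; last exact: bF.2.
exact: continuous_mfunC bF.1.
Qed.

Lemma nrm1_avgE n (F : G -> C) : bcont F ->
  ((fine (theta (A n)))^-1%:E * \int[theta]_(t in A n) (absC (F t))%:E)%E =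
  (nrm1 (p n) F)%:E.
Proof.
move=> bF; have iF := nrm1_int (p n) bF.
rewrite /nrm1 /Rintegral fineK; last exact: integrable_fin_num.
rewrite [RHS](ge0_integral_nrestr (borel_A vh n) (A_gt0 vh n) (A_fin haar vh n)) //.
  exact: measurable_int iF.
by move=> t; rewrite lee_fin absC_ge0.
Qed.

Lemma bcont_L1loc (F : G -> C) : bcont F -> L1loc theta F.
Proof.
move=> bF; split; first exact: continuous_mfunC bF.1.
move=> K cK; have [_ [M FM]] := bF; have [_ Kfin _ _ _] := haar.
have mK : measurable (K : set GB) by exact: closed_borel (compact_closed hG cK).
have mF : measurable_fun setT (fun t : GB => (absC (F t))%:E).
  by apply/measurable_EFinP; apply: mfunC_abs; exact: continuous_mfunC bF.1.
apply: (@le_lt_trans _ _ (\int[theta]_(t in K) M%:E)%E).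
  apply: ge0_le_integral => //.
  - by move=> t _; rewrite lee_fin absC_ge0.
  - exact: measurable_funTS.
  - by move=> t _; rewrite lee_fin FM.
rewrite integral_cst//; have : theta (K : set GB) \is a fin_num.
  by rewrite ge0_fin_numE// Kfin.
by move/fineK <-; rewrite -EFinM ltry.
Qed.

(** For bounded continuous functions local integrability is automatic, and the
    normalised integrals over A n are the one-norms for the averaging measures. *)
Lemma besicovitch_ap_funE (F : G -> C) : bcont F -> besicovitch_ap_fun theta A F <-> bap p F.
Proof.
move=> bF; split=> [[_ h]|[_ h]].
  split=> // e e0; have [P tP hP] := h e e0; exists P => //.
  apply: filterS (limn_esup_lt_near hP) => n.
  by rewrite (nrm1_avgE n (bcontB bF (trig_bcont tP))) lte_fin.
split; first exact: bcont_L1loc.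
move=> e e0; have e2 : 0 < e / 2 by rewrite divr_gt0.
have [P tP hP] := h _ e2; exists P => //.
apply: (@le_lt_trans _ _ (e / 2)%:E); last by rewrite lte_fin; lra.
apply: near_limn_esup_le; apply: filterS hP => n hn.
by rewrite (nrm1_avgE n (bcontB bF (trig_bcont tP))) lee_fin ltW.
Qed.

End besicovitch_functions.

Theorem theorem7p27 (R : realType) (G : topologicalZmodType)
    (theta : {measure set (borel (0 : G)) -> \bar R})
    (A : nat -> set G) (mu : radon R G) :
  hausdorff_space G ->
  locally_compact [set: G] ->
  sigma_compact G ->
  is_haar theta ->
  van_hove theta A ->
  translation_bounded mu ->
  metrisable R (hull mu) ->
  (besicovitch_ap theta A mu <->
   exists m : probability (borel (hull_base mu)) R,
     [/\ invariant_measure m, pure_point_spectrum m &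
         wiener_wintner m theta A]) /\
  (forall m : probability (borel (hull_base mu)) R,
     invariant_measure m -> pure_point_spectrum m ->
     wiener_wintner m theta A -> ergodic m).
Proof.
move=> hG lcG _ haar vh tb met.
pose p := avg haar vh.
have asymp := @avg_asymp_invariant _ _ _ _ hG haar vh.
have cX := @hull_compact _ _ hG lcG mu tb.
have oX := metrisable_open_approx met.
have corb := @orbit_continuous _ _ hG lcG mu tb.
have contb := @compact_bcont _ _ mu cX.
have ab f (cf : continuous f) : bcont (along_orbit (mu := mu) f) := along_bcont contb corb cf.
have evc (phi : Cc R G) : continuous (fun w : hull mu => val w phi).
  exact: hull_ev_continuous.
have convE (phi : Cc R G) : Defs.conv mu phi = along_orbit (fun w : hull mu => val w (Cc_refl 0 phi)).
  by apply/funext => t; exact: conv_orbit.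
have wwE (m : probability (borel (hull_base mu)) R) chi e : is_character chi ->
    ww_averages p m chi e <-> forall f : hull mu -> Cx R, continuous f ->
      ofR (fine (theta (A n)))^-1 * integralC theta (A n)
        (fun t : G => (chi t)^* * f (hull_shift (- t) (hull_base mu))) @[n --> \oo] --> innerL2 m f e.
  move=> hc; have E f : continuous f ->
      mean p ^~ (fun t => along_orbit (mu := mu) f t * (chi t)^*) =
      (fun n => ofR (fine (theta (A n)))^-1 * integralC theta (A n)
        (fun t : G => (chi t)^* * f (hull_shift (- t) (hull_base mu)))).
    move=> cf; apply/funext => n.
    rewrite (mean_avgE haar vh n (bcontM (ab f cf) (bcont_conj (char_bcont hc)))).
    by congr (_ * integralC _ _ _); apply/funext => t; rewrite mulrC.
  by split=> h f cf; have := h f cf; rewrite /has_mean E.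
have ww (m : probability (borel (hull_base mu)) R) : wiener_wintner m theta A <->
    forall chi, dyn_eigenvalue m chi -> exists B : set (borel (hull_base mu) -> Cx R),
      [/\ ae_basis m (dyn_eigenspace m chi) B, forall e, B e -> innerL2 m e e = 1 &
          forall e, B e -> ww_averages p m chi e].
  split=> h chi ev; have hc : is_character chi by case: ev => ? [].
    have [B [bB B1 hB]] := h chi ev; exists B; split => // e Be.
    by apply/(wwE m chi e hc) => f cf; exact: hB.
  have [B [bB B1 hB]] := h chi ev; exists B; split => // f cf e Be.
  exact: ((wwE m chi e hc).1 (hB e Be) f cf).
split; last first.
  by move=> m _ _ /ww hww; exact: (ww_ergodic oX hww).
split=> [hmu|[m [im pp /ww hww]] phi].
  have ev_bap phi : bap p (along_orbit (fun w : hull mu => val w phi)).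
    (* reflection at 0 is an involution *)
    have -> : (fun w : hull mu => val w phi) =
        (fun w : hull mu => val w (Cc_refl 0 (Cc_refl 0 phi))).
      apply/funext => w; congr (val w _); apply: val_inj; apply/funext => x /=.
      by rewrite !sub0r opprK.
    by rewrite -convE; apply/(besicovitch_ap_funE hG haar vh) => //; rewrite convE; exact: (ab _ (evc _)).
  have [m [im mean_int]] := orbit_measure asymp cX oX corb ev_bap.
  have allbap (f : hull mu -> Cx R) (cf : continuous f) := along_bap cX corb ev_bap cf.
  exists m; split=> //.
    exact: (besicovitch_pure_point asymp contb oX corb allbap im mean_int).
  apply/ww => chi ev.
  exact: (besicovitch_wiener_wintner asymp contb oX corb allbap im mean_int ev).
apply/(besicovitch_ap_funE hG haar vh); rewrite convE; first exact: (ab _ (evc _)).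
exact: (ww_bap asymp contb oX corb im hww pp (evc _)).
Qed.
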